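(* Let $n\geq 3$ be an integer. There exist a constant $C_n>0$ depending only on $n$, a measurable symmetric matrix field $A\colon\mathbb{B}^n\to\mathrm{Sym}_n$ with $$|\xi|^2\leq A(x)\xi\cdot\xi\leq\Lambda(x)|\xi|^2\qquad\text{for a.e. }x\in\mathbb{B}^n\text{ and all }\xi\in\mathbb{R}^n,$$ where, with $r=|x|$, $$\Lambda(x)=\Lambda(r)=C_n\Bigl(\log\bigl(e+\log\tfrac1r\bigr)\Bigr)^2,$$ and a weak solution $u\in H^1(\mathbb{B}^n,A)$ of $$\operatorname{div}(A\,\mathrm{D}u)=0\quad\text{in }\mathbb{B}^n$$ with no continuous representative at the origin (that is, no function which equals $u$ almost everywhere in $\mathbb{B}^n$ is continuous at $0$).
   Context: $\mathbb{B}^n$ is the open unit ball of $\mathbb{R}^n$ centred at the origin, and $\mathrm{Sym}_n$ is the space of real symmetric $n\times n$ matrices. $\mathrm{D}u=\nabla u$ denotes the gradient. For a symmetric matrix field $A$ with upper ellipticity function $\Lambda$ as in the claim, $H^1(\mathbb{B}^n,A)$ denotes the completion of $C^1(\mathbb{B}^n)$ (i.e. of the $C^1$ functions for which the norm is finite) under the norm $$\|v\|_{H^1(\mathbb{B}^n,A)}^2=\int_{\mathbb{B}^n}\bigl(A\nabla v\cdot\nabla v+\Lambda v^2\bigr)\,dx,$$ and $H^1_0(\mathbb{B}^n,A)$ is the corresponding closure of $C^1_c(\mathbb{B}^n)$. Since $A\ge\mathrm{Id}$ and $\Lambda$ is bounded below by a positive constant, elements of $H^1(\mathbb{B}^n,A)$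 are identified with functions in $W^{1,2}(\mathbb{B}^n)$. A function $u\in H^1(\mathbb{B}^n,A)$ is a weak solution of $\operatorname{div}(A\,\mathrm{D}u)=0$ in $\mathbb{B}^n$ if $$\int_{\mathbb{B}^n}A\nabla u\cdot\nabla\varphi\,dx=0\qquad\text{for every }\varphi\in H^1_0(\mathbb{B}^n,A).$$ *)

(* Defs.v *)
From HB Require Import structures.
From mathcomp Require Import all_boot all_order all_algebra.
From mathcomp Require Import all_classical all_reals all_analysis.

Set Implicit Arguments.
Unset Strict Implicit.
Unset Printing Implicit Defensive.

Import Order.TTheory GRing.Theory Num.Theory.
Import numFieldNormedType.Exports.

Local Open Scope classical_set_scope.
Local Open Scope ring_scope.

(* The sigma-algebra generated by the entries; on ['rV[R]_n] it is the Borel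
   sigma-algebra of R^n. *)
Definition matrix_measure_display : measure_display -> measure_display.
Proof. exact. Qed.

Section matrix_measurable.
Context {d : measure_display} {T : measurableType d} (m n : nat).

Definition matrix_measurable : set (set 'M[T]_(m, n)) :=
  <<s \bigcup_(ij in [set: 'I_m * 'I_n])
        preimage_set_system setT (fun M : 'M[T]_(m, n) => M ij.1 ij.2)
          measurable >>.

Let matrix_measurable0 : matrix_measurable set0.
Proof. exact: sigma_algebra0. Qed.

Let matrix_measurableC A : matrix_measurable A -> matrix_measurable (~` A).
Proof. exact: sigma_algebraC. Qed.

Let matrix_measurable_bigcup (F : (set 'M[T]_(m, n))^nat) :
  (forall i, matrix_measurable (F i)) -> matrix_measurable (\bigcup_i F i).
Proof. exact: sigma_algebra_bigcup. Qed.

HB.instance Definition _ := @isMeasurable.Build (matrix_measure_display d)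
  'M[T]_(m, n) matrix_measurable
  matrix_measurable0 matrix_measurableC matrix_measurable_bigcup.

End matrix_measurable.

Lemma measurable_fun_matrixP d1 d2 (S : measurableType d1)
    (T : measurableType d2) m n (f : S -> 'M[T]_(m, n)) :
  measurable_fun setT f <->
  forall i j, measurable_fun setT (fun x => f x i j).
Proof.
split=> [mf i j _ Y mY|mf _ Y mY].
  rewrite setTI; have := mf measurableT [set M | Y (M i j)].
  rewrite setTI; apply; apply: sub_sigma_algebra.
  by exists (i, j) => //; exists Y => //; rewrite setTI.
rewrite setTI.
suff : @matrix_measurable d2 T m n `<=` image_set_system setT f measurable.
  by move=> /(_ Y mY); rewrite /image_set_system/= setTI.
apply: smallest_sub; first exact/sigma_algebra_image/sigma_algebra_measurable.
move=> _ [[i j] _ [B mB <-]]; rewrite /image_set_system/= setTI.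
by have := mf i j measurableT B mB; rewrite !setTI.
Qed.

Section lebesgue_rV.
Context {R : realType}.
Local Open Scope ereal_scope.

Definition consrV n (p : R * 'rV[R]_n) : 'rV[R]_n.+1 :=
  row_mx p.1%:M p.2 : 'rV[R]_(1 + n).

Lemma consrV0 n (p : R * 'rV[R]_n) : consrV p ord0 ord0 = p.1.
Proof.
rewrite /consrV (_ : ord0 = @lshift 1 n ord0 :> 'I_(1 + n)); last exact: val_inj.
by rewrite (row_mxEl (p.1%:M : 'rV_1)) mxE eqxx mulr1n.
Qed.

Lemma consrVS n (p : R * 'rV[R]_n) (j : 'I_n) :
  consrV p ord0 (lift ord0 j) = p.2 ord0 j.
Proof.
rewrite /consrV (_ : lift ord0 j = @rshift 1 n j :> 'I_(1 + n));
  last exact: val_inj.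
by rewrite (row_mxEr (p.1%:M : 'rV_1)).
Qed.

Lemma measurable_consrV n : measurable_fun [set: R * 'rV[R]_n] (@consrV n).
Proof.
apply/measurable_fun_matrixP => i j; rewrite (ord1 i).
case: (unliftP ord0 j) => [k ->|->].
  under eq_fun do rewrite consrVS.
  have /measurable_fun_matrixP := @measurable_snd _ _ R 'rV[R]_n; exact.
under eq_fun do rewrite consrV0.
exact: measurable_fst.
Qed.

Definition unconsrV n (v : 'rV[R]_n.+1) : R * 'rV[R]_n :=
  (v ord0 ord0, \row_j v ord0 (lift ord0 j)).

Lemma consrVK n : cancel (@consrV n) (@unconsrV n).
Proof.
move=> p; rewrite [RHS]surjective_pairing /unconsrV consrV0; congr pair.
by apply/rowP => j; rewrite mxE consrVS.
Qed.

Lemma measurable_unconsrV n : measurable_fun [set: 'rV[R]_n.+1] (@unconsrV n).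
Proof.
have mc i : measurable_fun [set: 'rV[R]_n.+1] (fun v => v ord0 i).
  by have /measurable_fun_matrixP := @measurable_id _ 'rV[R]_n.+1 setT; exact.
apply/measurable_fun_pair; first exact: mc.
apply/measurable_fun_matrixP => i j.
by under eq_fun do rewrite mxE; exact: mc.
Qed.

Section lebesgue_cons.
Context n (mu : {sigma_finite_measure set 'rV[R]_n -> \bar R}).

Definition lebesgue_cons : set 'rV[R]_n.+1 -> \bar R :=
  pushforward (@lebesgue_measure R \x mu) (@consrV n).

Let lebesgue_cons0 : lebesgue_cons set0 = 0.
Proof. by rewrite /lebesgue_cons /pushforward preimage_set0 measure0. Qed.

Let lebesgue_cons_ge0 A : 0 <= lebesgue_cons A.
Proof. by rewrite /lebesgue_cons /pushforward measure_ge0. Qed.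

Let lebesgue_cons_sigma_additive : semi_sigma_additive lebesgue_cons.
Proof.
move=> F mF tF mUF; rewrite /lebesgue_cons /pushforward preimage_bigcup.
have mpre A : measurable A -> measurable (@consrV n @^-1` A).
  by move=> mA; rewrite -[X in measurable X]setTI; exact: measurable_consrV.
apply: measure_semi_sigma_additive => [k||]; first exact: mpre.
- apply/trivIsetP => /= i j _ _ ij; rewrite -preimage_setI.
  by move/trivIsetP : tF => /(_ _ _ _ _ ij) ->//; rewrite preimage_set0.
- by rewrite -preimage_bigcup; exact: mpre.
Qed.

HB.instance Definition _ := isMeasure.Build _ _ _ lebesgue_cons
  lebesgue_cons0 lebesgue_cons_ge0 lebesgue_cons_sigma_additive.

Let lebesgue_cons_sigma_finite : sigma_finite setT lebesgue_cons.
Proof.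
have /sigma_finiteP[F [TF ndF Foo]] := sigma_finiteT (@lebesgue_measure R).
have /sigma_finiteP[G [TG ndG Goo]] := sigma_finiteT mu.
exists (fun k => @unconsrV n @^-1` (F k `*` G k)).
  apply/esym; rewrite -subTset => v _.
  have [i _ Fi] : (\bigcup_i F i) (unconsrV v).1 by rewrite -TF.
  have [j _ Gj] : (\bigcup_i G i) (unconsrV v).2 by rewrite -TG.
  exists (maxn i j) => //; split.
  - by move: Fi; exact/subsetPset/ndF/leq_maxl.
  - by move: Gj; exact/subsetPset/ndG/leq_maxr.
move=> k; have [mF Fkoo] := Foo k; have [mG Gkoo] := Goo k; split.
  rewrite -[X in measurable X]setTI; apply: measurable_unconsrV => //.
  exact: measurableX.
rewrite /lebesgue_cons /pushforward -comp_preimage.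
rewrite (_ : _ \o _ = id) ?preimage_id; last exact/funext/consrVK.
by rewrite product_measure1E// lte_mul_pinfty// ge0_fin_numE.
Qed.

HB.instance Definition _ := Measure_isSigmaFinite.Build _ _ _ lebesgue_cons
  lebesgue_cons_sigma_finite.

End lebesgue_cons.

(* Lebesgue measure on R^n, by iterated products; R^0 carries the unit mass. *)
Fixpoint lebesgue_rV n : {sigma_finite_measure set 'rV[R]_n -> \bar R} :=
  if n is k.+1 then lebesgue_cons (lebesgue_rV k) else \d_(0%R : 'rV[R]_0).

Lemma lebesgue_rV_box n (X : 'I_n -> set R) : (forall i, measurable (X i)) ->
  lebesgue_rV n [set v : 'rV[R]_n | forall i, X i (v ord0 i)] =
  \prod_(i < n) @lebesgue_measure R (X i).
Proof.
elim: n X => [|n IHn] X mX.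
  by rewrite big_ord0 /= diracE mem_set//= => -[].
have mbox : measurable [set v : 'rV[R]_n | forall i, X (lift ord0 i) (v ord0 i)].
  rewrite (_ : [set _ | _] = \bigcap_(i in [set: 'I_n])
      (fun v : 'rV[R]_n => v ord0 i) @^-1` X (lift ord0 i)); last first.
    by apply/seteqP; split => [v vX i _|v vX i]; exact: vX.
  apply: fin_bigcap_measurable; first exact: finite_finset.
  move=> i _; rewrite -[X in measurable X]setTI.
  have /measurable_fun_matrixP := @measurable_id _ 'rV[R]_n setT.
  by move=> /(_ ord0 i); apply.
rewrite big_ord_recl/= -(IHn (fun i => X (lift ord0 i)))//.
rewrite -product_measure1E//=; last exact: mX.
rewrite /lebesgue_cons /pushforward.
congr (_ _); apply/seteqP; split => -[x v]/=.
  move=> h; split; first by have := h ord0; rewrite consrV0.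
  by move=> i; have := h (lift ord0 i); rewrite consrVS.
move=> [xX vX] i; case: (unliftP ord0 i) => [k ->|->]; rewrite ?consrV0//.
by rewrite consrVS; exact: vX.
Qed.

End lebesgue_rV.

Section degenerate_elliptic.
Context {R : realType} {n : nat}.
Implicit Types (x xi eta : 'rV[R]_n) (u v phi : 'rV[R]_n -> R)
  (G Phi : 'rV[R]_n -> 'rV[R]_n) (A : 'rV[R]_n -> 'M[R]_n)
  (Lam : 'rV[R]_n -> R).

Local Notation leb := (@lebesgue_rV R n).

Definition dotrv xi eta : R := \sum_i xi ord0 i * eta ord0 i.

(* The norm [`|x|] of the library on ['rV[R]_n] is the sup norm. *)
Definition enorm x : R := Num.sqrt (dotrv x x).

Definition unit_ball : set 'rV[R]_n := [set x | enorm x < 1].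

Local Notation B := unit_ball.

(* [M xi], for row vectors. *)
Definition mulmrv (M : 'M[R]_n) xi : 'rV[R]_n := xi *m M^T.

Definition grad v x : 'rV[R]_n := \row_i 'D_(delta_mx ord0 i) v x.

Definition C1_ball v : Prop :=
  forall x, B x -> differentiable v x /\ {for x, continuous (grad v)}.

Definition C1c_ball v : Prop :=
  C1_ball v /\
  let S := closure (B `&` [set x | v x != 0]) in compact S /\ S `<=` B.

Definition L2_ball v : Prop :=
  measurable_fun B v /\ (\int[leb]_(x in B) (v x ^+ 2)%:E < +oo)%E.

Definition weak_gradient u G : Prop :=
  forall phi, C1c_ball phi -> forall i,
  (\int[leb]_(x in B) (u x * grad phi x ord0 i)%:E =
   - \int[leb]_(x in B) (G x ord0 i * phi x)%:E)%E.

(* [u] is in W^{1,2}(B) and [G] is (a representative of) its gradient. *)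
Definition W12_ball u G : Prop :=
  [/\ L2_ball u, forall i, L2_ball (fun x => G x ord0 i) & weak_gradient u G].

Definition H1_normsq A Lam u G : \bar R :=
  (\int[leb]_(x in B)
     (dotrv (mulmrv (A x) (G x)) (G x) + Lam x * u x ^+ 2)%:E)%E.

(* The completion of the functions [v] such that [D v] and
   [H1_normsq A Lam v (grad v) < +oo], realised inside W^{1,2}(B): [u], with
   gradient [G], is a limit of such functions. *)
Definition H1_completion (D : set ('rV[R]_n -> R)) A Lam u G : Prop :=
  W12_ball u G /\
  exists v : nat -> 'rV[R]_n -> R,
    (forall k, D (v k) /\ (H1_normsq A Lam (v k) (grad (v k)) < +oo)%E) /\
    (fun k => H1_normsq A Lam (v k \- u) (grad (v k) \- G)) @ \oo --> 0%E.

Definition H1 := H1_completion C1_ball.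

Definition H10 := H1_completion C1c_ball.

Definition weak_solution A Lam u : Prop :=
  exists2 G, H1 A Lam u G &
  forall phi Phi, H10 A Lam phi Phi ->
    (\int[leb]_(x in B) (dotrv (mulmrv (A x) (G x)) (Phi x))%:E = 0)%E.

Definition elliptic A Lam : Prop :=
  {ae leb, forall x, B x -> forall xi,
     enorm xi ^+ 2 <= dotrv (mulmrv (A x) xi) xi <= Lam x * enorm xi ^+ 2}.

Definition measurable_symmetric A : Prop :=
  measurable_fun B A /\ forall x, B x -> (A x)^T = A x.

Definition loglog_sq (C : R) x : R :=
  C * ln (expR 1 + ln (enorm x)^-1) ^+ 2.

Definition continuous_representative_at0 u : Prop :=
  exists w, {ae leb, forall x, B x -> w x = u x} /\ {for 0, continuous w}.

End degenerate_elliptic.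

(* Main.v *)
(** Write [sigma = x_1 / |x|], [T = log (1/|x|)] up to a bounded term, [L = 2 log T]
    and [v = 1/T].  The solution is [u = (1 + v) tanh (L sigma)]: as [x] tends to 0 it
    tends to 1 on the cone [sigma >= 1/2] and to -1 on the opposite cone.

    The coefficients are read off from a flux.  For every function [m], the field
    [F_i = ((n - 1) m + sum_j x_j D_j m) delta_{i1} - x_i D_1 m] is free of divergence,
    and if [G = Du] satisfies [2 |G|^2 <= F . G] and [|F|^2 <= c F . G], then with
    [h = F - G] the symmetric matrix [A = Id + h h^T / (h . G)] satisfies [A G = F] and
    [Id <= A <= 1 + 2 c].  The choice [m = 64 (L w + v^2) / |x|] with
    [w = 1 - tanh^2 (L sigma)] achieves this with [c] of order [L^2].  The delicate
    region is the cap where [w <= 4 v^2]; there the factor [1 + v] makes the radial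
    derivative of [u] positive, and the term [v^2] in [m] makes the radial flux large
    enough to control.

    Replacing [|x|^2] by [|x|^2 + e] regularises [u] and [F]; energies and fluxes are
    then dominated, uniformly in [e], by a multiple of [1 + L^4 / |x|^2], which is
    integrable since [n >= 3].  Hence [u] lies in [H^1(A)] and [F] is weakly free of
    divergence across the origin. *)
Require Import Defs.
From HB Require Import structures.
From mathcomp Require Import all_boot all_order all_algebra.
From mathcomp Require Import all_classical all_reals all_analysis.
From mathcomp Require Import measurable_realfun.
From mathcomp Require Import ring lra.

Set Implicit Arguments.
Unset Strict Implicit.
Unset Printing Implicit Defensive.

Import Order.TTheory GRing.Theory Num.Theory.
Import numFieldNormedType.Exports.

Local Open Scope classical_set_scope.
Local Open Scope ring_scope.

(** The pointwise estimates compare only a radial and a tangential component, because [u] and [F]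
    are symmetric about the [x_1]-axis. The obstacle is that [L] grows as [x] tends to 0. For
    [sigma > 0] this contributes about [-2 sigma w v] to [|x|] times the radial derivative of [u],
    against a radial flux of positive sign. Where [sigma <= 1/2] the tangential product, of order
    [M L w] with [M = |x| m], absorbs this loss because [v] is small. Where [sigma >= 1/2] the loss
    is only of order [v^3], below the gain [v^2] that comes from differentiating [1 + v]. The
    regimes meet at [sigma = 1/2], where [e^(-2 L sigma) = e^(-L) = v^2]; this fixes the factor 2 in
    [L]. The size of [c] is already visible for [sigma <= 1/2]: there [|x| |F|] is at most a
    multiple of [L M], while [|x|^2 F . G] is at least a multiple of [M^2]. In the code [T] is
    [K + ln (1 + 1/|x|^2) / 2]: it stays above [K] on the whole space, so the regularised functions
    are of class C^1 on all of R^n, where integration by parts takes place, and a large [K] makes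
    [v] small everywhere. *)

(** * Scalar inequalities between the components of the gradient and of the flux *)

Section flux_bounds.
Context {R : realFieldType}.
(** Dictionary: [mu = n - 1], [sg] is the cosine, [p] is [|x|] times the radial derivative of [u],
    [q] the derivative of [u] in [sg], [M = |x| m], and [- th * MT] the derivative of [M] in
    [log |x|]. [P] and [Q] are [|x|] times the radial flux and [|x|] times the coefficient of the
    flux along the tangential part of the first basis vector. That part has squared length
    [1 - sg ^+ 2], so [E] is [|x|^2 F . G]. *)
Variables (mu th sg tau v L w M p q MT P Q E : R).
Hypotheses (mu2 : 2 <= mu) (th12 : 1/2 <= th) (th1 : th <= 1)
  (sg0 : 0 <= sg) (sg1 : sg <= 1) (tau0 : 0 <= tau) (tau1 : tau <= 1)
  (v0 : 0 < v) (vmu : 32 * v * (mu + 2) <= 1) (L1 : 1 <= L)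
  (wE : w = 1 - tau ^+ 2)
  (w_core : sg <= 1/2 -> v ^+ 2 <= w)
  (w_cap : 1/2 <= sg -> w <= 4 * v ^+ 2)
  (ME : M = 64 * (L * w + v ^+ 2))
  (pE : p = th * (v ^+ 2 * tau - 2 * (1 + v) * sg * w * v))
  (qE : q = (1 + v) * L * w)
  (MTE : MT = 64 * (2 * v * w - 4 * L * tau * w * sg * v - 2 * v ^+ 3))
  (PE : P = mu * sg * M + 128 * (1 - sg ^+ 2) * L ^+ 2 * tau * w)
  (QE : Q = (mu - 1) * M - th * MT)
  (EE : E = P * p + (1 - sg ^+ 2) * Q * q).

Let v128 : 128 * v <= 1.
Proof.
have : v * 2 <= v * mu by rewrite ler_wpM2l// ltW.
move: vmu; lra.
Qed.
Let v2 : 0 < v ^+ 2. Proof. by rewrite exprn_gt0. Qed.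
Let w0 : 0 <= w. Proof. by rewrite wE; move: tau0 tau1 => a b; nra. Qed.
Let w1 : w <= 1. Proof. by rewrite wE; move: tau0 tau1 => a b; nra. Qed.
Let L0 : 0 <= L. Proof. by move: L1; lra. Qed.
Let Lw0 : 0 <= L * w. Proof. exact: mulr_ge0. Qed.
Let wLw : w <= L * w. Proof. by rewrite ler_peMl. Qed.
Let M0 : 0 <= M. Proof. by rewrite ME; move: v2 Lw0; lra. Qed.
Let MLw : 64 * (L * w) <= M. Proof. by rewrite ME; move: v2; lra. Qed.
Let MN : 64 * v ^+ 2 <= M. Proof. by rewrite ME; move: Lw0; lra. Qed.
Let s0 : 0 <= 1 - sg ^+ 2. Proof. by move: sg0 sg1 => a b; nra. Qed.
Let s1 : 1 - sg ^+ 2 <= 1. Proof. by have := sqr_ge0 sg; lra. Qed.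
Let tw0 : 0 <= tau * w. Proof. exact: mulr_ge0. Qed.
Let twLw : 0 <= L * (tau * w) <= L * w.
Proof. by rewrite mulr_ge0//= ler_wpM2l// ler_piMl. Qed.
Let P2_0 : 0 <= 128 * (1 - sg ^+ 2) * L ^+ 2 * tau * w.
Proof. by rewrite -!mulrA !mulr_ge0 ?exprn_ge0. Qed.
Let mu0 : 0 <= mu. Proof. by move: mu2; lra. Qed.
Let P0 : 0 <= P. Proof. by rewrite PE addr_ge0// !mulr_ge0. Qed.

Let P_le : P <= mu * sg * M + 2 * (1 - sg ^+ 2) * L * M.
Proof.
have /andP[_ h] := twLw; move: MLw => k.
have h1 : 64 * (L * (tau * w)) <= M by lra.
have := ler_wpM2l (mulr_ge0 s0 L0) h1.
rewrite PE; lra.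
Qed.

Let P_le2 : P <= (mu + 2 * L) * M.
Proof.
have h1 : mu * M * sg <= mu * M by rewrite ler_piMr// mulr_ge0.
have h2 : (1 - sg ^+ 2) * (L * M) <= L * M by rewrite ler_piMl// mulr_ge0.
move: P_le; lra.
Qed.

(** Every term of [MT] carries a factor [v], and [128 * v <= 1]: the radial variation of [M] is
    small against [M], which keeps [Q] comparable to [M]. *)
Let MT_le : `|MT| <= M / 2.
Proof.
have h1 : 0 <= v * w <= v * (L * w) by rewrite mulr_ge0 ?(ltW v0)//= ler_wpM2l ?(ltW v0).
have h2 : 0 <= v * (L * (tau * w) * sg) <= v * (L * w).
  have /andP[a b] := twLw.
  rewrite mulr_ge0 ?(ltW v0) ?mulr_ge0//= ler_wpM2l ?(ltW v0)//.
  by apply: le_trans b; rewrite ler_piMr// mulr_ge0.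
have h5 : (128 * v) * (L * w) <= L * w by rewrite ler_piMl.
have h4 : (128 * v) * v ^+ 2 <= v ^+ 2 by rewrite ler_piMl// ltW.
have h6 : 0 <= v * v ^+ 2 by rewrite mulr_ge0// ltW.
rewrite MTE ME (exprS v 2).
move: v2 Lw0 h1 h2 => a b /andP[c d] /andP[e f].
rewrite ler_norml; apply/andP; split; lra.
Qed.

Let thMT : - (M / 2) <= th * MT <= M / 2.
Proof.
rewrite -ler_norml normrM ger0_norm; last by move: th12; lra.
have := normr_ge0 MT.
by move=> h; apply: le_trans MT_le; rewrite ler_piMl.
Qed.

Let Q_ge : M / 2 <= Q.
Proof.
have /andP[a b] := thMT; rewrite QE.
have : 2 * M <= mu * M by rewrite ler_wpM2r.
lra.
Qed.

Let Q_le : Q <= mu * M.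
Proof. have /andP[a b] := thMT; rewrite QE; move: M0; lra. Qed.

Let Q0 : 0 <= Q. Proof. by move: Q_ge M0; lra. Qed.

Let Lwq : L * w <= q <= 2 * (L * w).
Proof.
have h : 0 <= v * (L * w) <= L * w.
  by rewrite mulr_ge0 ?(ltW v0)//= ler_piMl//; move: v128; lra.
move: h => /andP[a b]; rewrite qE; apply/andP; split; lra.
Qed.

Let Qq : M * (L * w) / 2 <= Q * q.
Proof.
have /andP[h _] := Lwq.
have : M / 2 * (L * w) <= Q * q by rewrite ler_pM// divr_ge0.
lra.
Qed.

Let vsw : 0 <= (1 + v) * sg * (w * v) <= 2 * (w * v).
Proof.
have wv : 0 <= w * v by rewrite mulr_ge0// ltW.
have v0' := ltW v0.
have h : (1 + v) * sg <= 1 + v by rewrite ler_piMr// addr_ge0.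
rewrite !mulr_ge0//=; last by rewrite addr_ge0.
by rewrite ler_wpM2r//; move: v128 h; lra.
Qed.

Let vtau : 0 <= v ^+ 2 * tau <= v ^+ 2.
Proof. by rewrite mulr_ge0 ?(ltW v2)//= ler_piMr ?(ltW v2). Qed.

(** Only [P * p] can be negative, and its loss is at most [4 w v (mu + 2 L) M <= M L w / 8]; the
    tangential product contributes [3/8 M L w] because [1 - sg^2 >= 3/4]. *)
Let E_core : sg <= 1/2 -> M * (L * w) / 4 <= E.
Proof.
move=> sg12.
have wv : 0 <= w * v by rewrite mulr_ge0// ltW.
have h1 : w * v * P <= w * v * ((mu + 2 * L) * M) by rewrite ler_wpM2l.
have h2 : v * (mu + 2 * L) <= L / 32.
  have : 1 * (32 * v * (mu + 2)) <= L * 1 by apply: ler_pM => //; rewrite !mulr_ge0 ?(ltW v0)//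
    addr_ge0.
  have : v * mu <= v * (L * mu) by rewrite ler_wpM2l ?(ltW v0)// ler_peMl.
  have h3 : 32 * v * (mu + 2) * L <= L by rewrite ler_piMl.
  move: h3; lra.
have h3 : (w * M) * (v * (mu + 2 * L)) <= (w * M) * (L / 32).
  by rewrite ler_wpM2l// mulr_ge0.
have h4 : - (4 * (w * v)) <= p.
  have /andP[a0 _] := vtau; have /andP[a1 a2] := vsw.
  have b1 : 0 <= th * (v ^+ 2 * tau) by rewrite mulr_ge0//; move: th12; lra.
  have b2 : th * ((1 + v) * sg * (w * v)) <= (1 + v) * sg * (w * v) by rewrite ler_piMl.
  rewrite pE; lra.
have h5 : - (4 * (w * v)) * P <= p * P by rewrite ler_wpM2r.
have h6 : 3/4 <= 1 - sg ^+ 2 by move: sg0 => a; nra.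
have h7 : 3/4 * (M * (L * w) / 2) <= (1 - sg ^+ 2) * (Q * q).
  by rewrite ler_pM// divr_ge0// mulr_ge0.
move: M0; rewrite EE; lra.
Qed.

(** In the cap [w v <= v^2 / 32], so the negative part of [p] cannot compensate
    [v^2 tau >= v^2 / 2], and both products in [E] are nonnegative. The constant is
    [320 = 64 * (4 + 1)]. *)
Let E_cap : 1/2 <= sg ->
  [/\ M <= P, 0 <= p <= v ^+ 2, M <= 320 * L * v ^+ 2 &
   P * v ^+ 2 / 8 + (1 - sg ^+ 2) * (M * (L * w)) / 2 <= E].
Proof.
move=> sg12; have wv := w_cap sg12.
have v128' : 128 * v * v <= 1 * v by rewrite ler_wpM2r// ltW.
have tau12 : 1/2 <= tau.
  rewrite leNgt; apply/negP => h.
  have : tau ^+ 2 <= 1/4 by move: tau0 => a; nra.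
  by move: wv v128' v128; rewrite wE expr2 -mulrA; lra.
have MP : M <= P.
  have : 1 <= mu * sg by move: mu2 sg12 => a b; nra.
  by move=> /(ler_wpM2r M0); move: P2_0; rewrite PE; lra.
have c2 : w * v <= v ^+ 2 / 32.
  have : w * v <= 4 * v ^+ 2 * v by rewrite ler_wpM2r// ltW.
  have : (128 * v) * v ^+ 2 <= v ^+ 2 by rewrite ler_piMl// ltW.
  lra.
have /andP[d1 d2] := vsw.
have d3 : v ^+ 2 * (1/2) <= v ^+ 2 * tau by rewrite ler_wpM2l// ltW.
have /andP[d4 d5] := vtau.
have [X XE] : {X | X = v ^+ 2 * tau - 2 * (1 + v) * sg * w * v} by eexists.
have pX : p = th * X by rewrite XE.
have X1 : v ^+ 2 / 4 <= X <= v ^+ 2 by rewrite XE; apply/andP; split; lra.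
move: X1 => /andP[X1 X2].
have X0 : 0 <= X by move: v2; lra.
have pge : v ^+ 2 / 8 <= p.
  have : 1/2 * X <= th * X by rewrite ler_wpM2r.
  rewrite pX; lra.
split => //.
- apply/andP; split; first by rewrite pX mulr_ge0//; move: th12; lra.
  by rewrite pX; apply: le_trans X2; rewrite ler_piMl.
- have : L * w <= L * (4 * v ^+ 2) by rewrite ler_wpM2l.
  have : 1 * v ^+ 2 <= L * v ^+ 2 by rewrite ler_wpM2r// ltW.
  rewrite ME; lra.
- have e1 := ler_wpM2l P0 pge.
  have e2 := ler_wpM2l s0 Qq.
  rewrite EE; lra.
Qed.

(** This fixes the 64 in [M]. In the core [p^2] and [q^2] are each at most [4 (L w)^2], while
    [E >= M L w / 4 >= 16 (L w)^2]. In the cap [p <= v^2 <= M / 64 <= P / 64]. *)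
Lemma gradient_le_flux : 2 * (p ^+ 2 + (1 - sg ^+ 2) * q ^+ 2) <= E.
Proof.
have /andP[q1 q2] := Lwq.
have q3 : q ^+ 2 <= 4 * ((L * w) * (L * w)).
  have : q * q <= (2 * (L * w)) * (2 * (L * w)) by rewrite ler_pM//; move: Lw0; lra.
  by rewrite expr2; lra.
have Lw2 : 64 * (L * w) * (L * w) <= M * (L * w) by rewrite ler_wpM2r.
have [sg12|/ltW sg12] := leP sg (1/2).
  have h := E_core sg12; have wv := w_core sg12.
  have p2 : `|p| <= 2 * w.
    rewrite pE normrM ger0_norm; last by move: th12; lra.
    apply: (@le_trans _ _ (`|v ^+ 2 * tau - 2 * (1 + v) * sg * w * v|)).
      by rewrite ler_piMl.
    have /andP[a b] := vsw; have /andP[c d] := vtau.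
    have e : (128 * v) * w <= w by rewrite ler_piMl.
    rewrite ler_norml; apply/andP; split; move: w0; lra.
  have p3 : p ^+ 2 <= 4 * ((L * w) * (L * w)).
    rewrite -real_normK ?num_real//.
    have : `|p| * `|p| <= (2 * (L * w)) * (2 * (L * w)).
      by apply: ler_pM => //; move: wLw; lra.
    by rewrite expr2; lra.
  have h3 : (1 - sg ^+ 2) * q ^+ 2 <= q ^+ 2 by rewrite ler_piMl ?sqr_ge0.
  lra.
have [MP /andP[p0 pv] Mv EE'] := E_cap sg12.
have h1 : p ^+ 2 <= P * v ^+ 2 / 64.
  have : p * p <= (P / 64) * v ^+ 2.
    by apply: ler_pM => //; move: MN; lra.
  by rewrite expr2; lra.
have h2 : (1 - sg ^+ 2) * q ^+ 2 <= (1 - sg ^+ 2) * (M * (L * w) / 16).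
  by rewrite ler_wpM2l//; lra.
have h3 : 0 <= P * v ^+ 2 by rewrite mulr_ge0// ltW.
have h4 : 0 <= (1 - sg ^+ 2) * (M * (L * w)) by rewrite !mulr_ge0.
lra.
Qed.

(** Both [P] and [Q] are at most [Y M] with [Y = (mu + 2) L]. In the core [v^2 <= w] gives
    [M <= 128 L w], hence [M^2 <= 512 E]. The cap decides the constant: [P v^2 <= 8 E] and
    [M <= 320 Y v^2] cost [8 * 320] for each of the two squares. *)
Lemma flux_le : P ^+ 2 + (1 - sg ^+ 2) * Q ^+ 2 <= 5120 * (mu + 2) ^+ 2 * L ^+ 2 * E.
Proof.
have Y0 : 0 <= (mu + 2) * L by rewrite mulr_ge0// addr_ge0.
have muL : mu <= (mu + 2) * L.
  have : (mu + 2) * 1 <= (mu + 2) * L by rewrite ler_wpM2l// addr_ge0.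
  lra.
have muL2 : mu + 2 * L <= (mu + 2) * L.
  have : mu * 1 <= mu * L by rewrite ler_wpM2l.
  lra.
set Y := (mu + 2) * L in Y0 muL muL2 *.
have -> : 5120 * (mu + 2) ^+ 2 * L ^+ 2 * E = 5120 * (Y * Y) * E by rewrite /Y; ring.
have QL : Q <= Y * M by apply: le_trans Q_le _; rewrite ler_wpM2r.
have PL : P <= Y * M by apply: le_trans P_le2 _; rewrite ler_wpM2r.
have h3 : (1 - sg ^+ 2) * Q ^+ 2 <= Q ^+ 2 by rewrite ler_piMl ?sqr_ge0.
have YY : 0 <= Y * Y by rewrite mulr_ge0.
have [sg12|/ltW sg12] := leP sg (1/2).
  have h := E_core sg12; have wv := w_core sg12.
  have P2 : P ^+ 2 <= (Y * M) * (Y * M) by rewrite expr2 ler_pM.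
  have Q2 : Q ^+ 2 <= (Y * M) * (Y * M) by rewrite expr2 ler_pM.
  have M2 : M * M <= 512 * E.
    have : M * M <= M * (128 * (L * w)).
      by rewrite ler_wpM2l//; move: wLw; rewrite ME; lra.
    lra.
  have h4 := ler_wpM2l YY M2.
  have E0 : 0 <= E by apply: le_trans h; rewrite divr_ge0// mulr_ge0.
  have := mulr_ge0 YY E0; lra.
have [MP /andP[p0 pv] Mv EE'] := E_cap sg12.
have E1 : P * v ^+ 2 <= 8 * E.
  have h4 : 0 <= (1 - sg ^+ 2) * (M * (L * w)) by rewrite !mulr_ge0.
  lra.
have Y1 : L <= Y by rewrite /Y ler_peMl//; move: mu2; lra.
have MY : M <= 320 * (Y * v ^+ 2).
  apply: le_trans Mv _; have : L * v ^+ 2 <= Y * v ^+ 2 by rewrite ler_wpM2r// ltW.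
  lra.
have Pv0 : 0 <= P * v ^+ 2 by rewrite mulr_ge0// ltW.
have E0 : 0 <= E by lra.
have P2 : P ^+ 2 <= P * (Y * (320 * (Y * v ^+ 2))).
  rewrite expr2 ler_wpM2l//; apply: le_trans PL _.
  by rewrite ler_wpM2l.
have muL3 : mu * (mu * L) <= Y * Y.
  by rewrite ler_pM// ?mulr_ge0// /Y mulrDl lerDl mulr_ge0.
(* One factor [Q <= mu M] is spent through [M <= P], the other through [M <= 320 L v^2], so that the
   controlled product [P v^2] appears. *)
have Q2 : Q ^+ 2 <= (mu * (mu * L)) * (320 * (P * v ^+ 2)).
  have -> : mu * (mu * L) * (320 * (P * v ^+ 2)) = (mu * P) * (mu * (320 * L * v ^+ 2)) by ring.
  rewrite expr2 ler_pM//; apply: le_trans Q_le _; rewrite ler_wpM2l//.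
have Q3 : mu * (mu * L) * (320 * (P * v ^+ 2)) <= (Y * Y) * (320 * (P * v ^+ 2)).
  by apply: ler_wpM2r; [apply: mulr_ge0; [exact: ler0n|]|].
have := ler_wpM2l YY E1.
lra.
Qed.

End flux_bounds.

(** * Borel sets and translations of R^n *)

Section borel_rV.
Context {R : realType}.

Lemma measurable_coord n (j : 'I_n) :
  measurable_fun setT (fun x : 'rV[R]_n => x ord0 j).
Proof.
by have /measurable_fun_matrixP := @measurable_id _ 'rV[R]_n setT; exact.
Qed.

Lemma measurable_box n (X : 'I_n -> set R) : (forall i, measurable (X i)) ->
  measurable [set v : 'rV[R]_n | forall i, X i (v ord0 i)].
Proof.
move=> mX; rewrite (_ : [set _ | _] = \bigcap_(i in [set: 'I_n])
      (fun v : 'rV[R]_n => v ord0 i) @^-1` X i); last first.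
  by apply/seteqP; split => [v vX i _|v vX i]; exact: vX.
apply: fin_bigcap_measurable; first exact: finite_finset.
by move=> i _; rewrite -[X in measurable X]setTI; exact: measurable_coord.
Qed.

Lemma ball_rVP n (x y : 'rV[R]_n) e : 0 < e ->
  ball x e y <-> forall i, `|x ord0 i - y ord0 i| < e.
Proof.
move=> e0; split=> [[_ h] i|h]; first exact: h.
by split=> // i j; rewrite (ord1 i); exact: h.
Qed.

(* Every open set is a countable union of rational cubes. *)
Lemma open_measurable_rV n (U : set 'rV[R]_n) : open U -> measurable U.
Proof.
move=> oU.
pose c (p : 'rV[rat]_n * nat) : 'rV[R]_n := \row_i ratr (p.1 ord0 i).
pose Q (p : 'rV[rat]_n * nat) := [set v : 'rV[R]_n |
  forall i, ball (c p ord0 i) (p.2.+1%:R^-1) (v ord0 i)].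
rewrite (_ : U = \bigcup_p (if `[< Q p `<=` U >] then Q p else set0)).
  apply: countable_bigcupT_measurable => //.
  move=> p; case: ifP => // _.
  apply: (@measurable_box _ (fun i => ball (c p ord0 i) (p.2.+1%:R^-1))) => i.
  by apply: open_measurable; exact: ball_open.
apply/seteqP; split=> [x Ux|x [p _]]; last by case: ifP => // /asboolP; exact.
have /nbhs_ballP[e /= e0 xeU] := open_nbhs_nbhs (conj oU Ux).
have [k kE] : exists k : nat, k.+1%:R^-1 < e / 2.
  have e2 : 0 < e / 2 by rewrite divr_gt0.
  have [k _ h] := near_infty_natSinv_lt (PosNum e2).
  by exists k; exact: (h k (leqnn k)).
have q_ i : exists q : rat, `|x ord0 i - ratr q| < k.+1%:R^-1.
  have : x ord0 i - k.+1%:R^-1 < x ord0 i + k.+1%:R^-1.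
    by rewrite ltrBlDr -addrA ltrDl addr_gt0.
  move=> /rat_in_itvoo[q]; rewrite in_itv/= => /andP[q1 q2]; exists q.
  by rewrite distrC ltr_norml ltrBrDl q1 ltrBlDl.
exists (\row_i (xchoose (q_ i)), k) => //.
case: asboolP => [_ i|].
  by rewrite /c mxE mxE; have := xchooseP (q_ i); rewrite /ball/= distrC.
case=> v vQ; apply: xeU; apply/ball_rVP => // i.
have := vQ i; rewrite /c mxE mxE /ball/=.
set q := ratr _ => h.
have /= h2 : `|x ord0 i - q| < k.+1%:R^-1 by exact: (xchooseP (q_ i)).
rewrite (_ : _ - v ord0 i = (x ord0 i - q) + (q - v ord0 i)); last lra.
by rewrite (le_lt_trans (ler_normD _ _))// (splitr e) ltrD// (lt_trans _ kE).
Qed.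

Lemma continuous_measurable_rV n (D : set 'rV[R]_n) (f : 'rV[R]_n -> R) :
  open D -> (forall x, D x -> {for x, continuous f}) -> measurable_fun D f.
Proof.
move=> oD cf; apply: (measurability _ (RGenOpens.measurableE R)).
move=> _ [_ [a [b ->] <-]]; apply: open_measurable_rV.
rewrite openE => x [Dx fx]; apply: filterI; first exact: open_nbhs_nbhs.
apply: (cf x Dx); apply: open_nbhs_nbhs; split => //; exact: interval_open.
Qed.

End borel_rV.

Section translation.
Context {R : realType}.
Local Open Scope ereal_scope.

Lemma lebesgue_measure_translation (a : R) (A : set R) : measurable A ->
  lebesgue_measure ((fun x => x + a)%R @^-1` A) = lebesgue_measure A.
Proof.
have ma : measurable_fun setT (fun x : R => x + a)%R by exact: measurable_funD.
pose f : R -> measurableTypeR R := fun x => (x + a)%R.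
move=> mA; apply/esym.
apply: (@lebesgue_measure_unique _ (pushforward lebesgue_measure f)) => //=.
move=> _ [[b c]] _ <-; rewrite /pushforward.
have -> : f @^-1` [set` `]b, c]] = [set` `]b - a, c - a]]%R.
  by apply/seteqP; split=> x /=; rewrite !in_itv/= /f lerBrDr ltrBlDr.
by rewrite !lebesgue_measure_itv/= !lte_fin ltrD2r; congr (if _ then _ else _);
  rewrite -!EFinB; congr (_%:E); lra.
Qed.

Lemma measurable_translation n (v : 'rV[R]_n) :
  measurable_fun setT (fun x : 'rV[R]_n => x + v)%R.
Proof.
apply/measurable_fun_matrixP => i j; rewrite (ord1 i).
under eq_fun do rewrite mxE.
by apply: measurable_funD => //; exact: measurable_coord.
Qed.

(** Induction on the dimension: the shift acts separately on the head and on the tail, and a product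
    measure is determined by its values on rectangles. *)
Lemma lebesgue_rV_translation n (v : 'rV[R]_n) (A : set 'rV[R]_n) : measurable A ->
  lebesgue_rV n ((fun x => x + v)%R @^-1` A) = lebesgue_rV n A.
Proof.
elim: n v A => [|n IHn] v A mA.
  congr (lebesgue_rV 0 _); apply/funext => x /=; congr (A _).
  by apply/rowP => -[].
pose a := v ord0 ord0; pose w : 'rV[R]_n := (\row_j v ord0 (lift ord0 j))%R.
pose g (p : R * 'rV[R]_n) : measurableTypeR R * 'rV[R]_n := (p.1 + a, p.2 + w)%R.
have mg : measurable_fun setT g.
  apply/measurable_fun_pair; first exact: measurable_funD.
  exact: (measurableT_comp (measurable_translation w) measurable_snd).
have mcA : measurable (@consrV R n @^-1` A).
  by rewrite -[X in measurable X]setTI; exact: measurable_consrV.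
rewrite /= /lebesgue_cons /pushforward.
have -> : @consrV R n @^-1` ((fun x => x + v)%R @^-1` A) =
    g @^-1` (@consrV R n @^-1` A).
  apply/funext => p /=; congr (A _); apply/rowP => j; rewrite mxE.
  by case: (unliftP ord0 j) => [k ->|->]; rewrite !(consrV0, consrVS)//= !mxE.
apply/esym.
apply: (@product_measure_unique _ _ _ _ _ (@lebesgue_measure R) (lebesgue_rV n)
  (pushforward (lebesgue_measure \x lebesgue_rV n) g)) => //= X Y mX mY.
rewrite /pushforward.
have -> : g @^-1` (X `*` Y) =
    ((fun x => x + a)%R @^-1` X) `*` ((fun x => x + w)%R @^-1` Y) by [].
rewrite product_measure1E.
- by congr (_ * _); [exact: lebesgue_measure_translation|exact: IHn].
- by rewrite -[X in measurable X]setTI; exact: measurable_funD.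
- by rewrite -[X in measurable X]setTI; exact: measurable_translation.
Qed.

Lemma integral_translation n (v : 'rV[R]_n) (f : 'rV[R]_n -> \bar R) :
  (lebesgue_rV n).-integrable setT f ->
  (lebesgue_rV n).-integrable setT (fun x => f (x + v)%R) /\
  \int[lebesgue_rV n]_x f (x + v)%R = \int[lebesgue_rV n]_x f x.
Proof.
move=> intf; have mv := measurable_translation v.
have mf := measurable_int _ intf.
have shiftE g : \int[pushforward (lebesgue_rV n) (fun x => x + v)%R]_x g x =
    \int[lebesgue_rV n]_x g x.
  apply: eq_measure_integral => A mA _ /=.
  by rewrite /pushforward lebesgue_rV_translation.
have intg : (lebesgue_rV n).-integrable setT (fun x => f (x + v)%R).
  apply/integrableP; split; first exact: measurableT_comp.
  have /integrableP[_] := intf; apply: le_lt_trans.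
  have := @ge0_integral_pushforward _ _ _ _ R _ mv (lebesgue_rV n) setT (abse \o f)
    measurableT.
  rewrite preimage_setT /= shiftE => <- //; exact: measurableT_comp.
split=> //.
have := @integral_pushforward _ _ _ _ R _ mv (lebesgue_rV n) setT f mf.
by rewrite preimage_setT => /(_ intg measurableT)/= <-; exact: shiftE.
Qed.

End translation.

(** * Integrals of real-valued functions *)

Section integrable_real.
Context d (T : measurableType d) {R : realType}
  (mu : {measure set T -> \bar R}) (D : set T).
Hypothesis mD : measurable D.

Lemma integrableDR (u w : T -> R) : mu.-integrable D (EFin \o u) ->
  mu.-integrable D (EFin \o w) -> mu.-integrable D (EFin \o (fun x => u x + w x)).
Proof. by move=> iu iw; have := integrableD mD iu iw. Qed.

Lemma integrableBR (u w : T -> R) : mu.-integrable D (EFin \o u) ->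
  mu.-integrable D (EFin \o w) -> mu.-integrable D (EFin \o (fun x => u x - w x)).
Proof. by move=> iu iw; have := integrableB mD iu iw. Qed.

Lemma integrableZR (c : R) (u : T -> R) : mu.-integrable D (EFin \o u) ->
  mu.-integrable D (EFin \o (fun x => c * u x)).
Proof. by move=> iu; have := integrableZl mD c iu. Qed.

Lemma integrable_sumR (I : Type) (s : seq I) (u : I -> T -> R) :
  (forall i, mu.-integrable D (EFin \o u i)) ->
  mu.-integrable D (EFin \o (fun x => \sum_(i <- s) u i x)).
Proof.
move=> iu; elim: s => [|i s IH].
  by under eq_fun do rewrite big_nil; exact: (integrable0 mu D).
by under eq_fun do rewrite big_cons; exact: integrableDR.
Qed.

Lemma Rintegral_sum (I : Type) (s : seq I) (u : I -> T -> R) :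
  (forall i, mu.-integrable D (EFin \o u i)) ->
  (\int[mu]_(x in D) (\sum_(i <- s) u i x) = \sum_(i <- s) \int[mu]_(x in D) u i x)%R.
Proof.
move=> iu; elim: s => [|i s IH].
  rewrite big_nil; under eq_Rintegral do rewrite big_nil.
  by rewrite /Rintegral integral0.
rewrite big_cons -IH -RintegralD//; last exact: integrable_sumR.
by apply: eq_Rintegral => x _; rewrite big_cons.
Qed.

End integrable_real.

Section dominated_convergence_real.
Context d (T : measurableType d) {R : realType}
  (mu : {measure set T -> \bar R}) (D N : set T).
Local Open Scope ereal_scope.

(** Convergence and domination are asked off one fixed null set [N]; for the regularised solutions
    this is the origin. *)
Lemma dominated_convergence_Rintegral (f_ : nat -> T -> R) (f g : T -> R) :
  measurable D -> mu.-negligible N ->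
  (forall k, measurable_fun D (f_ k)) -> measurable_fun D f ->
  mu.-integrable D (EFin \o g) ->
  (forall x, D x -> ~ N x -> f_ ^~ x @ \oo --> f x) ->
  (forall k x, D x -> ~ N x -> (`|f_ k x| <= g x)%R) ->
  [/\ forall k, mu.-integrable D (EFin \o f_ k),
      mu.-integrable D (EFin \o f) &
      \int[mu]_(x in D) (f_ k x)%:E @[k --> \oo] --> \int[mu]_(x in D) (f x)%:E].
Proof.
move=> mD N0 mf_ mf ig cvgf lefg.
have [fint _ fcvg] := @dominated_convergence _ _ R mu D mD
  (fun k => EFin \o f_ k) (EFin \o f) (EFin \o g)
  (fun k => (measurable_EFinP _ _).2 (mf_ k)) ((measurable_EFinP _ _).2 mf)
  ltac:(apply: negligibleS N0 => x /= /not_implyP[Dx h]; apply: contrapT => Nx;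
        apply: h; apply/cvg_EFin; [exact: nearW|exact: cvgf])
  ig
  ltac:(apply: negligibleS N0 => x /= h; apply: contrapT => Nx;
        apply: h => k Dx; rewrite lee_fin; exact: lefg).
split => // k; apply/integrableP; split; first exact/measurable_EFinP.
have /integrableP[mg] := ig; apply: le_lt_trans.
apply: ae_ge0_le_integral => //.
- by apply: measurableT_comp => //; exact/measurable_EFinP.
- exact: measurableT_comp.
- apply: negligibleS N0 => x /= /not_implyP[Dx h]; apply: contrapT => Nx.
  apply: h; rewrite lee_fin (le_trans (lefg k x Dx Nx))//; exact: ler_norm.
Qed.

End dominated_convergence_real.

Section continuous_real.
Context {T : topologicalType} {R : realType}.
Implicit Types f g : T -> R.

Lemma continuousMR f g : continuous f -> continuous g -> continuous (fun x => f x * g x).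
Proof. by move=> cf cg x; exact: (continuousM (cf x) (cg x)). Qed.

Lemma continuousBR f g : continuous f -> continuous g -> continuous (fun x => f x - g x).
Proof. by move=> cf cg x; exact: (continuousB (cf x) (cg x)). Qed.

Lemma continuousDR f g : continuous f -> continuous g -> continuous (fun x => f x + g x).
Proof. by move=> cf cg x; exact: (continuousD (cf x) (cg x)). Qed.

Lemma cvg_sumR (S : Type) (F : set_system S) (FF : Filter F) (I : Type) (s : seq I)
    (f : I -> S -> R) (l : I -> R) : (forall i, f i t @[t --> F] --> l i) ->
  \sum_(i <- s) f i t @[t --> F] --> \sum_(i <- s) l i.
Proof.
move=> fl; elim: s => [|i s IH].
  by under eq_fun do rewrite big_nil; rewrite big_nil; exact: cvg_cst.
by under eq_fun do rewrite big_cons; rewrite big_cons; exact: cvgD.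
Qed.

End continuous_real.

(** * Functions of class C^1 and functions vanishing off a cube *)

Section C1_functions.
Context {R : realType} {n : nat}.
Implicit Types (f g phi psi : 'rV[R]_n -> R) (x v : 'rV[R]_n) (i j : 'I_n) (r : R).

Local Notation leb := (@lebesgue_rV R n).
Local Notation "''e_' i" := (delta_mx ord0 i : 'rV[R]_n) (at level 8, i at level 2).
Local Notation pd i f := (fun x => 'D_('e_i) f x).

(** Difference quotients move along one axis at a time, so continuous partial derivatives suffice.
    In contrast with [C1_ball], the condition bears on the whole space. *)
Definition C1 f := [/\ continuous f, forall x i, derivable f x ('e_i) &
  forall i, continuous (pd i f)].

(** Supports are measured by cubes because the volume of a cube is explicit for the iterated product
    measure. *)
Definition vanishes_off r f := forall x i, r < `|x ord0 i| -> f x = 0.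

Lemma C1_continuous f : C1 f -> continuous f.
Proof. by case. Qed.

Lemma continuous_measurable_setT f : continuous f -> measurable_fun setT f.
Proof. by move=> cf; apply: continuous_measurable_rV => [|x _]; [exact: openT|exact: cf]. Qed.

Lemma continuous_bounded_cube f r : continuous f ->
  exists2 C : R, 0 < C & forall x, (forall i, `|x ord0 i| <= r) -> `|f x| <= C.
Proof.
(* For [r < 0] the cube is empty, unless [n = 0], when it consists of the single point [0]. *)
move=> cf; have [r0|r0] := ltP r 0.
  have [i|] := pickP 'I_n.
    exists 1 => // x /(_ i) h; exfalso.
    by have := lt_le_trans (le_lt_trans h r0) (normr_ge0 (x ord0 i)); rewrite ltxx.
  move=> n0; exists (`|f 0| + 1) => [|x _]; first by rewrite ltr_wpDl.
  rewrite (_ : x = 0) ?lerDl//; apply/rowP => i; by have := n0 i.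
pose A := [set x : 'rV[R]_n | forall i, [set` `[-r, r]] (x ord0 i)].
have cA : compact A by apply: (@rV_compact _ _ (fun=> [set` `[-r, r]])) => i; exact:
  segment_compact.
have A0 : A 0 by move=> i /=; rewrite mxE in_itv/= r0 oppr_le0 r0.
have [c _ cmax] := @EVT_max_rV R n (fun x => `|f x|) A (ex_intro _ _ A0) cA
  ltac:(by apply: continuous_subspaceT => x; apply: continuous_comp; [exact: cf|exact:
    norm_continuous]).
exists (`|f c| + 1) => [|x xr]; first by rewrite ltr_wpDl.
rewrite (@le_trans _ _ `|f c|) ?lerDl//; apply: cmax; rewrite inE => i /=.
by rewrite in_itv/= -ler_norml.
Qed.

Definition cube r : set 'rV[R]_n := [set x | forall i, [set` `[-r, r]] (x ord0 i)].

Lemma cubeP r x : cube r x <-> forall i, `|x ord0 i| <= r.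
Proof.
by split=> h i; have := h i; rewrite /= in_itv/= ler_norml.
Qed.

Lemma measurable_cube r : measurable (cube r).
Proof. exact: (@measurable_box R n (fun=> [set` `[-r, r]])). Qed.

Lemma lebesgue_cube r : 0 <= r -> leb (cube r) = ((2 * r) ^+ n)%:E.
Proof.
move=> r0; rewrite (@lebesgue_rV_box R n (fun=> [set` `[-r, r]]))//.
rewrite (eq_bigr (fun=> (2 * r)%:E)) => [|i _]; last first.
  rewrite lebesgue_measure_itv/= lte_fin.
  case: ltP => [_|rr]; first by rewrite -EFinB; congr (_%:E); lra.
  by congr (_%:E); lra.
by rewrite big_const_ord; elim: n => [|m IH] //=; rewrite IH exprS EFinM.
Qed.

Lemma lebesgue_cube_lty r : 0 <= r -> (leb (cube r) < +oo)%E.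
Proof. by move=> r0; rewrite lebesgue_cube// ltry. Qed.

Lemma integrable_vanishes_off f r C : measurable_fun setT f ->
  (forall x, `|f x| <= C) -> vanishes_off r f -> leb.-integrable setT (EFin \o f).
Proof.
move=> mf fC f0; have [r0|r0] := leP 0 r; last first.
  have [i|n0] := pickP 'I_n.
    rewrite (_ : _ \o _ = cst 0%E); first by move=> *; exact (integrable0 leb setT).
    by apply/funext => x; rewrite /= (f0 x i)// (lt_le_trans r0).
  apply: (@measurable_bounded_integrable _ _ _ leb) => //.
    have -> : setT = cube 1 by apply/seteqP; split=> // x _ i; have := n0 i.
    exact: lebesgue_cube_lty.
  by exists C; split; [exact: num_real|move=> M CM x _ /=; exact: le_trans (fC x) (ltW CM)].
rewrite (_ : _ \o _ = (EFin \o f) \_ (cube r)); last first.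
  apply/funext => x; rewrite /patch; case: ifPn => //.
  rewrite notin_setE => /cubeP/existsNP[i].
  by move/negP; rewrite -ltNge => /f0 /= ->.
apply/(integrable_mkcond _ (measurable_cube r)).
apply: (@measurable_bounded_integrable _ _ _ leb).
- exact: measurable_cube.
- exact: lebesgue_cube_lty.
- exact: measurable_funTS.
- by exists C; split; [exact: num_real|move=> M CM x _ /=; exact: le_trans (fC x) (ltW CM)].
Qed.

Lemma continuous_integrable f r : continuous f -> vanishes_off r f ->
  leb.-integrable setT (EFin \o f).
Proof.
move=> cf f0; have [C C0 fC] := continuous_bounded_cube r cf.
apply: (@integrable_vanishes_off f r C) => [|x|//].
  exact: continuous_measurable_setT.
have [xr|/existsNP[i /negP]] := pselect (forall i, `|x ord0 i| <= r); first exact: fC.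
by rewrite -ltNge => /f0 ->; rewrite normr0 ltW.
Qed.

(** Mean value theorem on a segment. The bound on the derivative covers all [|t| <= 1], so that one
    maximum over an enlarged cube serves every increment. *)
Lemma C1_increment_le f i x (h C : R) : C1 f -> `|h| <= 1 ->
  (forall t : R, `|t| <= 1 -> `|'D_('e_i) f (x + t *: 'e_i)| <= C) ->
  `|f (x + h *: 'e_i) - f x| <= C * `|h|.
Proof.
move=> [_ df cf] h1 leC.
pose F t := f (x + t *: 'e_i).
have dF (t : R) : is_derive t (1 : R) F ('D_('e_i) f (x + t *: 'e_i)).
  have dt : derivable f (x + t *: 'e_i) 'e_i by exact: df.
  have FE : (fun s : R => s^-1 *: ((F \o shift t) (s *: (1 : R)) - F t)) =
      (fun s => s^-1 *: ((f \o shift (x + t *: 'e_i)) (s *: 'e_i) - f (x + t *: 'e_i))).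
    apply/funext => s; rewrite /F /= [_%:A]mulr1 scalerDl.
    by rewrite addrCA.
  by apply: DeriveDef; rewrite ?/derivable ?/derive FE.
have cF : continuous F by move=> t; apply: differentiable_continuous; apply/derivable1_diffP.
have bnd t : `|t| <= `|h| -> `|'D_('e_i) f (x + t *: 'e_i)| <= C.
  by move=> th; apply: leC; exact: le_trans h1.
have F0 : F 0 = f x by rewrite /F scale0r addr0.
rewrite -F0 -/(F h).
have [h0|h0] := leP 0 h.
  have [c] := MVT_segment h0 (fun t _ => dF t) (continuous_subspaceT cF).
  rewrite in_itv/= => /andP[c0 ch] ->; rewrite subr0 normrM ler_wpM2r//.
  by apply: bnd; rewrite !ger0_norm.
have [c] := MVT_segment (ltW h0) (fun t _ => dF t) (continuous_subspaceT cF).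
rewrite in_itv/= => /andP[hc c0] E; rewrite distrC E sub0r normrM normrN ler_wpM2r//.
by apply: bnd; rewrite !ler0_norm ?lerN2// ltW.
Qed.

End C1_functions.

(** * Integration by parts *)

Section integration_by_parts.
Context {R : realType} {n : nat}.
Implicit Types (f g phi psi : 'rV[R]_n -> R) (x v : 'rV[R]_n) (i j : 'I_n) (r : R).

Local Notation leb := (@lebesgue_rV R n).
Local Notation "''e_' i" := (delta_mx ord0 i : 'rV[R]_n) (at level 8, i at level 2).
Local Notation pd i f := (fun x => 'D_('e_i) f x).
Local Notation Int f := (\int[leb]_x (f x))%R.

Lemma coord_shift x i j (h : R) : (x + h *: 'e_i) ord0 j = x ord0 j + h * (j == i)%:R.
Proof. by rewrite !mxE eqxx. Qed.

Lemma coord_shift_le x i j (h : R) : `|h| <= 1 ->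
  `|(x + h *: 'e_i) ord0 j| <= `|x ord0 j| + 1.
Proof.
move=> h1; rewrite coord_shift (le_trans (ler_normD _ _))// lerD2l normrM.
by case: (j == i); rewrite ?normr1 ?normr0 ?mulr1 ?mulr0 ?ler01.
Qed.

Lemma vanishes_off_shift r f i (h : R) : `|h| <= 1 -> vanishes_off r f ->
  vanishes_off (r + 1) (fun x => f (x + h *: 'e_i)).
Proof.
move=> h1 f0 x j xr; apply: (f0 _ j).
have /(coord_shift_le (x + h *: 'e_i) i j) : `|- h| <= 1 by rewrite normrN.
by rewrite scaleNr addrK -(lerD2r (- 1)) addrK; apply: lt_le_trans; rewrite ltrBrDr.
Qed.

Lemma vanishes_off_le r r' f : r <= r' -> vanishes_off r f -> vanishes_off r' f.
Proof. by move=> rr f0 x i xr; apply: (f0 x i); exact: le_lt_trans xr. Qed.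

Lemma vanishes_off_pd r f i : C1 f -> vanishes_off r f -> vanishes_off r (pd i f).
Proof.
move=> _ f0 x j xr.
have -> : 'D_('e_i) f x = 'D_('e_i) (cst 0 : 'rV[R]_n -> R) x.
  apply: near_eq_derive.
  have oU : open [set y : 'rV[R]_n | r < `|y ord0 j|].
    apply: (@open_comp _ _ (fun y : 'rV[R]_n => `|y ord0 j|) [set z | r < z]); last exact: open_gt.
    move=> y _; apply: continuous_comp; [exact: coord_continuous|exact: norm_continuous].
  have := open_nbhs_nbhs (conj oU xr).
  by apply: filterS => y /= /f0.
by rewrite derive_cst.
Qed.

Lemma cvg_difference_quotient f i x (h : nat -> R) :
  derivable f x ('e_i) -> (forall k, h k != 0) -> h @ \oo --> 0 ->
  (h k)^-1 * (f (x + h k *: 'e_i) - f x) @[k --> \oo] --> 'D_('e_i) f x.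
Proof.
move=> df hn0 h0.
have /cvgr_dnbhsP := (df : cvg _).
move=> /(_ h (conj hn0 h0)); apply: cvg_trans; apply: near_eq_cvg; near=> k.
by rewrite /= [x + _]addrC.
Unshelve. all: by end_near. Qed.

(** All quotients are dominated at once by the maximum of the derivative over the cube of half-side
    [r + 1]. The factor [g] is only measurable and bounded because indicators of cubes are inserted
    for it below. *)
Lemma cvg_integral_difference_quotient f g i r C (h : nat -> R) :
  C1 f -> measurable_fun setT g -> (forall x, `|g x| <= C) -> vanishes_off r g ->
  (forall k, h k != 0) -> (forall k, `|h k| <= 1) -> h @ \oo --> 0 ->
  Int (fun x => (h k)^-1 * (f (x + h k *: 'e_i) - f x) * g x) @[k --> \oo] -->
  Int (fun x => 'D_('e_i) f x * g x).
Proof.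
move=> C1f mg gC g0 hn0 h1 h0.
have [_ df cf] := C1f; have cf0 := C1_continuous C1f.
have [C' C'0 fC'] := continuous_bounded_cube (r + 1) (cf i).
have C0 : 0 <= C by exact: le_trans (gC 0).
have mshift k : measurable_fun setT (fun x => f (x + h k *: 'e_i)).
  apply: (measurableT_comp (continuous_measurable_setT cf0)).
  exact: measurable_translation.
have mq k : measurable_fun setT
    (fun x => (h k)^-1 * (f (x + h k *: 'e_i) - f x) * g x).
  apply: measurable_funM => //; apply: measurable_funM => //.
  by apply: measurable_funB => //; exact: continuous_measurable_setT.
have md : measurable_fun setT (fun x => 'D_('e_i) f x * g x).
  by apply: measurable_funM => //; exact: continuous_measurable_setT.
have N0 : leb.-negligible set0 by exact: negligible_set0.
pose b x := C' * C * \1_(cube r) x.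
have ib : leb.-integrable setT (EFin \o b).
  apply: (@integrable_vanishes_off _ _ _ r (C' * C)).
  - apply: measurable_funM => //; by apply: measurable_indic; exact: measurable_cube.
  - move=> x; rewrite /b normrM ger0_norm ?mulr_ge0 ?(ltW C'0)//.
    rewrite ler_piMr// ?mulr_ge0 ?(ltW C'0)// indicE.
    by case: (_ \in _); rewrite ?normr0 ?normr1.
  - move=> x j xr; rewrite /b indicE memNset ?mulr0// => /cubeP/(_ j).
    by rewrite leNgt xr.
have dom k x : `|(h k)^-1 * (f (x + h k *: 'e_i) - f x) * g x| <= b x.
  rewrite /b indicE; have [xr|] := boolP (x \in cube r); last first.
    rewrite notin_setE => /cubeP/existsNP[j /negP]; rewrite -ltNge => /g0 ->.
    by rewrite mulr0 normr0 mulr0.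
  rewrite mulr1 normrM ler_pM// normrM normfV ler_pdivrMl ?normr_gt0// mulrC.
  apply: C1_increment_le => // t t1; apply: fC' => j.
  apply: le_trans (coord_shift_le _ _ _ t1) _; rewrite lerD2r.
  by move: xr; rewrite inE => /cubeP; exact.
have [ik il] := @dominated_convergence_Rintegral _ _ R leb setT set0 _ _ _
  measurableT N0 mq md ib
  ltac:(by move=> x _ _; apply: cvgM; [exact: cvg_difference_quotient|exact: cvg_cst])
  ltac:(by move=> k x _ _; exact: dom).
rewrite -[X in _ --> X](fineK (integrable_fin_num measurableT il)).
by move=> /fine_cvgP[_].
Qed.

Lemma Rintegral_translation g v : leb.-integrable setT (EFin \o g) ->
  leb.-integrable setT (EFin \o (fun x => g (x + v))) /\
  Int (fun x => g (x + v)) = Int g.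
Proof.
move=> /integral_translation => /(_ v)[h1 h2]; split=> //.
by rewrite /Rintegral; congr fine; exact: h2.
Qed.

Lemma harmonic_steps : [/\ forall k, (k.+1%:R^-1 : R) != 0,
  forall k, `|k.+1%:R^-1 : R| <= 1 & (k.+1%:R^-1 : R) @[k --> \oo] --> 0].
Proof.
split=> [k|k|]; first by rewrite invr_eq0 pnatr_eq0.
  by rewrite ger0_norm// invf_le1// ler1n.
exact: cvg_harmonic.
Qed.

Lemma continuous_translation (v : 'rV[R]_n) : continuous (fun x => x + v).
Proof. by move=> x; apply: differentiable_continuous; exact: differentiableD. Qed.

Lemma continuous_comp_translation f v : continuous f -> continuous (fun x => f (x + v)).
Proof.
move=> cf x; apply: (@continuous_comp 'rV[R]_n 'rV[R]_n R (fun y => y + v) f).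
  exact: continuous_translation.
exact: cf.
Qed.

(** By translation invariance the integral of each difference quotient is zero. The indicator of a
    larger cube plays the part of the constant 1, which has no bounded support. *)
Lemma integral_pd psi i r : 0 <= r -> C1 psi -> vanishes_off r psi ->
  Int (pd i psi) = 0.
Proof.
move=> r0 C1psi psi0; have [hn0 h1 h0] := harmonic_steps.
have cpsi := C1_continuous C1psi.
have ip : leb.-integrable setT (EFin \o psi) by exact: continuous_integrable psi0.
have := @cvg_integral_difference_quotient psi (\1_(cube (r + 1))) i (r + 1) 1 _ C1psi _ _ _ hn0 h1
  h0.
have -> : (fun k : nat => Int (fun x => (k.+1%:R^-1)^-1 * (psi (x + k.+1%:R^-1 *: 'e_i) - psi x) *
    \1_(cube (r + 1)) x)) = cst 0.
  apply/funext => k /=; set h := k.+1%:R^-1.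
  rewrite (_ : (fun x => _) = (fun x => h^-1 * (psi (x + h *: 'e_i) - psi x))).
    have [it itE] := @Rintegral_translation psi (h *: 'e_i) ip.
    rewrite RintegralZl//; last exact: integrableBR.
    by rewrite RintegralB// itE subrr mulr0.
  apply/funext => x; rewrite indicE.
  have [xr|] := boolP (x \in _); first by rewrite mulr1.
  rewrite notin_setE => /cubeP/existsNP[j /negP]; rewrite -ltNge => xr.
  rewrite (vanishes_off_shift i (h1 k) psi0 xr) (psi0 x j) ?subrr ?mulr0//.
  by rewrite (lt_trans _ xr)// ltrDl.
have -> : (fun x => 'D_('e_i) psi x * \1_(cube (r + 1)) x) = pd i psi.
  apply/funext => x; rewrite indicE.
  have [xr|] := boolP (x \in _); first by rewrite mulr1.
  rewrite notin_setE => /cubeP/existsNP[j /negP]; rewrite -ltNge => xr.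
  have := vanishes_off_pd i C1psi psi0.
  move=> /(_ x j) ->; first by rewrite mul0r.
  by rewrite (lt_trans _ xr)// ltrDl.
move=> H; have {}H : (cst 0 : nat -> R) @ \oo --> Int (pd i psi).
  apply: H.
  - by apply: measurable_indic; exact: measurable_cube.
  - by move=> x; rewrite indicE; case: (_ \in _); rewrite ?normr1 ?normr0.
  - move=> x j xr; rewrite indicE memNset// => /cubeP/(_ j).
    by rewrite leNgt xr.
by rewrite -(cvg_lim (@Rhausdorff R) H); exact: lim_cst.
Qed.

Lemma C1M f g : C1 f -> C1 g -> C1 (fun x => f x * g x).
Proof.
move=> C1f C1g; have [_ df cf] := C1f; have [_ dg cg] := C1g.
split=> [|x i|i]; first exact: (continuousMR (C1_continuous C1f) (C1_continuous C1g)).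
  exact: derivableM.
have -> : pd i (fun x => f x * g x) = (fun x => f x * 'D_('e_i) g x + g x * 'D_('e_i) f x).
  by apply/funext => x; rewrite deriveM.
by apply: continuousDR; apply: continuousMR => //; exact: C1_continuous.
Qed.

Lemma pdM f g i x : C1 f -> C1 g ->
  'D_('e_i) (fun x => f x * g x) x = f x * 'D_('e_i) g x + g x * 'D_('e_i) f x.
Proof. by move=> [_ df _] [_ dg _]; rewrite deriveM. Qed.

Lemma C1B f g : C1 f -> C1 g -> C1 (fun x => f x - g x).
Proof.
move=> C1f C1g; have [_ df cf] := C1f; have [_ dg cg] := C1g.
split=> [|x i|i]; first exact: (continuousBR (C1_continuous C1f) (C1_continuous C1g)).
  exact: derivableB.
have -> : pd i (fun x => f x - g x) = (fun x => 'D_('e_i) f x - 'D_('e_i) g x).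
  by apply/funext => x; rewrite deriveB.
exact: continuousBR.
Qed.

Lemma pd_shift f v i x : 'D_('e_i) (fun x => f (x + v)) x = 'D_('e_i) f (x + v).
Proof.
rewrite /derive; set g1 := fun h : R => h^-1 *: _; set g2 := fun h : R => h^-1 *: _.
suff -> : g1 = g2 by [].
by apply/funext => h; rewrite /g1 /g2 /= addrA.
Qed.

Lemma C1_shift f v : C1 f -> C1 (fun x => f (x + v)).
Proof.
move=> [cf0 df cf]; split=> [|x i|i].
- exact: (continuous_comp_translation cf0).
- have := df (x + v) i; rewrite /derivable.
  set g1 := fun h : R => h^-1 *: _; set g2 := fun h : R => h^-1 *: _.
  suff -> : g1 = g2 by [].
  by apply/funext => h; rewrite /g1 /g2 /= addrA.
- have -> : pd i (fun x => f (x + v)) = (fun x => 'D_('e_i) f (x + v)).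
    by apply/funext => x; exact: pd_shift.
  exact: (continuous_comp_translation (cf i)).
Qed.

Lemma vanishes_offM r f g : vanishes_off r g -> vanishes_off r (fun x => f x * g x).
Proof. by move=> g0 x i xr; rewrite (g0 x i xr) mulr0. Qed.

(* Integrating twice by parts would need second derivatives of [f]; a
   difference quotient in the direction [i] replaces one of them. *)
Lemma integral_pd_swap f phi i j r : 0 <= r -> C1 f -> C1 phi -> vanishes_off r phi ->
  Int (fun x => 'D_('e_i) f x * 'D_('e_j) phi x) =
  Int (fun x => 'D_('e_j) f x * 'D_('e_i) phi x).
Proof.
move=> r0 C1f C1phi phi0; have [hn0 h1 h0] := harmonic_steps.
have [_ df cf] := C1f; have [_ dphi cphi] := C1phi.
have cf0 := C1_continuous C1f; have cphi0 := C1_continuous C1phi.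
have phij0 : vanishes_off r (pd j phi) by exact: vanishes_off_pd.
pose h k : R := k.+1%:R^-1.
have [C _ phiC] := continuous_bounded_cube r (cphi j).
have bphij x : `|'D_('e_j) phi x| <= `|C|.
  have [xr|/existsNP[l /negP]] := pselect (forall l, `|x ord0 l| <= r).
    by rewrite (le_trans (phiC x xr))// ler_norm.
  by rewrite -ltNge => /phij0 ->; rewrite normr0.
have cvg1 := @cvg_integral_difference_quotient f (pd j phi) i r _ h C1f
  (continuous_measurable_setT (cphi j)) bphij phij0 hn0 h1 h0.
(* The cut-off makes [D_j f] bounded; the cube still contains the support of [phi] after a shift by
   at most 1. *)
pose g x := 'D_('e_j) f x * \1_(cube (r + 1)) x.
have [C' C'0 fC'] := continuous_bounded_cube (r + 1) (cf j).
have mg : measurable_fun setT g.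
  apply: measurable_funM; first exact: continuous_measurable_setT.
  by apply: measurable_indic; exact: measurable_cube.
have bg x : `|g x| <= C'.
  rewrite /g indicE; have [|_] := boolP (x \in _); last by rewrite mulr0 normr0 ltW.
  by rewrite inE mulr1 => /cubeP; exact: fC'.
have g0 : vanishes_off (r + 1) g.
  move=> x l xr; rewrite /g indicE memNset ?mulr0// => /cubeP/(_ l).
  by rewrite leNgt xr.
have cvg2 := @cvg_integral_difference_quotient phi g i (r + 1) C' (fun k => - h k)
  C1phi mg bg g0
  ltac:(by move=> k; rewrite oppr_eq0; exact: hn0)
  ltac:(by move=> k; rewrite normrN; exact: h1)
  ltac:(by rewrite -oppr0; apply: cvgN; exact: h0).
have gphi : (fun x => 'D_('e_i) phi x * g x) = (fun x => 'D_('e_j) f x * 'D_('e_i) phi x).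
  apply/funext => x; rewrite /g indicE; have [_|] := boolP (x \in _).
    by rewrite mulr1 mulrC.
  rewrite notin_setE => /cubeP/existsNP[l /negP]; rewrite -ltNge => xr.
  rewrite (vanishes_off_pd i C1phi phi0 (i := l)) ?mulr0 ?mul0r//.
  by rewrite (lt_trans _ xr)// ltrDl.
rewrite gphi in cvg2.
(* Discrete form of the claim: a change of variables moves the quotient in direction [i] from [f] to
   [phi], reversing the step, and direction [j] is integrated by parts exactly. *)
suff E k : Int (fun x => (- h k)^-1 * (phi (x + (- h k) *: 'e_i) - phi x) * g x) =
    Int (fun x => (h k)^-1 * (f (x + h k *: 'e_i) - f x) * 'D_('e_j) phi x).
  rewrite -(cvg_lim (@Rhausdorff R) cvg1) -(cvg_lim (@Rhausdorff R) cvg2).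
  by under eq_fun do rewrite -E.
set t := h k; have t1 : `|t| <= 1 by exact: h1.
have tn1 : `|- t| <= 1 by rewrite normrN.
have r1 : r <= r + 1 by rewrite lerDl.
have ie u : continuous u -> vanishes_off (r + 1) u -> leb.-integrable setT (EFin \o u).
  exact: continuous_integrable.
have cft : continuous (fun x => f (x + t *: 'e_i)).
  exact: (continuous_comp_translation cf0).
have cfjt : continuous (fun x => 'D_('e_j) f (x + t *: 'e_i)).
  exact: (continuous_comp_translation (cf j)).
have cphit : continuous (fun x => phi (x + (- t) *: 'e_i)).
  exact: (continuous_comp_translation cphi0).
have phi1 := vanishes_off_le r1 phi0; have phij1 := vanishes_off_le r1 phij0.
pose a x := (f (x + t *: 'e_i) - f x) * 'D_('e_j) phi x.
pose b x := 'D_('e_j) f (x + t *: 'e_i) * phi x.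
pose c x := 'D_('e_j) f x * phi x.
pose b' x := 'D_('e_j) f x * phi (x + (- t) *: 'e_i).
have ia : leb.-integrable setT (EFin \o a).
  by apply: ie; [apply: continuousMR => //; exact: continuousBR|exact: vanishes_offM].
have ib : leb.-integrable setT (EFin \o b).
  by apply: ie; [exact: continuousMR|exact: vanishes_offM].
have ic : leb.-integrable setT (EFin \o c).
  by apply: ie; [exact: continuousMR|exact: vanishes_offM].
have ib' : leb.-integrable setT (EFin \o b').
  by apply: ie; [exact: continuousMR|apply: vanishes_offM; exact: vanishes_off_shift].
have bb' : Int b = Int b'.
  have [_ <-] := @Rintegral_translation b' (t *: 'e_i) ib'.
  by congr (Rintegral _ _ _); apply/funext => x; rewrite /b /b' scaleNr addrK.
(* This is [integral_pd] in direction [j] for the product of [f (x + t e_i) - f x] and [phi x]. *)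
have abc : Int a + (Int b - Int c) = 0.
  rewrite -RintegralB// -RintegralD//; last exact: integrableBR.
  have C1ft : C1 (fun x => f (x + t *: 'e_i) - f x).
    exact: (C1B (C1_shift _ C1f) C1f).
  have := @integral_pd (fun x => (f (x + t *: 'e_i) - f x) * phi x) j r r0
    (C1M C1ft C1phi) (vanishes_offM _ phi0).
  move=> <-; congr (Rintegral _ _ _); apply/funext => x.
  rewrite pdM// /a /b /c; congr (_ + _).
  rewrite deriveB; last 2 first.
  - by have [_ d _] := C1_shift (t *: 'e_i) C1f; exact: d.
  - exact: df.
  by rewrite pd_shift; ring.
rewrite (_ : (fun x => _ * g x) = (fun x => - t^-1 * (b' x - c x))); last first.
  apply/funext => x; rewrite /b' /c /g invrN.
  rewrite indicE; have [_|] := boolP (x \in _); first by rewrite mulr1; ring.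
  rewrite notin_setE => /cubeP/existsNP[l /negP]; rewrite -ltNge => xr.
  rewrite (vanishes_off_shift i tn1 phi0 xr) (phi1 x l xr); ring.
rewrite (_ : (fun x => _ * 'D_('e_j) phi x) = (fun x => t^-1 * a x)); last first.
  by apply/funext => x; rewrite /a mulrA.
rewrite RintegralZl//; last exact: integrableBR.
rewrite RintegralZl// RintegralB// -bb'.
have -> : Int a = - (Int b - Int c) by apply/eqP; rewrite -addr_eq0; apply/eqP.
by rewrite mulNr mulrN.
Qed.

End integration_by_parts.

(** * Euclidean inner product and quadratic forms *)

Section euclidean.
Context {R : realType} {n : nat}.
Implicit Types (x y z xi eta : 'rV[R]_n) (A : 'M[R]_n) (c : R).

Lemma dotrvE x y : dotrv x y = (x *m y^T) ord0 ord0.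
Proof. by rewrite mxE; apply: eq_bigr => i _; rewrite mxE. Qed.

Lemma dotrvC x y : dotrv x y = dotrv y x.
Proof. by apply: eq_bigr => i _; rewrite mulrC. Qed.

Lemma dotrvDl x y z : dotrv (x + y) z = dotrv x z + dotrv y z.
Proof. by rewrite !dotrvE mulmxDl mxE. Qed.

Lemma dotrvDr x y z : dotrv x (y + z) = dotrv x y + dotrv x z.
Proof. by rewrite !(dotrvC x) dotrvDl. Qed.

Lemma dotrvZl c x y : dotrv (c *: x) y = c * dotrv x y.
Proof. by rewrite !dotrvE -scalemxAl mxE. Qed.

Lemma dotrvZr c x y : dotrv x (c *: y) = c * dotrv x y.
Proof. by rewrite !(dotrvC x) dotrvZl. Qed.

Lemma dotrvBr x y z : dotrv x (y - z) = dotrv x y - dotrv x z.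
Proof. by rewrite dotrvDr -scaleN1r dotrvZr mulN1r. Qed.

Lemma dotrv_ge0 x : 0 <= dotrv x x.
Proof. by apply: sumr_ge0 => i _; rewrite -expr2 sqr_ge0. Qed.

Lemma enorm_ge0 x : 0 <= enorm x. Proof. exact: sqrtr_ge0. Qed.

Lemma sqr_enorm x : enorm x ^+ 2 = dotrv x x.
Proof. by rewrite sqr_sqrtr// dotrv_ge0. Qed.

Lemma sqr_coord_le x i : x ord0 i ^+ 2 <= dotrv x x.
Proof.
rewrite /dotrv (bigD1 i)//= -expr2 lerDl sumr_ge0// => j _.
by rewrite -expr2 sqr_ge0.
Qed.

Lemma normr_coord_le x i : `|x ord0 i| <= enorm x.
Proof. by rewrite -sqrtr_sqr ler_wsqrtr// sqr_coord_le. Qed.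

Lemma dotrv_eq0 x : dotrv x x = 0 -> x = 0.
Proof.
move=> x0; apply/rowP => i; rewrite mxE; apply/eqP; rewrite -sqrf_eq0.
by rewrite eq_le sqr_ge0 andbT -x0 sqr_coord_le.
Qed.

Lemma dotrv_cauchy x y : dotrv x y ^+ 2 <= dotrv x x * dotrv y y.
Proof.
have [y0|y0] := eqVneq (dotrv y y) 0.
  by rewrite (dotrv_eq0 y0) !dotrvE trmx0 !mulmx0 mxE expr0n mulr0.
have yy : 0 < dotrv y y by rewrite lt_def y0 dotrv_ge0.
have := dotrv_ge0 (dotrv y y *: x + (- dotrv x y) *: y).
rewrite !(dotrvDl, dotrvDr, dotrvZl, dotrvZr) (dotrvC y x) => h.
have : 0 <= dotrv y y * (dotrv x x * dotrv y y - dotrv x y ^+ 2).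
  by apply: le_trans h _; rewrite le_eqVlt; apply/orP; left; apply/eqP; ring.
by rewrite pmulr_rge0// subr_ge0.
Qed.

Lemma mulmrvD A x y : mulmrv A (x + y) = mulmrv A x + mulmrv A y.
Proof. exact: mulmxDl. Qed.

Lemma mulmrvZ A c x : mulmrv A (c *: x) = c *: mulmrv A x.
Proof. by rewrite /mulmrv -scalemxAl. Qed.

Lemma dotrv_mulmrv_sym A x y : A^T = A -> dotrv (mulmrv A x) y = dotrv (mulmrv A y) x.
Proof.
move=> As; rewrite (dotrvC _ x) !dotrvE /mulmrv As trmx_mul As mulmxA.
by [].
Qed.

(** The form is nonnegative at [c x - e y] for [e = 1] and [e = -1]. The right-hand side is linear
    in the two energies, so it can be integrated directly and [c] chosen afterwards. *)
Lemma mulmrv_young A x y c : A^T = A -> (forall xi, 0 <= dotrv (mulmrv A xi) xi) -> 0 < c ->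
  `|dotrv (mulmrv A x) y| <= c / 2 * dotrv (mulmrv A x) x + (2 * c)^-1 * dotrv (mulmrv A y) y.
Proof.
move=> As A0 c0.
have h (e : R) : e ^+ 2 = 1 -> e * dotrv (mulmrv A x) y <=
    c / 2 * dotrv (mulmrv A x) x + (2 * c)^-1 * dotrv (mulmrv A y) y.
  move=> e1; have := A0 (c *: x + (- e) *: y).
  rewrite !(mulmrvD, mulmrvZ) !(dotrvDl, dotrvDr, dotrvZl, dotrvZr).
  rewrite (dotrv_mulmrv_sym y x As).
  set a := dotrv _ x; set b := dotrv _ y; set d := dotrv _ y => H.
  rewrite -subr_ge0.
  suff -> : c / 2 * a + (2 * c)^-1 * d - e * b =
      (2 * c)^-1 * (c * (c * a) + - e * (c * b) + (c * (- e * b) + - e * (- e * d))).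
    by apply: mulr_ge0; [rewrite invr_ge0 mulr_ge0// ltW|move: H; lra].
  have -> : - e * (- e * d) = d by rewrite mulrA mulrNN -expr2 e1 mul1r.
  by field; rewrite gt_eqF.
rewrite ler_norml lerNl -mulN1r.
by rewrite h ?sqrrN ?expr1n//= -[X in X <= _]mul1r h// expr1n.
Qed.

End euclidean.

(** * The unit ball and its test functions *)

Section ball.
Context {R : realType} {n : nat}.
Implicit Types (x : 'rV[R]_n) (phi : 'rV[R]_n -> R).

Local Notation leb := (@lebesgue_rV R n).
Local Notation B := (@unit_ball R n).
Local Notation "''e_' i" := (delta_mx ord0 i : 'rV[R]_n) (at level 8, i at level 2).

Lemma continuous_dotrv : continuous (fun x => dotrv x x).
Proof.
have -> : (fun x : 'rV[R]_n => dotrv x x) = \sum_i (fun x => x ord0 i * x ord0 i).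
  by apply/funext => x; rewrite fct_sumE.
elim/big_rec : _ => [|i f _ cf]; first exact: cst_continuous.
apply: continuousDR => //; apply: continuousMR; exact: coord_continuous.
Qed.

Lemma continuous_enorm : continuous (@enorm R n).
Proof.
move=> x; apply: (@continuous_comp _ _ _ (fun x => dotrv x x) Num.sqrt).
  exact: continuous_dotrv.
exact: sqrt_continuous.
Qed.

Lemma open_unit_ball : open B.
Proof.
apply: (@open_comp _ _ (@enorm R n) [set t | t < 1]) => [x _|]; last exact: open_lt.
exact: continuous_enorm.
Qed.

Lemma measurable_unit_ball : measurable B.
Proof. by apply: open_measurable_rV; exact: open_unit_ball. Qed.

Lemma unit_ball_coord x i : B x -> `|x ord0 i| <= 1.
Proof. by move=> Bx; apply: le_trans (normr_coord_le x i) (ltW Bx). Qed.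

(** Extension by zero: every point has a neighbourhood inside the ball or one that misses the
    compact support, so the derivatives glue. Integrals over the ball become integrals over R^n. *)
Lemma C1c_extension phi : C1c_ball phi -> exists phi0 : 'rV[R]_n -> R,
  [/\ C1 phi0, vanishes_off 1 phi0,
    forall x, ~ B x -> phi0 x = 0 /\ forall i, 'D_('e_i) phi0 x = 0 &
    forall x, B x -> phi0 x = phi x /\
      forall i, 'D_('e_i) phi0 x = grad phi x ord0 i].
Proof.
move=> [C1phi [cS SB]]; set S := closure _ in cS SB.
pose phi0 x := if x \in B then phi x else 0.
have phi0B x : B x -> \forall y \near x, phi y = phi0 y.
  move=> Bx; have := open_nbhs_nbhs (conj open_unit_ball Bx).
  by apply: filterS => y By; rewrite /phi0 mem_set.
have phi0S x : ~ S x -> \forall y \near x, cst 0 y = phi0 y.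
  move=> Sx; have oS : open (~` S).
    apply: closed_openC; apply: compact_closed => //; exact: norm_hausdorff.
  have := open_nbhs_nbhs (conj oS Sx).
  apply: filterS => y Sy; rewrite /phi0; case: ifPn => //; rewrite inE => By.
  apply/esym/eqP/negPn/negP => phiy; apply: Sy; apply: subset_closure.
  by split.
have dB x i : B x -> is_derive x ('e_i) phi0 (grad phi x ord0 i).
  move=> Bx; apply: (near_eq_is_derive (phi0B x Bx)).
  by rewrite mxE; apply: derivableP; apply: diff_derivable; have [] := C1phi x Bx.
have dS x i : ~ S x -> is_derive x ('e_i) phi0 0.
  by move=> Sx; apply: (near_eq_is_derive (phi0S x Sx)); exact: is_derive_cst.
have nB x : ~ B x -> phi0 x = 0 /\ forall i, 'D_('e_i) phi0 x = 0.
  move=> Bx; split; first by rewrite /phi0 memNset.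
  by move=> i; have := dS x i; case=> [/SB|].
exists phi0; split => //.
- split.
  + move=> x; have [Sx|Sx] := pselect (S x).
      have /phi0B h := SB x Sx; have [dphi _] := C1phi x (SB x Sx).
      have cphi := differentiable_continuous dphi.
      rewrite /continuous_at -(nbhs_singleton h).
      apply: cvg_trans cphi; exact: (near_eq_cvg h).
    have h := phi0S x Sx.
    rewrite /continuous_at -(nbhs_singleton h).
    by apply: cvg_trans (@cst_continuous _ _ 0 x); exact: (near_eq_cvg h).
  + move=> x i; have [Sx|Sx] := pselect (S x).
      by have [] := dB x i (SB x Sx).
    by have [] := dS x i Sx.
  + move=> i x; have [Sx|Sx] := pselect (S x).
      have Bx := SB x Sx; have [_ cg] := C1phi x Bx.
      have h : \forall y \near x, grad phi y ord0 i = 'D_('e_i) phi0 y.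
        have := open_nbhs_nbhs (conj open_unit_ball Bx).
        by apply: filterS => y By; have [_ ->] := dB y i By.
      rewrite /continuous_at -(nbhs_singleton h).
      have c : {for x, continuous (fun y => grad phi y ord0 i)}.
        apply: (@continuous_comp _ _ _ (grad phi) (fun v => v ord0 i)) => //.
        exact: coord_continuous.
      by apply: cvg_trans c; exact: (near_eq_cvg h).
    have h : \forall y \near x, cst 0 y = 'D_('e_i) phi0 y.
      have oS : open (~` S).
        apply: closed_openC; apply: compact_closed => //; exact: norm_hausdorff.
      have := open_nbhs_nbhs (conj oS Sx).
      by apply: filterS => y Sy; have [_ ->] := dS y i Sy.
    rewrite /continuous_at -(nbhs_singleton h).
    by apply: cvg_trans (@cst_continuous _ _ 0 x); exact: (near_eq_cvg h).
- move=> x i xi; have [|//] := nB x.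
  by move=> /(unit_ball_coord i); rewrite leNgt xi.
- move=> x Bx; split; first by rewrite /phi0 mem_set.
  by move=> i; have [_ ->] := dB x i Bx.
Qed.

Lemma integral_ball_eq (f f0 : 'rV[R]_n -> R) :
  (forall x, B x -> f0 x = f x) -> (forall x, ~ B x -> f0 x = 0) ->
  (\int[leb]_(x in B) (f x)%:E = \int[leb]_x (f0 x)%:E)%E.
Proof.
move=> fB fN; rewrite integral_mkcond; apply: eq_integral => x _.
by rewrite /patch; case: ifPn; [rewrite inE => /fB ->|rewrite notin_setE => /fN ->].
Qed.

Lemma negligible_rV0 : (0 < n)%N -> leb.-negligible [set (0 : 'rV[R]_n)].
Proof.
move=> n0; apply: (@negligibleS _ _ _ _ [set v : 'rV[R]_n | forall i, [set (0 : R)] (v ord0 i)]).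
  by move=> x -> i; rewrite /= mxE.
apply/negligibleP; first exact: (@measurable_box R n (fun=> [set 0])).
apply: (eq_trans (@lebesgue_rV_box R n (fun=> [set 0]) _)) => //.
by rewrite (bigD1 (Ordinal n0))//= lebesgue_measure_set1 mul0e.
Qed.

End ball.

(** * Weak solutions as limits of regular ones *)

Section weak_solution_limit.
Context {R : realType} {n : nat}.

Local Notation leb := (@lebesgue_rV R n).
Local Notation B := (@unit_ball R n).
Local Notation "''e_' i" := (delta_mx ord0 i : 'rV[R]_n) (at level 8, i at level 2).

(** [D] is one integrable function dominating [Lam], the weighted squared gradients and the fluxes
    of all approximants off the origin. The approximation of [u] and that of [F] are independent:
    [F_ k] is divergence free but need not be [A] applied to the gradient of [u_ k]. *)
Variables (A : 'rV[R]_n -> 'M[R]_n) (Lam D u : 'rV[R]_n -> R) (G F : 'rV[R]_n -> 'rV[R]_n).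
Variables (u_ : nat -> 'rV[R]_n -> R) (F_ : nat -> 'rV[R]_n -> 'rV[R]_n).
Hypotheses (n0 : (0 < n)%N)
  (mA : forall i j, measurable_fun B (fun x => A x i j))
  (Asym : forall x, B x -> (A x)^T = A x)
  (Aell : forall x, B x -> forall xi,
     dotrv xi xi <= dotrv (mulmrv (A x) xi) xi <= Lam x * dotrv xi xi)
  (AG : forall x, B x -> mulmrv (A x) (G x) = F x)
  (mLam : measurable_fun B Lam) (Lam1 : forall x, B x -> 1 <= Lam x)
  (mu : measurable_fun B u)
  (mG : forall i, measurable_fun B (fun x => G x ord0 i))
  (mF : forall i, measurable_fun B (fun x => F x ord0 i))
  (iD : leb.-integrable B (EFin \o D))
  (LamD : forall x, B x -> Lam x <= D x)
  (u2 : forall x, B x -> `|u x| <= 2)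
  (GD : forall x i, B x -> Lam x * G x ord0 i ^+ 2 <= D x)
  (C1u_ : forall k, C1_ball (u_ k)) (C1pu_ : forall k, C1 (u_ k))
  (u_2 : forall k x, B x -> `|u_ k x| <= 2)
  (u_D : forall k x i, B x -> x <> 0 -> Lam x * ('D_('e_i) (u_ k) x) ^+ 2 <= D x)
  (cvg_u : forall x, B x -> x <> 0 -> u_ ^~ x @ \oo --> u x)
  (cvg_G : forall x i, B x -> x <> 0 ->
     (fun k => 'D_('e_i) (u_ k) x) @ \oo --> G x ord0 i)
  (mF_ : forall k i, measurable_fun B (fun x => F_ k x ord0 i))
  (F_D : forall k x i, B x -> x <> 0 -> `|F_ k x ord0 i| <= D x)
  (cvg_F : forall x i, B x -> x <> 0 -> (fun k => F_ k x ord0 i) @ \oo --> F x ord0 i)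
  (divF_ : forall k phi, C1 phi -> vanishes_off 1 phi ->
     (\int[leb]_x (\sum_i F_ k x ord0 i * 'D_('e_i) phi x)%:E = 0)%E).

Let mB : measurable B. Proof. exact: measurable_unit_ball. Qed.

Let N0 : leb.-negligible [set (0 : 'rV[R]_n)]. Proof. exact: negligible_rV0. Qed.

Let D1 x : B x -> 1 <= D x.
Proof. by move=> Bx; apply: le_trans (Lam1 Bx) (LamD Bx). Qed.

Let sqr_leD x t : B x -> Lam x * t ^+ 2 <= D x -> t ^+ 2 <= D x.
Proof.
move=> Bx; apply: le_trans; rewrite ler_peMl ?sqr_ge0//; exact: Lam1.
Qed.

Let normr_leD x t : B x -> Lam x * t ^+ 2 <= D x -> `|t| <= D x.
Proof.
move=> Bx /(sqr_leD Bx); have := D1 Bx => d1 tD.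
have [t1|t1] := leP `|t| 1; first exact: le_trans d1.
apply: le_trans tD; rewrite -real_normK ?num_real// expr2 ler_peMl//; exact: ltW.
Qed.

Let integrable_le (f : 'rV[R]_n -> R) c : measurable_fun B f ->
  (forall x, B x -> `|f x| <= c * D x) -> leb.-integrable B (EFin \o f).
Proof.
move=> mf fD; apply: (@le_integrable _ _ _ _ _ mB _ (EFin \o (fun x => c * D x))).
- exact/measurable_EFinP.
- by move=> x Bx; rewrite /= lee_fin (le_trans (fD x Bx))// ler_norm.
- exact: integrableZR.
Qed.

Let integrableD_scaled c : leb.-integrable B (EFin \o (fun x => c * D x)).
Proof. exact: integrableZR. Qed.

Let measurable_grad phi i : C1_ball phi -> measurable_fun B (fun x => grad phi x ord0 i).
Proof.
move=> C1phi; apply: continuous_measurable_rV; first exact: open_unit_ball.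
move=> x Bx; have [_ cg] := C1phi x Bx.
apply: (@continuous_comp _ _ _ (grad phi) (fun v => v ord0 i)) => //.
exact: coord_continuous.
Qed.

Let measurable_C1_ball phi : C1_ball phi -> measurable_fun B phi.
Proof.
move=> C1phi; apply: continuous_measurable_rV; first exact: open_unit_ball.
by move=> x Bx; have [d _] := C1phi x Bx; exact: differentiable_continuous.
Qed.

Let measurable_bilinear (X Y : 'rV[R]_n -> 'rV[R]_n) :
  (forall i, measurable_fun B (fun x => X x ord0 i)) ->
  (forall i, measurable_fun B (fun x => Y x ord0 i)) ->
  measurable_fun B (fun x => dotrv (mulmrv (A x) (X x)) (Y x)).
Proof.
move=> mX mY; apply: measurable_sum => i; apply: measurable_funM => //.
under eq_fun do rewrite mxE.
apply: measurable_sum => j; apply: measurable_funM => //.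
by under eq_fun do rewrite mxE; exact: mA.
Qed.

Let C1c_bounds phi : C1c_ball phi -> exists2 c, 0 <= c &
  forall x, B x -> `|phi x| <= c /\ forall i, `|grad phi x ord0 i| <= c.
Proof.
move=> /C1c_extension[phi0 [C1phi0 _ _ phiB]].
have [cphi0 _ cphi] := C1phi0.
have [c c0 phic] := continuous_bounded_cube 1 cphi0.
pose d i := sval (cid2 (continuous_bounded_cube 1 (cphi i))).
have dP i : 0 < d i /\ forall x : 'rV[R]_n, (forall j, `|x ord0 j| <= 1) -> `|'D_('e_i) phi0 x| <=
  d i.
  by rewrite /d; case: cid2.
exists (c + \sum_i d i).
  by rewrite addr_ge0 ?(ltW c0)// sumr_ge0// => i _; have [/ltW] := dP i.
move=> x Bx; have [<- gE] := phiB x Bx.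
have xc j : `|x ord0 j| <= 1 by exact: unit_ball_coord.
have sd : 0 <= \sum_i d i by rewrite sumr_ge0// => i _; have [/ltW] := dP i.
split; first by rewrite (le_trans (phic x xc))// lerDl.
move=> i; rewrite -gE; have [_ h] := dP i; rewrite (le_trans (h x xc))//.
rewrite (bigD1 i)//= addrCA lerDl addr_ge0 ?(ltW c0)// sumr_ge0// => j _.
by have [/ltW] := dP j.
Qed.

(** Integration by parts holds exactly for each [u_ k], and both sides converge by domination, so
    the singularity at the origin leaves no extra term. *)
Let weak_gradient_uG : weak_gradient u G.
Proof.
move=> phi C1cphi i.
have [phi0 [C1phi0 phi01 phiN phiB]] := C1c_extension C1cphi.
have [c c0 phic] := C1c_bounds C1cphi; have [C1phi _] := C1cphi.
have [cphi0 _ cphi] := C1phi0.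
have step k : (\int[leb]_(x in B) (u_ k x * grad phi x ord0 i)%:E =
    - \int[leb]_(x in B) ('D_('e_i) (u_ k) x * phi x)%:E)%E.
  have [cu _ cdu] := C1pu_ k.
  rewrite (@integral_ball_eq _ _ _ (fun x => u_ k x * 'D_('e_i) phi0 x)); last 2 first.
  - by move=> x /phiB[_ ->].
  - by move=> x /phiN[_ ->]; rewrite mulr0.
  rewrite (@integral_ball_eq _ _ _ (fun x => 'D_('e_i) (u_ k) x * phi0 x)); last 2 first.
  - by move=> x /phiB[-> _].
  - by move=> x /phiN[-> _]; rewrite mulr0.
  have i1 : leb.-integrable setT (EFin \o (fun x => u_ k x * 'D_('e_i) phi0 x)).
    apply: (@continuous_integrable _ _ _ 1); first exact: continuousMR.
    by apply: vanishes_offM; exact: vanishes_off_pd.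
  have i2 : leb.-integrable setT (EFin \o (fun x => 'D_('e_i) (u_ k) x * phi0 x)).
    by apply: (@continuous_integrable _ _ _ 1); [exact: continuousMR|exact: vanishes_offM].
  rewrite -(fineK (integrable_fin_num measurableT i1)) -(fineK (integrable_fin_num measurableT i2)).
  rewrite -EFinN; congr (_%:E); apply/eqP; rewrite -subr_eq0 opprK; apply/eqP.
  have := @integral_pd _ _ (fun x => u_ k x * phi0 x) i 1 ler01
    (C1M (C1pu_ k) C1phi0) (vanishes_offM _ phi01).
  have -> : (fun x => 'D_('e_i) (fun x => u_ k x * phi0 x) x) =
      (fun x => u_ k x * 'D_('e_i) phi0 x + 'D_('e_i) (u_ k) x * phi0 x).
    by apply/funext => x; rewrite pdM// (mulrC (phi0 x)).
  by rewrite RintegralD.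
have m1 k : measurable_fun B (fun x => u_ k x * grad phi x ord0 i).
  exact: (measurable_funM (measurable_C1_ball (C1u_ k)) (measurable_grad i C1phi)).
have m2 : measurable_fun B (fun x => u x * grad phi x ord0 i).
  by apply: measurable_funM => //; exact: measurable_grad.
have b1 k x : B x -> ~ [set (0 : 'rV[R]_n)] x ->
    `|u_ k x * grad phi x ord0 i| <= (2 * c) * D x.
  move=> Bx _; have [_ /(_ i) gc] := phic x Bx; have uk2 := u_2 k Bx.
  have d1 := D1 Bx.
  have h : `|u_ k x * grad phi x ord0 i| <= 2 * c by rewrite normrM; exact: ler_pM.
  by apply: le_trans h _; rewrite ler_peMr// mulr_ge0.
have c1 x : B x -> ~ [set (0 : 'rV[R]_n)] x ->
    u_ k x * grad phi x ord0 i @[k --> \oo] --> u x * grad phi x ord0 i.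
  by move=> Bx x0; apply: cvgM; [exact: cvg_u|exact: cvg_cst].
have [_ _ cvg1] := @dominated_convergence_Rintegral _ _ R leb B [set (0 : 'rV[R]_n)]
  (fun k x => u_ k x * grad phi x ord0 i) (fun x => u x * grad phi x ord0 i) (fun x => (2 * c) * D
    x)
  mB N0 m1 m2 (integrableD_scaled _) c1 b1.
have [_ _ cvg2] := @dominated_convergence_Rintegral _ _ R leb B [set (0 : 'rV[R]_n)]
  (fun k x => 'D_('e_i) (u_ k) x * phi x) (fun x => G x ord0 i * phi x) (fun x => c * D x) mB N0
  ltac:(by move=> k; apply: measurable_funM; [
    have [_ _ cdu] := C1pu_ k; apply: measurable_funTS; exact: continuous_measurable_setT
    |exact: measurable_C1_ball])
  ltac:(by apply: measurable_funM => //; exact: measurable_C1_ball)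
  (integrableD_scaled _)
  ltac:(by move=> x Bx x0; apply: cvgM; [exact: cvg_G|exact: cvg_cst])
  ltac:(by move=> k x Bx x0; rewrite normrM mulrC; have [pc _] := phic x Bx;
    apply: ler_pM => //; apply: normr_leD => //; exact: u_D).
have cvg1' : (\int[leb]_(x in B) (u_ k x * grad phi x ord0 i)%:E)%E @[k --> \oo] -->
    (- \int[leb]_(x in B) (G x ord0 i * phi x)%:E)%E.
  by under eq_fun do rewrite step; exact: cvgeN.
by rewrite -(cvg_lim _ cvg1)// -(cvg_lim _ cvg1').
Qed.

Let W12_uG : W12_ball u G.
Proof.
split=> [|i|]; last exact: weak_gradient_uG.
- split=> //; apply: (integrable_lty mB); apply: (@integrable_le (fun x => u x ^+ 2) 4).
    exact: measurable_funX.
  move=> x Bx; rewrite normrX; have := u2 Bx; have := D1 Bx.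
  have := normr_ge0 (u x); set t := `|u x| => t0 d1 t2.
  have : t * t <= 2 * 2 by exact: ler_pM.
  by rewrite -expr2; lra.
- split=> //; apply: (integrable_lty mB); apply: (@integrable_le (fun x => G x ord0 i ^+ 2) 1).
    exact: measurable_funX.
  move=> x Bx; rewrite mul1r ger0_norm ?sqr_ge0//.
  by apply: (sqr_leD Bx); exact: GD.
Qed.

Local Notation energy v X := (fun x => dotrv (mulmrv (A x) (X x)) (X x) + Lam x * v x ^+ 2).

Let energy_le x (xi : 'rV[R]_n) (t a b : R) : B x ->
  (forall i, Lam x * xi ord0 i ^+ 2 <= a * D x) -> t ^+ 2 <= b -> 0 <= b ->
  `|dotrv (mulmrv (A x) xi) xi + Lam x * t ^+ 2| <= (n%:R * a + b) * D x.
Proof.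
move=> Bx xia tb b0; have /andP[e1 e2] := Aell Bx xi.
have L0 : 0 <= Lam x by apply: le_trans (Lam1 Bx).
have q0 := le_trans (dotrv_ge0 xi) e1.
rewrite ger0_norm; last by apply: addr_ge0 => //; rewrite mulr_ge0 ?sqr_ge0.
rewrite mulrDl lerD//.
  apply: le_trans e2 _; rewrite /dotrv mulr_sumr -mulrA mulr_natl.
  rewrite -[n in X in _ <= X]card_ord -sumr_const.
  by apply: ler_sum => i _; rewrite -expr2.
rewrite mulrC ler_pM ?sqr_ge0//; exact: LamD.
Qed.

Let cvg_dotrv (a : nat -> 'rV[R]_n) (M : 'M[R]_n) (l : 'rV[R]_n) :
  (forall i, (fun k => a k ord0 i) @ \oo --> l ord0 i) ->
  dotrv (mulmrv M (a k)) (a k) @[k --> \oo] --> dotrv (mulmrv M l) l.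
Proof.
move=> al; apply: cvg_sumR => i; apply: cvgM => //.
rewrite mxE; under eq_fun do rewrite mxE.
by apply: cvg_sumR => j; apply: cvgM => //; exact: cvg_cst.
Qed.

Let cvg_sqr (a : nat -> R) (l : R) : a @ \oo --> l -> a k ^+ 2 @[k --> \oo] --> l ^+ 2.
Proof. by move=> al; rewrite expr2; under eq_fun do rewrite expr2; exact: cvgM. Qed.

Let cvg_energy x (X_ : nat -> 'rV[R]_n) (X : 'rV[R]_n) (v_ : nat -> R) (v : R) :
  (forall i, (fun k => X_ k ord0 i) @ \oo --> X ord0 i) -> v_ @ \oo --> v ->
  dotrv (mulmrv (A x) (X_ k)) (X_ k) + Lam x * v_ k ^+ 2 @[k --> \oo] -->
  dotrv (mulmrv (A x) X) X + Lam x * v ^+ 2.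
Proof.
move=> XX vv; apply: cvgD; first exact: cvg_dotrv.
by apply: cvgM; [exact: cvg_cst|exact: cvg_sqr].
Qed.

Let measurable_energy (X : 'rV[R]_n -> 'rV[R]_n) (v : 'rV[R]_n -> R) :
  (forall i, measurable_fun B (fun x => X x ord0 i)) -> measurable_fun B v ->
  measurable_fun B (energy v X).
Proof.
move=> mX mv; apply: measurable_funD; first exact: measurable_bilinear.
by apply: measurable_funM => //; exact: measurable_funX.
Qed.

(** The [u_ k] themselves are the approximants. The energy of [u_ k - u] is dominated by
    [(4 n + 16) D], from [(a - b)^2 <= 2 a^2 + 2 b^2] and [|u_ k - u| <= 4], and tends to 0 off the
    origin. *)
Let H1_uG : H1 A Lam u G.
Proof.
split; first exact: W12_uG.
exists u_.
have gE k x i : grad (u_ k) x ord0 i = 'D_('e_i) (u_ k) x by rewrite mxE.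
have mgk k i : measurable_fun B (fun x => grad (u_ k) x ord0 i) by exact: measurable_grad.
have muk k : measurable_fun B (u_ k) by exact: measurable_C1_ball.
have cvg_g x i : B x -> x <> 0 -> (fun k => grad (u_ k) x ord0 i) @ \oo --> G x ord0 i.
  by move=> Bx x0; under eq_fun do rewrite gE; exact: cvg_G.
have bound0 k x : B x -> ~ [set (0 : 'rV[R]_n)] x ->
    `|energy (u_ k) (grad (u_ k)) x| <= (n%:R * 1 + 4) * D x.
  move=> Bx x0; apply: energy_le => // [i|]; first by rewrite gE mul1r; exact: u_D.
  rewrite -real_normK ?num_real// (_ : 4 = 2 ^+ 2); last by rewrite expr2; lra.
  by rewrite ler_sqr ?nnegrE//; exact: u_2.
split=> [k|].
  have [int _ _] := @dominated_convergence_Rintegral _ _ R leb B [set (0 : 'rV[R]_n)]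
    (fun k => energy (u_ k) (grad (u_ k))) (energy u G) (fun x => (n%:R * 1 + 4) * D x) mB N0
    (fun k => measurable_energy (mgk k) (muk k)) (measurable_energy mG mu)
    (integrableD_scaled _)
    (fun x Bx x0 => @cvg_energy x _ _ _ _ (fun i => cvg_g x i Bx x0) (cvg_u Bx x0))
    bound0.
  by split=> //; exact: (integrable_lty mB (int k)).
have mX k i : measurable_fun B (fun x => (grad (u_ k) \- G) x ord0 i).
  rewrite (_ : (fun x => _) = (fun x => grad (u_ k) x ord0 i - G x ord0 i)).
    exact: measurable_funB.
  by apply/funext => x; rewrite !mxE.
have cvg_X x i : B x -> x <> 0 ->
    (fun k => (grad (u_ k) \- G) x ord0 i) @ \oo --> (0 : 'rV[R]_n) ord0 i.
  move=> Bx x0; rewrite mxE -(subrr (G x ord0 i)).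
  rewrite (_ : (fun k => _) = (fun k => grad (u_ k) x ord0 i - G x ord0 i)).
    by apply: cvgB; [exact: cvg_g|exact: cvg_cst].
  by apply/funext => k; rewrite !mxE.
have cvg_0 x : B x -> x <> 0 -> (fun k => (u_ k \- u) x) @ \oo --> 0.
  by move=> Bx x0; rewrite -(subrr (u x)); apply: cvgB; [exact: cvg_u|exact: cvg_cst].
have bound k x : B x -> ~ [set (0 : 'rV[R]_n)] x ->
    `|energy (u_ k \- u) (grad (u_ k) \- G) x| <= (n%:R * 4 + 16) * D x.
  move=> Bx x0; apply: energy_le => // [i|].
    rewrite !mxE; have := u_D k i Bx x0; have := GD i Bx; have := Lam1 Bx.
    set a := 'D_('e_i) (u_ k) x; set b := G x ord0 i => l1 h1 h2.
    have : Lam x * (a - b) ^+ 2 <= Lam x * (2 * a ^+ 2 + 2 * b ^+ 2).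
      by rewrite ler_pM2l; [have := sqr_ge0 (a + b); lra|lra].
    by move: h1 h2; lra.
  have h : `|u_ k x - u x| <= 4.
    by apply: le_trans (ler_normB _ _) _; have := u_2 k Bx; have := u2 Bx; lra.
  rewrite -real_normK ?num_real// (_ : 16 = 4 ^+ 2); first by rewrite ler_sqr ?nnegrE.
  by rewrite expr2; lra.
(* The limit zero is presented as the energy of the zero function, so that [cvg_energy] gives the
   pointwise convergence. *)
have [_ _] := @dominated_convergence_Rintegral _ _ R leb B [set (0 : 'rV[R]_n)]
  (fun k => energy (u_ k \- u) (grad (u_ k) \- G)) (energy (cst 0) (cst 0))
  (fun x => (n%:R * 4 + 16) * D x) mB N0
  (fun k => measurable_energy (mX k) (measurable_funB (muk k) mu))
  (@measurable_energy (cst 0) (cst 0) (fun i => measurable_cst _) (measurable_cst _))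
  (integrableD_scaled _)
  (fun x Bx x0 => @cvg_energy x _ _ _ _ (fun i => cvg_X x i Bx x0) (cvg_0 x Bx x0)) bound.
rewrite [X in _ --> X](_ : _ = 0%E)//.
rewrite -[RHS](integral0 leb B); apply: eq_integral => x _.
by rewrite dotrvE trmx0 mulmx0 mxE expr0n mulr0 addr0.
Qed.

Let flux_weak phi : C1c_ball phi ->
  leb.-integrable B (EFin \o (fun x => dotrv (F x) (grad phi x))) /\
  (\int[leb]_(x in B) (dotrv (F x) (grad phi x))%:E = 0)%E.
Proof.
move=> C1cphi.
have [phi0 [C1phi0 phi01 phiN phiB]] := C1c_extension C1cphi.
have [c c0 phic] := C1c_bounds C1cphi; have [C1phi _] := C1cphi.
have [_ iF cvgF] := @dominated_convergence_Rintegral _ _ R leb B [set (0 : 'rV[R]_n)]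
  (fun k x => dotrv (F_ k x) (grad phi x)) (fun x => dotrv (F x) (grad phi x))
  (fun x => (n%:R * c) * D x) mB N0
  ltac:(by move=> k; apply: measurable_sum => i; apply: measurable_funM => //; exact:
    measurable_grad)
  ltac:(by apply: measurable_sum => i; apply: measurable_funM => //; exact: measurable_grad)
  (integrableD_scaled _)
  ltac:(by move=> x Bx x0; apply: cvg_sumR => i; apply: cvgM; [exact: cvg_F|exact: cvg_cst])
  ltac:(by move=> k x Bx x0; apply: le_trans (ler_norm_sum _ _ _) _;
    rewrite -mulrA mulr_natl -[n in X in _ <= X]card_ord -sumr_const; apply: ler_sum => i _;
    rewrite normrM mulrC; have [_ gc] := phic x Bx; apply: ler_pM => //; exact: F_D).
split=> //.
rewrite -(cvg_lim _ cvgF)//; apply: lim_near_cst => //; apply: nearW => k.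
rewrite (@integral_ball_eq _ _ _ (fun x => \sum_i F_ k x ord0 i * 'D_('e_i) phi0 x)) ?divF_//.
- by move=> x /phiB[_ gE]; apply: eq_bigr => i _; rewrite gE.
- by move=> x /phiN[_ gE]; rewrite big1// => i _; rewrite gE mulr0.
Qed.

(** The equation is known for test functions of class C^1 by [flux_weak]. For general [phi], with
    approximants [phi_ k], the error is the pairing of [A G] with [grad (phi_ k) - Phi], and Young's
    inequality bounds it by two energies, one of which tends to 0. *)
Lemma weak_solution_of_limit : weak_solution A Lam u.
Proof.
exists G; first exact: H1_uG.
move=> phi Phi [[[mphi _] L2Phi _] [phi_ [phi_D cvg_phi]]].
have mPhi i : measurable_fun B (fun x => Phi x ord0 i) by have [] := L2Phi i.
have A0 x xi : B x -> 0 <= dotrv (mulmrv (A x) xi) xi.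
  by move=> Bx; have /andP[h _] := Aell Bx xi; apply: le_trans h; exact: dotrv_ge0.
have mgk k i : measurable_fun B (fun x => grad (phi_ k) x ord0 i).
  by have [[C1phi _] _] := phi_D k; exact: measurable_grad.
pose X k x := grad (phi_ k) x - Phi x.
have mX k i : measurable_fun B (fun x => X k x ord0 i).
  by under eq_fun do rewrite !mxE; apply: measurable_funB => //;
     have := mgk k i; under eq_fun do rewrite mxE.
pose E0 x := dotrv (mulmrv (A x) (G x)) (G x).
have mE0 : measurable_fun B E0 by exact: measurable_bilinear.
have E00 x : B x -> 0 <= E0 x by exact: A0.
have iE0 : leb.-integrable B (EFin \o E0).
  apply: (@integrable_le _ (n%:R * 1 + 0)) => // x Bx.
  have := @energy_le x (G x) 0 1 0 Bx; rewrite expr0n mulr0 addr0; apply => //.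
  by move=> i; rewrite mul1r; exact: GD.
pose a k := fun x => dotrv (mulmrv (A x) (X k x)) (X k x).
have ma k : measurable_fun B (a k) by exact: measurable_bilinear.
have a0 k x : B x -> 0 <= a k x by exact: A0.
have a_le k : (\int[leb]_(x in B) (a k x)%:E <=
    H1_normsq A Lam (phi_ k \- phi)%R (grad (phi_ k) \- Phi)%R)%E.
  have mphik : measurable_fun B (phi_ k).
    by have [[C1phi _] _] := phi_D k; exact: measurable_C1_ball.
  apply: ge0_le_integral => //.
  - by move=> x Bx; rewrite lee_fin a0.
  - exact/measurable_EFinP.
  - by apply/measurable_EFinP; apply: measurable_funD; [exact: ma|
      apply: measurable_funM => //; apply: measurable_funX; exact: measurable_funB].
  - move=> x Bx; rewrite lee_fin lerDl mulr_ge0 ?sqr_ge0//.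
    exact: le_trans (Lam1 Bx).
pose w x := dotrv (mulmrv (A x) (G x)) (Phi x).
pose z k x := dotrv (mulmrv (A x) (G x)) (X k x).
have mz k : measurable_fun B (z k) by exact: measurable_bilinear.
have young k (c : R) x : 0 < c -> B x ->
    `|z k x| <= c / 2 * E0 x + (2 * c)^-1 * a k x.
  by move=> c0 Bx; apply: mulmrv_young => //; [exact: Asym|move=> xi; exact: A0].
have w_le (c : R) (k : nat) : 0 < c -> (\int[leb]_(x in B) (a k x)%:E < +oo)%E ->
    leb.-integrable B (EFin \o w) /\
    `|(\int[leb]_(x in B) w x)%R| <= c / 2 * (\int[leb]_(x in B) E0 x)%R +
       (2 * c)^-1 * (\int[leb]_(x in B) a k x)%R.
  move=> c0 aoo.
  have ia : leb.-integrable B (EFin \o a k).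
    apply/integrableP; split; first exact/measurable_EFinP.
    rewrite (eq_integral (fun x => (a k x)%:E))// => x; rewrite inE => Bx.
    by rewrite /= ger0_norm// a0.
  have ir : leb.-integrable B (EFin \o (fun x => c / 2 * E0 x + (2 * c)^-1 * a k x)).
    by apply: integrableDR => //; exact: integrableZR.
  have iz : leb.-integrable B (EFin \o z k).
    apply: le_integrable ir => //; first exact/measurable_EFinP.
    by move=> x Bx; rewrite /= lee_fin (le_trans (young k c x c0 Bx))// ler_norm.
  have [[C1cphi _] _] := phi_D k.
  have [iFk F0] := flux_weak (phi_D k).1.
  (* Since [A G = F], the pairing with [Phi] differs from a term of zero integral by the error
     [z k]. *)
  have wE x : B x -> w x = dotrv (F x) (grad (phi_ k) x) - z k x.
    by move=> Bx; rewrite /w /z /X dotrvBr AG// opprB addrCA subrr addr0.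
  have iw : leb.-integrable B (EFin \o w).
    apply: (eq_integrable mB (EFin \o (fun x => dotrv (F x) (grad (phi_ k) x) - z k x))).
      by move=> x; rewrite inE => Bx; rewrite /= wE.
    exact: integrableBR.
  split=> //.
  have -> : (\int[leb]_(x in B) w x)%R = - (\int[leb]_(x in B) z k x)%R.
    rewrite (@eq_Rintegral _ _ _ _ _ (fun x => dotrv (F x) (grad (phi_ k) x) - z k x)).
      by rewrite RintegralB// {1}/Rintegral F0/= sub0r.
    by move=> x; rewrite inE => /wE.
  rewrite normrN.
  apply: le_trans (le_normr_Rintegral mB iz) _.
  apply: le_trans (le_Rintegral mB (integrable_norm iz) ir _) _ => [x Bx|].
    exact: young.
  rewrite RintegralD//; [|exact: integrableZR|exact: integrableZR].
  by rewrite !RintegralZl.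
have cvg_a : (\int[leb]_(x in B) (a k x)%:E)%E @[k --> \oo] --> 0%E.
  apply: (@squeeze_cvge _ _ _ _ (cst 0%E) _
    (fun k => H1_normsq A Lam (phi_ k \- phi) (grad (phi_ k) \- Phi))) => //.
    apply: nearW => k; rewrite a_le andbT; apply: integral_ge0 => x Bx.
    by rewrite lee_fin a0.
  exact: cvg_cst.
have [aoo cvg_aR] := (fine_cvgP _ _).1 cvg_a.
have ltey_fin (y : \bar R) : y \is a fin_num -> (y < +oo)%E.
  by rewrite fin_numElt => /andP[].
have I0 : 0 <= (\int[leb]_(x in B) E0 x)%R by exact: Rintegral_ge0.
have iw : leb.-integrable B (EFin \o w).
  have [K _ /(_ K (leqnn K)) aK] := aoo.
  by have [] := w_le 1 K ltr01 (ltey_fin _ aK).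
rewrite -/(w _) -(fineK (integrable_fin_num mB iw)) -/(Rintegral _ _ _).
congr (_%:E); apply/eqP; rewrite -normr_eq0 eq_le normr_ge0 andbT.
set W := Rintegral _ _ _; set I := Rintegral _ _ E0 in I0 w_le.
rewrite leNgt; apply/negP => W0.
(* This [c] makes [c / 2 * I] smaller than [|W| / 2]; a large [k] then does the same for the other
   term. The [+ 1] covers [I = 0]. *)
pose c := `|W| / (I + 1).
have I1 : 0 < I + 1 by rewrite ltr_wpDl.
have c0 : 0 < c by rewrite divr_gt0.
have e0 : 0 < c * `|W| by rewrite mulr_gt0.
have aoo' : \forall k \near \oo, (fine (\int[leb]_(x in B) (a k x)%:E)%E < c * `|W|).
  by move/cvgrPdist_lt : cvg_aR => /(_ _ e0); apply: filterS => k; rewrite sub0r normrN; apply: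
    le_lt_trans; exact: ler_norm.
have [K _ /(_ K (leqnn K))[aK1 aK2]] := filterI aoo aoo'.
have [_] := w_le c K c0 (ltey_fin _ aK1).
rewrite -/W; apply/negP; rewrite -ltNge.
have h1 : c * I < `|W|.
  by rewrite /c mulrAC ltr_pdivrMr// ltr_pM2l// ltrDl.
have h2 : (2 * c)^-1 * (\int[leb]_(x in B) a K x)%R < `|W| / 2.
  have c2 : 0 < 2 * c by rewrite mulr_gt0.
  rewrite (ltr_pdivrMl _ _ c2).
  have -> : 2 * c * (`|W| / 2) = c * `|W| by field.
  exact: aK2.
lra.
Qed.

End weak_solution_limit.

(** * The profile and its stream function *)

Section derivative_rules.
Context {R : realType}.
Implicit Types (f g : R -> R) (x c df dg : R).

Lemma is_derive_cstR c x : is_derive x (1 : R) (fun=> c) (0 : R).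
Proof. exact: is_derive_cst. Qed.

Lemma is_derive_idR x : is_derive x (1 : R) (fun t => t) (1 : R).
Proof. exact: is_derive_id. Qed.

Lemma is_deriveDR f g x df dg : is_derive x (1 : R) f df -> is_derive x (1 : R) g dg ->
  is_derive x (1 : R) (fun t => f t + g t) (df + dg).
Proof. by move=> hf hg; exact: is_deriveD. Qed.

Lemma is_deriveMR f g x df dg : is_derive x (1 : R) f df -> is_derive x (1 : R) g dg ->
  is_derive x (1 : R) (fun t => f t * g t) (f x * dg + g x * df).
Proof. by move=> hf hg; exact: is_deriveM. Qed.

Lemma is_deriveVR f x df : f x != 0 -> is_derive x (1 : R) f df ->
  is_derive x (1 : R) (fun t => (f t)^-1) (- (f x) ^- 2 * df).
Proof. by move=> f0 hf; exact: is_deriveV. Qed.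

Lemma is_derive_compR f g x df dg : is_derive (g x) (1 : R) f df ->
  is_derive x (1 : R) g dg -> is_derive x (1 : R) (fun t => f (g t)) (df * dg).
Proof. by move=> hf hg; exact: is_derive1_comp. Qed.

Lemma is_derive_eqR f x df df' : is_derive x (1 : R) f df -> df = df' ->
  is_derive x (1 : R) f df'.
Proof. by move=> h <-. Qed.

End derivative_rules.

Section radial_profiles.
Context {R : realType}.
Variable K : R.
Hypothesis K1 : 1 <= K.
Implicit Types a y : R.

(* [a] stands for [|x|^2 + e]; for [e = 0], [logr a] is [log (1/|x|)] up to a
   bounded term. *)
Definition logr a : R := K + ln (1 + a^-1) / 2.
Definition vlog a : R := (logr a)^-1.
Definition loglogr a : R := 2 * ln (logr a).
Definition rsqrt a : R := (Num.sqrt a)^-1.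
Definition tanhR y : R := 1 - 2 / (1 + expR (2 * y)).
(** [logr] is not exactly a logarithm: its derivative in [ln (sqrt a)] is [- tht a] instead of [-1].
    This factor lies in [[1/2, 1]] for [0 <= a <= 1]. *)
Definition tht a : R := (1 + a)^-1.

Lemma one_addV_gt1 a : 0 < a -> 1 < 1 + a^-1.
Proof. by move=> a0; rewrite ltrDl invr_gt0. Qed.

Lemma logr_ge a : 0 <= a -> K <= logr a.
Proof.
by move=> a0; rewrite lerDl divr_ge0// ln_ge0// lerDl invr_ge0.
Qed.

Lemma logr_ge1 a : 0 <= a -> 1 <= logr a.
Proof. by move=> /logr_ge; exact: le_trans. Qed.

Lemma logr_gt0 a : 0 <= a -> 0 < logr a.
Proof. by move=> /logr_ge1; exact: lt_le_trans. Qed.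

Lemma is_derive_logr a : 0 < a -> is_derive a (1 : R) logr (- (tht a / (2 * a))).
Proof.
move=> a0; have a1 : a != 0 by rewrite gt_eqF.
have h1 := is_deriveDR (is_derive_cstR 1 a) (is_deriveVR a1 (is_derive_idR a)).
have h2 := is_derive1_ln (lt_trans ltr01 (one_addV_gt1 a0)).
have h3 := is_deriveMR (is_derive_compR (g := fun t => 1 + t^-1) h2 h1) (is_derive_cstR 2^-1 a).
apply: is_derive_eqR (is_deriveDR (is_derive_cstR K a) h3) _.
by rewrite /tht; field; rewrite a1 !gt_eqF// ?addr_gt0// ?mulr_gt0 ?addr_gt0.
Qed.

Lemma is_derive_vlog a : 0 < a -> is_derive a (1 : R) vlog (vlog a ^+ 2 * tht a / (2 * a)).
Proof.
move=> a0; have T0 := gt_eqF (logr_gt0 (ltW a0)).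
apply: is_derive_eqR (is_deriveVR (negbT T0) (is_derive_logr a0)) _.
by rewrite /vlog exprVn mulrNN mulrA.
Qed.

Lemma is_derive_loglogr a : 0 < a -> is_derive a (1 : R) loglogr (- (vlog a * tht a / a)).
Proof.
move=> a0; have T0 := logr_gt0 (ltW a0).
have h := is_derive_compR (g := logr) (is_derive1_ln T0) (is_derive_logr a0).
apply: is_derive_eqR (is_deriveMR (is_derive_cstR 2 a) h) _.
by rewrite /vlog; field; rewrite !gt_eqF.
Qed.

Lemma is_derive_rsqrt a : 0 < a -> is_derive a (1 : R) rsqrt (- (rsqrt a / (2 * a))).
Proof.
move=> a0; have r0 : Num.sqrt a != 0 by rewrite gt_eqF// sqrtr_gt0.
apply: is_derive_eqR (is_deriveVR r0 (is_derive1_sqrt a0)) _.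
rewrite /rsqrt sqr_sqrtr ?(ltW a0)//.
by field; rewrite r0 gt_eqF.
Qed.

Lemma is_derive_tanhR y : is_derive y (1 : R) tanhR (1 - tanhR y ^+ 2).
Proof.
have h1 := is_deriveMR (is_derive_cstR 2 y) (is_derive_idR y).
have h2 := is_derive_compR (g := fun t => 2 * t) (is_derive_expR _) h1.
have h3 := is_deriveDR (is_derive_cstR 1 y) h2.
have E0 : 0 < 1 + expR (2 * y) by rewrite addr_gt0// expR_gt0.
have E1 : 1 + expR (2 * y) != 0 by rewrite gt_eqF.
have h4 := is_deriveMR (is_derive_cstR (- 2) y) (is_deriveVR (f := fun t => 1 + expR (2 * t)) E1
  h3).
have h5 := is_deriveDR (is_derive_cstR 1 y) h4.
rewrite (_ : tanhR = fun t => 1 + (- 2) / (1 + expR (2 * t))); last first.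
  by apply/funext => t; rewrite /tanhR mulNr.
by apply: is_derive_eqR h5 _; field.
Qed.

End radial_profiles.

(** * Rules for computing gradients *)

Section gradients.
Context {R : realType} {n : nat}.
Implicit Types (f g : 'rV[R]_n -> R) (x : 'rV[R]_n) (d : 'I_n -> R).
Local Notation "''e_' i" := (delta_mx ord0 i : 'rV[R]_n) (at level 8, i at level 2).

(** Differentiability is kept next to the partial derivatives because the sum, product and chain
    rules rely on it. *)
Definition has_grad f x d :=
  differentiable f x /\ forall i, 'D_('e_i) f x = d i.

Lemma has_grad_eq f x d d' : has_grad f x d -> d =1 d' -> has_grad f x d'.
Proof. by move=> [df fd] dd; split=> // i; rewrite fd dd. Qed.

Lemma has_grad_cst c x : has_grad (fun=> c) x (fun=> 0).
Proof.
split; first exact: differentiable_cst.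
by move=> i; exact: derive_cst.
Qed.

Lemma has_grad_coord j x : has_grad (fun y => y ord0 j) x (fun i => (i == j)%:R).
Proof.
have dc : differentiable (fun y : 'rV[R]_n => y ord0 j) x by exact: differentiable_coord.
split=> // i; apply/cvg_lim => //.
apply: (@cvg_trans _ (cst ((i == j)%:R : R) h @[h --> (0 : R)^'])); last exact: cvg_cst.
apply: near_eq_cvg; near=> h.
rewrite /= !mxE eqxx/= addrK eq_sym [_ *: _]mulrA mulVf ?mul1r//.
by near: h; exact: nbhs_dnbhs_neq.
Unshelve. all: by end_near. Qed.

Lemma has_gradD f g x d e : has_grad f x d -> has_grad g x e ->
  has_grad (fun y => f y + g y) x (fun i => d i + e i).
Proof.
move=> [df fd] [dg ge]; split; first exact: differentiableD.
by move=> i; rewrite deriveD ?fd ?ge//; exact: diff_derivable.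
Qed.

Lemma has_gradM f g x d e : has_grad f x d -> has_grad g x e ->
  has_grad (fun y => f y * g y) x (fun i => f x * e i + g x * d i).
Proof.
move=> [df fd] [dg ge]; split; first exact: differentiableM.
by move=> i; rewrite deriveM ?fd ?ge//; exact: diff_derivable.
Qed.

Lemma has_grad_comp (h : R -> R) h' f x d : is_derive (f x) (1 : R) h h' ->
  has_grad f x d -> has_grad (fun y => h (f y)) x (fun i => h' * d i).
Proof.
move=> [hh hh'] [df fd].
have dh : differentiable h (f x) by apply/derivable1_diffP.
have dhf : differentiable (h \o f) x by exact: differentiable_comp.
split=> // i; rewrite (_ : (fun y => h (f y)) = h \o f)// deriveE// diff_comp//=.
rewrite deriv1E// -deriveE// fd derive1E hh'.
by rewrite /GRing.scale/= mulrC.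
Qed.

Lemma has_grad_sum (s : seq 'I_n) (F : 'I_n -> 'rV[R]_n -> R) x (e : 'I_n -> 'I_n -> R) :
  (forall j, has_grad (F j) x (e j)) ->
  has_grad (fun y => \sum_(j <- s) F j y) x (fun i => \sum_(j <- s) e j i).
Proof.
move=> H; elim: s => [|j s IH].
  have [d c] := has_grad_cst 0 x; split.
    by under eq_fun do rewrite big_nil.
  by move=> i; rewrite big_nil; under eq_fun do rewrite big_nil; exact: c.
have [d c] := has_gradD (H j) IH; split.
  by under eq_fun do rewrite big_cons.
by move=> i; rewrite big_cons; under eq_fun do rewrite big_cons; exact: c.
Qed.

Lemma has_grad_dotrv x : has_grad (fun y => dotrv y y) x (fun i => 2 * x ord0 i).
Proof.
apply: has_grad_eq (has_grad_sum _ (fun j => has_gradM (has_grad_coord j x) (has_grad_coord j x)))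
  _.
move=> i; rewrite (bigD1 i)//= eqxx mulr1 big1 ?addr0 => [|j ji]; first by rewrite mulr2n mulrDl
  mul1r.
by rewrite eq_sym (negbTE ji) mulr0 addr0.
Qed.

Lemma C1_of_has_grad f (d : 'rV[R]_n -> 'I_n -> R) :
  (forall x, has_grad f x (d x)) -> (forall i, continuous (fun x => d x i)) ->
  C1 f /\ C1_ball f.
Proof.
move=> fd cd.
have pE i : (fun x => 'D_('e_i) f x) = (fun x => d x i).
  by apply/funext => x; have [_] := fd x.
split; first split.
- by move=> x; have [df _] := fd x; exact: differentiable_continuous.
- by move=> x i; have [df _] := fd x; exact: diff_derivable.
- by move=> i; rewrite pE.
- move=> x _; have [df _] := fd x; split=> //.
  have FFx : Filter (nbhs x) := nbhs_filter x.
  apply/cvgrPdist_lt => e e0.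
  have H : \forall y \near x, forall j, `|'D_('e_j) f x - 'D_('e_j) f y| < e.
    apply: (@filter_forall _ _ (fun j y => `|'D_('e_j) f x - 'D_('e_j) f y| < e) (nbhs x)) => j.
    by have := cd j x; rewrite -pE => /cvgrPdist_lt/(_ e e0).
  apply: filterS H => y Hy.
  rewrite [X in X < _]/Num.Def.normr/= mx_normrE (bigmax_lt _ e0)//= => -[i j] _.
  by rewrite !mxE/=.
Qed.

End gradients.

Section profile_functions.
Context {R : realType}.
Variable K : R.
Hypothesis K1 : 1 <= K.
Implicit Types a z : R.

Local Notation v := (vlog K).
Local Notation L := (loglogr K).

(* With [a = |x|^2 + e] and [z = x_1]: the suffix [_r] marks the derivative with
   respect to [ln (sqrt a)] at fixed cosine [z / sqrt a] (divided by [- tht a] for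
   [stream_r]), the suffix [_c] the one with respect to the cosine. *)
Definition cosr a z : R := z * rsqrt a.
Definition taur a z : R := tanhR (L a * cosr a z).
Definition sech2r a z : R := 1 - taur a z ^+ 2.
Definition profile a z : R := (1 + v a) * taur a z.
Definition profile_r a z : R :=
  tht a * (v a ^+ 2 * taur a z - 2 * (1 + v a) * cosr a z * sech2r a z * v a).
Definition profile_c a z : R := (1 + v a) * L a * sech2r a z.
Definition stream a z : R := 64 * (L a * sech2r a z + v a ^+ 2).
Definition stream_r a z : R := 64 * (2 * v a * sech2r a z
  - 4 * L a * taur a z * sech2r a z * cosr a z * v a - 2 * v a ^+ 3).
Definition stream_c a z : R := - (128 * L a ^+ 2 * taur a z * sech2r a z).
Definition potential a z : R := stream a z * rsqrt a.
(** The gradient of [potential] is a multiple of [x] plus a multiple of the basis vector. Up to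
    [rsqrt a ^+ 3] this is the former coefficient: its terms come from the radial derivative of
    [stream], from the change of the cosine along [x], and from the derivative of [rsqrt]. *)
Definition stream_x a z : R := - (tht a * stream_r a z) - cosr a z * stream_c a z - stream a z.

(** * Limits along any filter: continuity in [x] at fixed [e], and [e -> 0] at fixed [x] *)

Section continuity.
Context (S : Type) (F : set_system S) (FF : Filter F).
Variables (at_ zt : S -> R) (a z : R).
Hypotheses (cvga : at_ t @[t --> F] --> a) (cvgz : zt t @[t --> F] --> z) (a0 : 0 < a).

Let cvg_of_derive (f : R -> R) (g : S -> R) (b d : R) : is_derive b (1 : R) f d ->
  g t @[t --> F] --> b -> f (g t) @[t --> F] --> f b.
Proof.
move=> [df _] gb; apply: (@continuous_cvg _ _ _ F FF g f b) => //.
by apply: differentiable_continuous; apply/derivable1_diffP.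
Qed.

Let cvgX (g : S -> R) (b : R) k : g t @[t --> F] --> b -> g t ^+ k @[t --> F] --> b ^+ k.
Proof.
move=> gb; elim: k => [|k IH].
  by rewrite expr0; under eq_fun do rewrite expr0; exact: cvg_cst.
by rewrite exprS; under eq_fun do rewrite exprS; exact: cvgM.
Qed.

Lemma cvg_vlog : v (at_ t) @[t --> F] --> v a.
Proof. exact: cvg_of_derive (is_derive_vlog K1 a0) cvga. Qed.

Lemma cvg_loglogr : L (at_ t) @[t --> F] --> L a.
Proof. exact: cvg_of_derive (is_derive_loglogr K1 a0) cvga. Qed.

Lemma cvg_rsqrt : rsqrt (at_ t) @[t --> F] --> rsqrt a.
Proof. exact: cvg_of_derive (is_derive_rsqrt a0) cvga. Qed.

Lemma cvg_tht : tht (at_ t) @[t --> F] --> tht a.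
Proof.
apply: cvgV; first by rewrite gt_eqF// addr_gt0.
by apply: cvgD => //; exact: cvg_cst.
Qed.

Lemma cvg_cosr : cosr (at_ t) (zt t) @[t --> F] --> cosr a z.
Proof. by apply: cvgM => //; exact: cvg_rsqrt. Qed.

Lemma cvg_taur : taur (at_ t) (zt t) @[t --> F] --> taur a z.
Proof.
apply: cvg_of_derive (is_derive_tanhR _) _.
by apply: cvgM; [exact: cvg_loglogr|exact: cvg_cosr].
Qed.

Lemma cvg_sech2r : sech2r (at_ t) (zt t) @[t --> F] --> sech2r a z.
Proof. by apply: cvgB; [exact: cvg_cst|apply: cvgX; exact: cvg_taur]. Qed.

Lemma cvg_profile : profile (at_ t) (zt t) @[t --> F] --> profile a z.
Proof. exact: (cvgM (cvgD (cvg_cst _) cvg_vlog) cvg_taur). Qed.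

Lemma cvg_profile_r : profile_r (at_ t) (zt t) @[t --> F] --> profile_r a z.
Proof.
exact: (cvgM cvg_tht (cvgB (cvgM (@cvgX _ _ 2 cvg_vlog) cvg_taur) (cvgM (cvgM (cvgM (cvgM
  (cvg_cst _) (cvgD (cvg_cst _) cvg_vlog)) cvg_cosr) cvg_sech2r) cvg_vlog))).
Qed.

Lemma cvg_profile_c : profile_c (at_ t) (zt t) @[t --> F] --> profile_c a z.
Proof. exact: (cvgM (cvgM (cvgD (cvg_cst _) cvg_vlog) cvg_loglogr) cvg_sech2r). Qed.

Lemma cvg_stream : stream (at_ t) (zt t) @[t --> F] --> stream a z.
Proof. exact: (cvgM (cvg_cst _) (cvgD (cvgM cvg_loglogr cvg_sech2r) (@cvgX _ _ 2 cvg_vlog))). Qed.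

Lemma cvg_stream_r : stream_r (at_ t) (zt t) @[t --> F] --> stream_r a z.
Proof.
exact: (cvgM (cvg_cst _) (cvgB (cvgB (cvgM (cvgM (cvg_cst _) cvg_vlog) cvg_sech2r) (cvgM (cvgM
  (cvgM (cvgM (cvgM (cvg_cst _) cvg_loglogr) cvg_taur) cvg_sech2r) cvg_cosr) cvg_vlog)) (cvgM
  (cvg_cst _) (@cvgX _ _ 3 cvg_vlog)))).
Qed.

Lemma cvg_stream_c : stream_c (at_ t) (zt t) @[t --> F] --> stream_c a z.
Proof.
exact: (cvgN (cvgM (cvgM (cvgM (cvg_cst _) (@cvgX _ _ 2 cvg_loglogr)) cvg_taur) cvg_sech2r)).
Qed.

Lemma cvg_stream_x : stream_x (at_ t) (zt t) @[t --> F] --> stream_x a z.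
Proof.
apply: cvgB; last exact: cvg_stream.
apply: cvgB; last by apply: cvgM; [exact: cvg_cosr|exact: cvg_stream_c].
by apply: cvgN; apply: cvgM; [exact: cvg_tht|exact: cvg_stream_r].
Qed.

End continuity.

End profile_functions.

(** * Measurability of the profiles on the whole space, the origin included *)

Section measurable_profiles.
Context {d : measure_display} {X : measurableType d} {R : realType}.
Variable K : R.
Implicit Types f g : X -> R.

Lemma measurable_funV f : measurable_fun setT f -> measurable_fun setT (fun x => (f x)^-1).
Proof.
(* Squaring makes the base nonnegative, where the real power [-1] is the inverse; the factor [f x]
   gives the value 0 at the zeros of [f], in accordance with [0^-1 = 0]. *)
move=> mf; rewrite (_ : (fun x => _) = (fun x => f x * (f x ^+ 2) `^ (- 1))).
  exact: (measurable_funM mf (measurableT_comp (measurable_powR (- 1)) (measurable_funX 2 mf))).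
apply/funext => x; rewrite powR_inv1 ?sqr_ge0//.
have [->|f0] := eqVneq (f x) 0; first by rewrite invr0 mul0r.
by rewrite expr2; field.
Qed.

Variables at_ zt : X -> R.
Hypotheses (ma : measurable_fun setT at_) (mz : measurable_fun setT zt).

Lemma measurable_logr : measurable_fun setT (fun x => logr K (at_ x)).
Proof.
apply: measurable_funD => //; apply: measurable_funM => //.
apply: (measurableT_comp (@measurable_ln R)); apply: measurable_funD => //.
exact: measurable_funV.
Qed.

Lemma measurable_vlog : measurable_fun setT (fun x => vlog K (at_ x)).
Proof. by apply: measurable_funV; exact: measurable_logr. Qed.

Lemma measurable_loglogr : measurable_fun setT (fun x => loglogr K (at_ x)).
Proof.
apply: measurable_funM => //.
by apply: (measurableT_comp (@measurable_ln R)); exact: measurable_logr.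
Qed.

Lemma measurable_rsqrt : measurable_fun setT (fun x => rsqrt (at_ x)).
Proof.
apply: measurable_funV; apply: measurableT_comp ma.
by apply: continuous_measurable_fun; exact: sqrt_continuous.
Qed.

Lemma measurable_tht : measurable_fun setT (fun x => tht (at_ x)).
Proof. by apply: measurable_funV; exact: measurable_funD. Qed.

Lemma measurable_cosr : measurable_fun setT (fun x => cosr (at_ x) (zt x)).
Proof. by apply: measurable_funM => //; exact: measurable_rsqrt. Qed.

Lemma measurable_taur : measurable_fun setT (fun x => taur K (at_ x) (zt x)).
Proof.
apply: measurable_funB => //; apply: measurable_funM => //.
apply: measurable_funV; apply: measurable_funD => //.
apply: (measurableT_comp (@measurable_expR R)); apply: measurable_funM => //.
by apply: measurable_funM; [exact: measurable_loglogr|exact: measurable_cosr].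
Qed.

Lemma measurable_sech2r : measurable_fun setT (fun x => sech2r K (at_ x) (zt x)).
Proof. by apply: measurable_funB => //; apply: measurable_funX; exact: measurable_taur. Qed.

Let mc (c : R) : measurable_fun setT (fun _ : X => c). Proof. exact: measurable_cst. Qed.

Let mN f : measurable_fun setT f -> measurable_fun setT (fun x => - f x).
Proof.
move=> mf; rewrite (_ : (fun x => _) = (fun x => (-1) * f x)).
  exact: measurable_funM.
by apply/funext => x; rewrite mulN1r.
Qed.

Lemma measurable_profile : measurable_fun setT (fun x => profile K (at_ x) (zt x)).
Proof. exact: (measurable_funM (measurable_funD (mc _) measurable_vlog) measurable_taur). Qed.

Lemma measurable_profile_r : measurable_fun setT (fun x => profile_r K (at_ x) (zt x)).
Proof.
exact: (measurable_funM measurable_tht (measurable_funB (measurable_funM (measurable_funX 2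
  measurable_vlog) measurable_taur) (measurable_funM (measurable_funM (measurable_funM
  (measurable_funM (mc _) (measurable_funD (mc _) measurable_vlog)) measurable_cosr)
  measurable_sech2r) measurable_vlog))).
Qed.

Lemma measurable_profile_c : measurable_fun setT (fun x => profile_c K (at_ x) (zt x)).
Proof.
exact: (measurable_funM (measurable_funM (measurable_funD (mc _) measurable_vlog)
  measurable_loglogr) measurable_sech2r).
Qed.

Lemma measurable_stream : measurable_fun setT (fun x => stream K (at_ x) (zt x)).
Proof.
exact: (measurable_funM (mc _) (measurable_funD (measurable_funM measurable_loglogr
  measurable_sech2r) (measurable_funX 2 measurable_vlog))).
Qed.

Lemma measurable_stream_r : measurable_fun setT (fun x => stream_r K (at_ x) (zt x)).
Proof.
exact: (measurable_funM (mc _) (measurable_funB (measurable_funB (measurable_funM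
  (measurable_funM (mc _) measurable_vlog) measurable_sech2r) (measurable_funM (measurable_funM
  (measurable_funM (measurable_funM (measurable_funM (mc _) measurable_loglogr)
  measurable_taur) measurable_sech2r) measurable_cosr) measurable_vlog)) (measurable_funM (mc
  _) (measurable_funX 3 measurable_vlog)))).
Qed.

Lemma measurable_stream_c : measurable_fun setT (fun x => stream_c K (at_ x) (zt x)).
Proof.
have h := (measurable_funM (measurable_funM (measurable_funM (mc 128) (measurable_funX 2
  measurable_loglogr)) measurable_taur) measurable_sech2r).
exact: (mN h).
Qed.

Lemma measurable_stream_x : measurable_fun setT (fun x => stream_x K (at_ x) (zt x)).
Proof.
apply: measurable_funB; last exact: measurable_stream.
apply: measurable_funB; last first.
  by apply: measurable_funM; [exact: measurable_cosr|exact: measurable_stream_c].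
exact: (mN (measurable_funM measurable_tht measurable_stream_r)).
Qed.

End measurable_profiles.

(** * The regularised solution, its stream potential and their gradients *)

Section gradient_formulas.
Context {R : realType} {n : nat}.
Variables (K : R) (i0 : 'I_n).
Hypothesis K1 : 1 <= K.
Implicit Types (x : 'rV[R]_n) (e : R).

Definition sqnorm e x : R := dotrv x x + e.

Definition sol e x : R := profile K (sqnorm e x) (x ord0 i0).
(** With [rho = sqrt (|x|^2 + e)] and [c = x_1 / rho], the gradient of [ln rho] is [x / rho^2] and
    that of [c] is [e_1 / rho - c x / rho^2]; the second term of the latter produces the
    subtraction. *)
Definition grad_u e x (i : 'I_n) : R :=
  (profile_r K (sqnorm e x) (x ord0 i0) -
    cosr (sqnorm e x) (x ord0 i0) * profile_c K (sqnorm e x) (x ord0 i0)) *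
    rsqrt (sqnorm e x) ^+ 2 * x ord0 i +
  profile_c K (sqnorm e x) (x ord0 i0) * rsqrt (sqnorm e x) * (i == i0)%:R.

Definition pot e x : R := potential K (sqnorm e x) (x ord0 i0).
Definition grad_m e x (i : 'I_n) : R :=
  stream_x K (sqnorm e x) (x ord0 i0) * rsqrt (sqnorm e x) ^+ 3 * x ord0 i +
  stream_c K (sqnorm e x) (x ord0 i0) * rsqrt (sqnorm e x) ^+ 2 * (i == i0)%:R.

(* The field [sum_j D_j (x_j m) delta_{i i0} - D_{i0} (x_i m)], free of divergence
   for every [m]. *)
Definition flux e x (i : 'I_n) : R :=
  ((n%:R - 1) * pot e x + \sum_j x ord0 j * grad_m e x j) * (i == i0)%:R -
  grad_m e x i0 * x ord0 i.

Lemma sqnorm_gt0 e x : 0 < e -> 0 < sqnorm e x.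
Proof. by move=> e0; rewrite ltr_wpDl// dotrv_ge0. Qed.

Lemma sqr_rsqrt (a : R) : 0 < a -> rsqrt a ^+ 2 = a^-1.
Proof. by move=> a0; rewrite exprVn sqr_sqrtr// ltW. Qed.

Lemma has_grad_sqnorm e x : has_grad (sqnorm e) x (fun i => 2 * x ord0 i).
Proof.
apply: has_grad_eq (has_gradD (has_grad_dotrv x) (has_grad_cst e x)) _.
by move=> i; rewrite addr0.
Qed.

Section at_point.
Variables (e : R) (x : 'rV[R]_n).
Hypothesis a0 : 0 < sqnorm e x.
Let a := sqnorm e x.
Let z := x ord0 i0.

Let hz := has_grad_coord i0 x.
Let ha := has_grad_sqnorm e x.
Let hv := has_grad_comp (is_derive_vlog K1 a0) ha.
Let hL := has_grad_comp (is_derive_loglogr K1 a0) ha.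
Let hr := has_grad_comp (is_derive_rsqrt a0) ha.
Let hc := has_gradM hz hr.
Let ht := has_grad_comp (is_derive_tanhR (loglogr K a * (z * rsqrt a))) (has_gradM hL hc).

Lemma has_grad_sol : has_grad (sol e) x (grad_u e x).
Proof.
apply: has_grad_eq (has_gradM (has_gradD (has_grad_cst 1 x) hv) ht) _ => i.
rewrite /grad_u /profile_r /profile_c /sech2r -/a -/z -/(cosr a z) -/(taur K a z).
rewrite sqr_rsqrt//.
have ->: cosr a z = z * rsqrt a by [].
by field; rewrite gt_eqF.
Qed.

Lemma has_grad_pot : has_grad (pot e) x (grad_m e x).
Proof.
have h1 := has_gradM (has_grad_cst (-1) x) (has_gradM ht ht).
have hw := has_gradD (has_grad_cst 1 x) h1.
have hM := has_gradM (has_grad_cst 64 x) (has_gradD (has_gradM hL hw) (has_gradM hv hv)).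
have hm := has_gradM hM hr.
have -> : pot e = (fun y => 64 * (loglogr K (sqnorm e y) *
   (1 + -1 * (tanhR (loglogr K (sqnorm e y) * (y ord0 i0 * rsqrt (sqnorm e y))) *
    tanhR (loglogr K (sqnorm e y) * (y ord0 i0 * rsqrt (sqnorm e y))))) +
   vlog K (sqnorm e y) * vlog K (sqnorm e y)) * rsqrt (sqnorm e y)).
  by apply/funext => y; rewrite /pot /potential /stream /sech2r /taur /cosr !expr2 mulN1r.
apply: has_grad_eq hm _ => i.
rewrite /grad_m /stream_x /stream_r /stream_c /stream /sech2r -/a -/z -/(cosr a z) -/(taur K a z).
have -> : rsqrt a ^+ 3 = a^-1 * rsqrt a by rewrite exprSr sqr_rsqrt.
have ->: cosr a z = z * rsqrt a by [].
by field; rewrite gt_eqF.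
Qed.

End at_point.

Lemma continuous_sqnorm e : continuous (sqnorm e).
Proof. by move=> x; have [d _] := has_grad_sqnorm e x; exact: differentiable_continuous. Qed.

Section limits.
Context (S : Type) (F : set_system S) (FF : Filter F).
Variables (et : S -> R) (e : R) (xt : S -> 'rV[R]_n) (x : 'rV[R]_n).
Hypotheses (cvge : sqnorm (et t) (xt t) @[t --> F] --> sqnorm e x)
  (cvgx : forall i, xt t ord0 i @[t --> F] --> x ord0 i) (a0 : 0 < sqnorm e x).

Lemma cvg_sol : sol (et t) (xt t) @[t --> F] --> sol e x.
Proof. exact: (cvg_profile K1 FF cvge (@cvgx i0) a0). Qed.

Let cvg_rsqrtX k : rsqrt (sqnorm (et t) (xt t)) ^+ k @[t --> F] --> rsqrt (sqnorm e x) ^+ k.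
Proof.
elim: k => [|k IH].
  by rewrite expr0; under eq_fun do rewrite expr0; exact: cvg_cst.
rewrite exprS; under eq_fun do rewrite exprS; apply: cvgM => //.
exact: (cvg_rsqrt FF cvge a0).
Qed.

Lemma cvg_grad_u i : grad_u (et t) (xt t) i @[t --> F] --> grad_u e x i.
Proof.
exact: (cvgD (cvgM (cvgM (cvgB (cvg_profile_r K1 FF cvge (@cvgx i0) a0)
  (cvgM (cvg_cosr FF cvge (@cvgx i0) a0) (cvg_profile_c K1 FF cvge (@cvgx i0) a0)))
  (@cvg_rsqrtX 2)) (@cvgx i))
  (cvgM (cvgM (cvg_profile_c K1 FF cvge (@cvgx i0) a0) (@cvg_rsqrtX 1)) (cvg_cst _))).
Qed.

Lemma cvg_grad_m i : grad_m (et t) (xt t) i @[t --> F] --> grad_m e x i.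
Proof.
exact: (cvgD (cvgM (cvgM (cvg_stream_x K1 FF cvge (@cvgx i0) a0)
  (@cvg_rsqrtX 3)) (@cvgx i))
  (cvgM (cvgM (cvg_stream_c K1 FF cvge (@cvgx i0) a0) (@cvg_rsqrtX 2)) (cvg_cst _))).
Qed.

Lemma cvg_flux i : flux (et t) (xt t) i @[t --> F] --> flux e x i.
Proof.
have h : \sum_j xt t ord0 j * grad_m (et t) (xt t) j @[t --> F] -->
    \sum_j x ord0 j * grad_m e x j.
  by apply: cvg_sumR => j; apply: cvgM; [exact: cvgx|exact: cvg_grad_m].
exact: (cvgB (cvgM (cvgD (cvgM (cvg_cst _) (cvgM (cvg_stream K1 FF cvge (@cvgx i0) a0)
  (@cvg_rsqrtX 1))) h) (cvg_cst _))
   (cvgM (@cvg_grad_m i0) (@cvgx i))).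
Qed.

End limits.

Section regularized.
Variable e : R.
Hypothesis e0 : 0 < e.

Lemma C1_sol : C1 (sol e) /\ C1_ball (sol e).
Proof.
apply: (@C1_of_has_grad _ _ _ (fun x => grad_u e x)) => [x|i x].
  by apply: has_grad_sol; exact: sqnorm_gt0.
apply: cvg_grad_u; [exact: nbhs_filter|exact: continuous_sqnorm|
  by move=> j; exact: coord_continuous|exact: sqnorm_gt0].
Qed.

Lemma C1_pot : C1 (pot e).
Proof.
apply: (@C1_of_has_grad _ _ _ (fun x => grad_m e x) _ _).1 => [x|i x].
  by apply: has_grad_pot; exact: sqnorm_gt0.
apply: cvg_grad_m; [exact: nbhs_filter|exact: continuous_sqnorm|
  by move=> j; exact: coord_continuous|exact: sqnorm_gt0].
Qed.

Lemma pd_sol x i : 'D_(delta_mx ord0 i : 'rV[R]_n) (sol e) x = grad_u e x i.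
Proof. by have [_ ->] := has_grad_sol (sqnorm_gt0 x e0). Qed.

Lemma pd_pot x i : 'D_(delta_mx ord0 i : 'rV[R]_n) (pot e) x = grad_m e x i.
Proof. by have [_ ->] := has_grad_pot (sqnorm_gt0 x e0). Qed.

End regularized.

End gradient_formulas.

(** * Pointwise bounds *)

Section hyperbolic_tangent.
Context {R : realType}.
Implicit Types y : R.

Let E1_gt0 y : 0 < 1 + expR (2 * y). Proof. by rewrite addr_gt0// expR_gt0. Qed.

Lemma tanhRN y : tanhR (- y) = - tanhR y.
Proof.
rewrite /tanhR mulrN expRN; have := expR_gt0 (2 * y); set E := expR _ => E0.
by field; rewrite !gt_eqF// addr_gt0.
Qed.

Lemma tanhR_ge0 y : 0 <= y -> 0 <= tanhR y.
Proof.
move=> y0; rewrite /tanhR subr_ge0 ler_pdivrMr// mul1r.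
have : 1 <= expR (2 * y) by rewrite -expR0 ler_expR mulr_ge0.
lra.
Qed.

Lemma normr_tanhR_le1 y : `|tanhR y| <= 1.
Proof.
have e0 := expR_gt0 (2 * y).
have h1 : 0 <= 2 / (1 + expR (2 * y)) by rewrite divr_ge0// ltW.
have h2 : 2 / (1 + expR (2 * y)) <= 2.
  by rewrite ler_pdivrMr// mulrDr mulr1 lerDl mulr_ge0// ltW.
rewrite /tanhR ler_norml; apply/andP; split; lra.
Qed.

Lemma sech2E y : 1 - tanhR y ^+ 2 = 4 * expR (2 * y) / (1 + expR (2 * y)) ^+ 2.
Proof.
rewrite /tanhR; have := E1_gt0 y; set E := expR _ => E0.
by field; rewrite gt_eqF.
Qed.

Lemma sech2_ge y : 0 <= y -> expR (- (2 * y)) <= 1 - tanhR y ^+ 2.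
Proof.
move=> y0; rewrite sech2E expRN.
have h := expR_gt0 (2 * y); have : 1 <= expR (2 * y) by rewrite -expR0 ler_expR mulr_ge0.
set E := expR _ in h * => E1.
rewrite ler_pdivlMr ?exprn_gt0 ?addr_gt0// ler_pdivrMl//.
have : (1 + E) * (1 + E) <= (2 * E) * (2 * E) by apply: ler_pM; lra.
rewrite -expr2; lra.
Qed.

Lemma sech2_le y : 1 - tanhR y ^+ 2 <= 4 * expR (- (2 * y)).
Proof.
rewrite sech2E expRN.
have h := expR_gt0 (2 * y); set E := expR _ in h *.
rewrite ler_pdivrMr ?exprn_gt0 ?addr_gt0// -mulrA ler_pM2l// ler_pdivlMl//.
have : E * E <= (1 + E) * (1 + E) by apply: ler_pM; lra.
by rewrite -expr2.
Qed.

Lemma tanhR_ge12 y : 1 <= y -> 1/2 <= tanhR y.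
Proof.
move=> y1; have h : 3 <= expR (2 * y).
  by apply: le_trans (expR_ge1Dx _); lra.
have : 2 / (1 + expR (2 * y)) <= 1/2 by rewrite ler_pdivrMr//; lra.
rewrite /tanhR; lra.
Qed.

End hyperbolic_tangent.

Section profile_bounds.
Context {R : realType}.
Variable K : R.
Hypothesis Ke : expR 1 <= K.
Implicit Types a z : R.

Let K1 : 1 <= K. Proof. by apply: le_trans Ke; rewrite -expR0 ler_expR. Qed.

Lemma loglogr_ge2 a : 0 <= a -> 2 <= loglogr K a.
Proof.
move=> a0; have T0 := logr_gt0 K1 a0.
have : 1 <= ln (logr K a).
  rewrite -[X in X <= _](expRK (1 : R)) ler_ln ?posrE ?expR_gt0//.
  exact: le_trans Ke (logr_ge K a0).
rewrite /loglogr; lra.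
Qed.

Lemma vlog_gt0 a : 0 <= a -> 0 < vlog K a.
Proof. by move=> a0; rewrite invr_gt0; exact: logr_gt0. Qed.

Lemma vlog_le a : 0 <= a -> vlog K a <= K^-1.
Proof.
move=> a0; rewrite lef_pV2 ?posrE ?logr_gt0//; first exact: logr_ge.
exact: lt_le_trans K1.
Qed.

Lemma vlog_le1 a : 0 <= a -> vlog K a <= 1.
Proof. by move=> a0; apply: le_trans (vlog_le a0) _; rewrite invf_le1// (lt_le_trans _ K1). Qed.

Lemma sqr_vlogE a : 0 <= a -> vlog K a ^+ 2 = expR (- loglogr K a).
Proof.
move=> a0; have T0 := logr_gt0 K1 a0.
rewrite /loglogr expRN /vlog exprVn; congr (_^-1).
by rewrite expRM_natl lnK ?posrE.
Qed.

Lemma logr_le (a b : R) : 0 < a -> a <= b -> logr K b <= logr K a.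
Proof.
move=> a0 ab; have b0 := lt_le_trans a0 ab.
rewrite lerD2l ler_wpM2r ?invr_ge0// ler_ln ?posrE ?(lt_trans ltr01)//; last 2 first.
- exact: one_addV_gt1.
- exact: one_addV_gt1.
by rewrite lerD2l lef_pV2.
Qed.

Lemma loglogr_le (a b : R) : 0 < a -> a <= b -> loglogr K b <= loglogr K a.
Proof.
move=> a0 ab; have b0 := lt_le_trans a0 ab.
by rewrite ler_pM2l// ler_ln ?posrE ?logr_gt0 ?(ltW a0) ?(ltW b0)//; exact: logr_le.
Qed.

Lemma rsqrt_ge0 a : 0 <= rsqrt a.
Proof. by rewrite invr_ge0 sqrtr_ge0. Qed.

Lemma rsqrt_le (a b : R) : 0 < a -> a <= b -> rsqrt b <= rsqrt a.
Proof.
move=> a0 ab; have b0 := lt_le_trans a0 ab.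
by rewrite lef_pV2 ?posrE ?sqrtr_gt0//; exact: ler_wsqrtr.
Qed.

Lemma normr_mul_rsqrt_le1 a z : z ^+ 2 <= a -> `|z| * rsqrt a <= 1.
Proof.
move=> za; have [->|a0] := eqVneq a 0; first by rewrite /rsqrt sqrtr0 invr0 mulr0.
have a1 : 0 < a by rewrite lt_def a0 (le_trans _ za)// sqr_ge0.
by rewrite ler_pdivrMr ?sqrtr_gt0// mul1r -sqrtr_sqr ler_wsqrtr.
Qed.

Lemma tht_gt0 a : 0 <= a -> 0 < tht a.
Proof. by move=> a0; rewrite invr_gt0 ltr_wpDr. Qed.

Lemma tht_le1 a : 0 <= a -> tht a <= 1.
Proof. by move=> a0; rewrite invf_le1 ?ltr_wpDr// lerDl. Qed.

Lemma tht_ge12 a : 0 <= a -> a <= 1 -> 1/2 <= tht a.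
Proof.
by move=> a0 a1; rewrite mul1r lef_pV2 ?posrE ?ltr_wpDr//; lra.
Qed.

Lemma normr_cosr_le1 a z : z ^+ 2 <= a -> `|cosr a z| <= 1.
Proof.
move=> /normr_mul_rsqrt_le1; rewrite /cosr normrM (ger0_norm (rsqrt_ge0 a)).
exact.
Qed.

Lemma sech2r_ge0 a z : 0 <= sech2r K a z.
Proof.
by rewrite subr_ge0 -real_normK ?num_real// expr_le1// normr_tanhR_le1.
Qed.

Lemma sech2r_le1 a z : sech2r K a z <= 1.
Proof. by rewrite gerBl sqr_ge0. Qed.

Section bounds.
Variables a z : R.
Hypotheses (a0 : 0 <= a) (za : z ^+ 2 <= a).
Let L2 := loglogr_ge2 a0.
Let v0 := vlog_gt0 a0.
Let v1 := vlog_le1 a0.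
Let w0 := sech2r_ge0 a z.
Let w1 := sech2r_le1 a z.
Let c1 := normr_cosr_le1 za.
Let t1 : `|taur K a z| <= 1. Proof. exact: normr_tanhR_le1. Qed.
Let Th0 := tht_gt0 a0.
Let Th1 := tht_le1 a0.
Let L0 : 0 <= loglogr K a. Proof. by apply: le_trans L2. Qed.

Let normrM_le (x y b c : R) : `|x| <= b -> `|y| <= c -> `|x * y| <= b * c.
Proof. by move=> xb yc; rewrite normrM ler_pM. Qed.

Let nv : `|vlog K a| <= 1. Proof. by rewrite ger0_norm// ltW. Qed.
Let nv1 : `|1 + vlog K a| <= 2.
Proof. by rewrite ger0_norm ?addr_ge0 ?(ltW v0)//; move: v1; lra. Qed.
Let nw : `|sech2r K a z| <= 1. Proof. by rewrite ger0_norm. Qed.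
Let nL : `|loglogr K a| <= loglogr K a. Proof. by rewrite ger0_norm. Qed.
Let nt : `|tht a| <= 1. Proof. by rewrite ger0_norm// ltW. Qed.
Let nk (k : R) : 0 <= k -> `|k| <= k. Proof. by move=> k0; rewrite ger0_norm. Qed.
Let nX (x : R) k : `|x| <= 1 -> `|x ^+ k| <= 1.
Proof. by move=> x1; rewrite normrX exprn_ile1. Qed.

Lemma profile_le2 : `|profile K a z| <= 2.
Proof. by rewrite -[leRHS]mulr1; exact: normrM_le. Qed.

Lemma profile_r_le5 : `|profile_r K a z| <= 5.
Proof.
rewrite -[leRHS]mul1r; apply: normrM_le => //.
apply: le_trans (ler_normB _ _) _.
have h1 : `|vlog K a ^+ 2 * taur K a z| <= 1 * 1 by apply: normrM_le => //; exact: nX.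
have h2 : `|2 * (1 + vlog K a) * cosr a z * sech2r K a z * vlog K a| <= 2 * 2 * 1 * 1 * 1.
  by do 4 (apply: normrM_le => //); exact: nk.
lra.
Qed.

Lemma profile_c_le : `|profile_c K a z| <= 2 * loglogr K a.
Proof. by rewrite -[leRHS]mulr1; do 2 apply: normrM_le => //. Qed.

Lemma stream_le : `|stream K a z| <= 128 * loglogr K a.
Proof.
have h1 : `|loglogr K a * sech2r K a z| <= loglogr K a * 1 by exact: normrM_le.
have h2 : `|vlog K a ^+ 2| <= 1 by exact: nX.
have h3 := ler_normD (loglogr K a * sech2r K a z) (vlog K a ^+ 2).
have : `|stream K a z| <= 64 * (loglogr K a + 1).
  by apply: normrM_le; [exact: nk|lra].
by move: L2; lra.
Qed.

Lemma stream_r_le : `|stream_r K a z| <= 512 * loglogr K a.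
Proof.
have h1 : `|2 * vlog K a * sech2r K a z| <= 2 * 1 * 1.
  by do 2 (apply: normrM_le => //); exact: nk.
have h2 : `|4 * loglogr K a * taur K a z * sech2r K a z * cosr a z * vlog K a| <=
    4 * loglogr K a * 1 * 1 * 1 * 1.
  by do 5 (apply: normrM_le => //); exact: nk.
have h3 : `|2 * vlog K a ^+ 3| <= 2 * 1 by apply: normrM_le; [exact: nk|exact: nX].
rewrite /stream_r; set A := 2 * _ * _ in h1 *; set B := 4 * _ * _ * _ * _ * _ in h2 *.
set C := 2 * _ ^+ 3 in h3 *.
have h4 := ler_normB (A - B) C; have h5 := ler_normB A B.
have : `|64 * (A - B - C)| <= 64 * (4 + 4 * loglogr K a).
  by apply: normrM_le; [exact: nk|lra].
by move: L2; lra.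
Qed.

Lemma stream_c_le : `|stream_c K a z| <= 128 * loglogr K a ^+ 2.
Proof.
rewrite normrN -[leRHS]mulr1 -[leRHS]mulr1.
do 3 (apply: normrM_le => //); first exact: nk.
by rewrite normrX ger0_norm.
Qed.

Lemma stream_x_le : `|stream_x K a z| <= 768 * loglogr K a ^+ 2.
Proof.
have h1 : `|tht a * stream_r K a z| <= 1 * (512 * loglogr K a).
  by apply: normrM_le => //; exact: stream_r_le.
have h2 : `|cosr a z * stream_c K a z| <= 1 * (128 * loglogr K a ^+ 2).
  by apply: normrM_le => //; exact: stream_c_le.
have h3 := stream_le.
have h4 := ler_normB (- (tht a * stream_r K a z) - cosr a z * stream_c K a z) (stream K a z).
have h5 := ler_normB (- (tht a * stream_r K a z)) (cosr a z * stream_c K a z).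
have h6 : 2 * loglogr K a <= loglogr K a ^+ 2 by rewrite expr2 ler_wpM2r.
move: h5; rewrite normrN /stream_x => h5.
by move: L2; lra.
Qed.

End bounds.

(* [w >= e^(-2 L sigma)] and [e^(-L) = v^2]: this is why [L] is twice the
   logarithm of [logr]. *)
Lemma profile_core a z : 0 <= a -> 0 <= cosr a z -> cosr a z <= 1/2 ->
  vlog K a ^+ 2 <= sech2r K a z.
Proof.
move=> a0 c0 c1; have L2 := loglogr_ge2 a0.
have L0 : 0 <= loglogr K a by apply: le_trans L2.
have := @sech2_ge R (loglogr K a * cosr a z) (mulr_ge0 L0 c0).
apply: le_trans; rewrite sqr_vlogE// ler_expR lerN2.
have : loglogr K a * cosr a z <= loglogr K a * (1/2) by rewrite ler_wpM2l.
lra.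
Qed.

Lemma profile_cap a z : 0 <= a -> 1/2 <= cosr a z ->
  sech2r K a z <= 4 * vlog K a ^+ 2.
Proof.
move=> a0 c1; have L2 := loglogr_ge2 a0.
have L0 : 0 <= loglogr K a by apply: le_trans L2.
apply: le_trans (sech2_le _) _; rewrite ler_pM2l// sqr_vlogE// ler_expR lerN2.
have : loglogr K a * (1/2) <= loglogr K a * cosr a z by rewrite ler_wpM2l.
lra.
Qed.

Lemma taur_ge0 a z : 0 <= a -> 0 <= z -> 0 <= taur K a z.
Proof.
move=> a0 z0; apply: tanhR_ge0; rewrite mulr_ge0//.
  by apply: le_trans (loglogr_ge2 a0).
by rewrite mulr_ge0// rsqrt_ge0.
Qed.

Lemma cosrN a z : cosr a (- z) = - cosr a z. Proof. by rewrite /cosr mulNr. Qed.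

Lemma taurN a z : taur K a (- z) = - taur K a z.
Proof. by rewrite /taur cosrN mulrN tanhRN. Qed.

Lemma sech2rN a z : sech2r K a (- z) = sech2r K a z.
Proof. by rewrite /sech2r taurN sqrrN. Qed.

Lemma profile_rN a z : profile_r K a (- z) = - profile_r K a z.
Proof. by rewrite /profile_r taurN cosrN sech2rN; ring. Qed.

Lemma profile_cN a z : profile_c K a (- z) = profile_c K a z.
Proof. by rewrite /profile_c sech2rN. Qed.

Lemma streamN a z : stream K a (- z) = stream K a z.
Proof. by rewrite /stream sech2rN. Qed.

Lemma stream_rN a z : stream_r K a (- z) = stream_r K a z.
Proof. by rewrite /stream_r sech2rN cosrN taurN; ring. Qed.

Variable mu : R.
Hypotheses (mu2 : 2 <= mu) (Kmu : 32 * (mu + 2) <= K).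

(** Components of the flux, multiplied by [|x|], when [mu = n - 1] and [a = |x|^2]. In the radial
    one the radial derivatives of [m] cancel, which leaves [mu * cos * M - (1 - cos^2) * dM/dcos];
    they survive only in [flux_c]. *)
Definition flux_r a z : R := mu * cosr a z * stream K a z +
  128 * (1 - cosr a z ^+ 2) * loglogr K a ^+ 2 * taur K a z * sech2r K a z.
Definition flux_c a z : R := (mu - 1) * stream K a z - tht a * stream_r K a z.
Definition flux_energy a z : R :=
  flux_r a z * profile_r K a z + (1 - cosr a z ^+ 2) * flux_c a z * profile_c K a z.

Lemma flux_rN a z : flux_r a (- z) = - flux_r a z.
Proof. by rewrite /flux_r streamN cosrN sech2rN taurN sqrrN; ring. Qed.

Lemma flux_cN a z : flux_c a (- z) = flux_c a z.
Proof. by rewrite /flux_c streamN stream_rN. Qed.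

Lemma flux_energyN a z : flux_energy a (- z) = flux_energy a z.
Proof.
by rewrite /flux_energy flux_rN flux_cN profile_rN profile_cN cosrN sqrrN mulrNN.
Qed.

(** Both inequalities are invariant under [z -> - z], so the scalar estimates for a nonnegative
    cosine apply. The bound [a <= 1] yields [tht a >= 1/2], and [Kmu] yields the smallness of
    [vlog K a]. *)
Lemma profile_flux_bounds a z : 0 <= a -> a <= 1 -> z ^+ 2 <= a ->
  2 * (profile_r K a z ^+ 2 + (1 - cosr a z ^+ 2) * profile_c K a z ^+ 2) <= flux_energy a z /\
  flux_r a z ^+ 2 + (1 - cosr a z ^+ 2) * flux_c a z ^+ 2 <=
    5120 * (mu + 2) ^+ 2 * loglogr K a ^+ 2 * flux_energy a z.
Proof.
move=> a0 a1; wlog z0 : z / 0 <= z => [H za|za].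
  have [/H|/ltW z0] := leP 0 z; first exact.
  have := H (- z); rewrite oppr_ge0 sqrrN => /(_ z0 za).
  by rewrite flux_energyN flux_rN flux_cN profile_rN profile_cN cosrN !sqrrN.
have c0 : 0 <= cosr a z by rewrite mulr_ge0// rsqrt_ge0.
have c1 : cosr a z <= 1 by have := normr_cosr_le1 za; rewrite ger0_norm.
have t0 := taur_ge0 a0 z0.
have t1 : taur K a z <= 1 by have := normr_tanhR_le1 (loglogr K a * cosr a z); apply: le_trans;
  exact: ler_norm.
have v0 := vlog_gt0 a0.
have vmu : 32 * vlog K a * (mu + 2) <= 1.
  rewrite mulrAC -ler_pdivlMr// mul1r invrK.
  by apply: le_trans Kmu (logr_ge K a0).
have L1 : 1 <= loglogr K a by apply: le_trans (loglogr_ge2 a0); lra.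
have core := fun h => profile_core a0 c0 h.
have cap := fun h => @profile_cap a z a0 h.
split.
  by apply: (@gradient_le_flux R mu (tht a) (cosr a z) (taur K a z) (vlog K a)
    (loglogr K a) (sech2r K a z) (stream K a z) _ _ (stream_r K a z)) => //; [exact:
      tht_ge12|exact: tht_le1].
by apply: (@flux_le R mu (tht a) (cosr a z) (taur K a z) (vlog K a)
    (loglogr K a) (sech2r K a z) (stream K a z) _ _ (stream_r K a z)) => //; [exact:
      tht_ge12|exact: tht_le1].
Qed.

End profile_bounds.

(** * Integrability at the origin *)

Section shells.
Context {R : realType} {n : nat}.
Local Notation leb := (@lebesgue_rV R n).
Local Notation B := (@unit_ball R n).
Implicit Types (x : 'rV[R]_n) (k : nat).

Definition shell_radius k : R := (4 ^+ k)^-1.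

Lemma shell_radius_gt0 k : 0 < shell_radius k.
Proof. by rewrite invr_gt0 exprn_gt0. Qed.

(** Take the least [k] with [4^-(k+1) <= |x|]. The outer bound is stated with a cube because its
    volume is explicit. *)
Lemma exists_shell x : x <> 0 -> B x ->
  exists k, shell_radius k.+1 <= enorm x /\ cube (shell_radius k) x.
Proof.
move=> x0 Bx; have r0 : 0 < enorm x.
  rewrite lt_def enorm_ge0 andbT; apply/eqP => h; apply: x0; apply: dotrv_eq0.
  by rewrite -sqr_enorm h expr0n.
have ex : exists k, shell_radius k.+1 <= enorm x.
  have [k _ hk] := near_infty_natSinv_lt (PosNum r0).
  exists k; apply: le_trans (ltW (hk k (leqnn k))).
  rewrite /shell_radius lef_pV2 ?posrE ?exprn_gt0// -natrX ler_nat.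
  by apply: ltnW; exact: ltn_expl.
case: (ex_minnP ex) => k hk kmin; exists k; split=> //.
apply/cubeP => i; apply: le_trans (normr_coord_le x i) _.
case: k hk kmin => [_ _|k hk kmin].
  by rewrite /shell_radius expr0 invr1; exact: ltW.
rewrite leNgt; apply/negP => /ltW /kmin; rewrite ltnn//.
Qed.

(* On the shell [4^-(k+1) <= |x| <= 4^-k], of volume at most [C 64^-k] as [n >= 3],
   a function of size [32^k] has integral at most [C 2^-k]. *)
Lemma integrable_of_shells (f : 'rV[R]_n -> R) (c : R) : (3 <= n)%N ->
  measurable_fun B f -> 0 <= c -> f 0 = 0 ->
  (forall x k, B x -> shell_radius k.+1 <= enorm x -> `|f x| <= c * 32 ^+ k) ->
  leb.-integrable B (EFin \o f).
Proof.
move=> n3 mf c0 f0 fle; apply/integrableP; split; first exact/measurable_EFinP.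
(* The sum of all [g k] dominates [|f|]: a nonzero point of the ball lies in some shell, where a
   single term is enough, and at the origin [f] is zero. *)
pose g k x : \bar R := ((c * 32 ^+ k)%:E * (\1_(cube (shell_radius k)) x)%:E)%E.
have c32 k : 0 <= c * 32 ^+ k by rewrite mulr_ge0// exprn_ge0.
have g0 k x : (0 <= g k x)%E.
  by rewrite /g -EFinM lee_fin mulr_ge0// indicE; case: (_ \in _).
have mg k : measurable_fun setT (g k).
  apply: measurable_funeM; apply/measurable_EFinP.
  by apply: measurable_indic; exact: measurable_cube.
apply: (@le_lt_trans _ _ (\int[leb]_(x in B) (\sum_(k <oo) g k x))%E).
  apply: ge0_le_integral => //.
  - exact: measurable_unit_ball.
  - by apply: measurableT_comp => //; exact/measurable_EFinP.
  - by apply: ge0_emeasurable_sum => // k _; exact: measurable_funTS.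
  - move=> x Bx; have [->|/eqP x0] := eqVneq x 0.
      by rewrite /= f0 normr0; apply: nneseries_ge0.
    have [k [k1 k2]] := exists_shell x0 Bx.
    apply: (@le_trans _ _ (g k x)).
      rewrite /g indicE mem_set// mule1 lee_fin; exact: fle.
    have := @nneseries_lim_ge R (fun k => g k x) xpredT 0 k.+1 (fun _ _ _ => g0 _ x).
    apply: le_trans; rewrite big_nat_recr//= leeDr// sume_ge0//.
rewrite integral_nneseries//; last 2 first.
- exact: measurable_unit_ball.
- by move=> k; exact: measurable_funTS.
have ig k : (\int[leb]_(x in B) g k x <= (c * 2 ^+ n * 2 / (2 ^ k.+1)%:R)%:E)%E.
  apply: (@le_trans _ _ (\int[leb]_x g k x)%E).
    by apply: ge0_subset_integral => //; exact: measurable_unit_ball.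
  rewrite /g ge0_integralZl_EFin//; last first.
    by apply/measurable_EFinP; apply: measurable_indic; exact: measurable_cube.
  rewrite integral_indic//; last exact: measurable_cube.
  rewrite setIT.
  have E : leb (cube (shell_radius k)) = ((2 * shell_radius k) ^+ n)%:E.
    by apply: lebesgue_cube; exact/ltW/shell_radius_gt0.
  rewrite [X in (_ * X)%E]E -EFinM lee_fin exprMn /shell_radius.
  rewrite -!mulrA ler_wpM2l// mulrCA ler_wpM2l ?exprn_ge0//.
  rewrite natrX exprS invfM mulrA divff// mul1r.
  (* Here [n >= 3] enters: the volume decays like [64^-k], faster than [32^k] grows. *)
  have h : ((4 ^+ k)^-1 : R) ^+ n <= (64 ^+ k)^-1.
    have -> : ((64 ^+ k)^-1 : R) = ((4 ^+ k)^-1) ^+ 3.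
      by rewrite exprVn -exprM mulnC exprM; congr (_ ^+ k)^-1; rewrite -natrX.
    apply: ler_wiXn2l n3; first by rewrite invr_ge0 exprn_ge0.
    by rewrite invf_le1 ?exprn_gt0// exprn_ege1// ler1n.
  apply: le_trans (ler_wpM2l _ h) _; first exact: exprn_ge0.
  have -> : (64 : R) = 32 * 2 by ring.
  by rewrite exprMn invfM mulrA divff ?mul1r// expf_neq0.
apply: (@le_lt_trans _ _ (c * 2 ^+ n * 2)%:E); last exact: ltry.
have e0 : 0 <= c * 2 ^+ n * 2 by rewrite !mulr_ge0// exprn_ge0.
apply: le_trans (epsilon_trick0 xpredT e0).
apply: lee_nneseries => [k _ _|k _]; last exact: ig.
by apply: integral_ge0 => x _; exact: g0.
Qed.

End shells.

(** * The solution, its flux and the coefficients *)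

Section rank_one_matrix.
Context {R : realType} {n : nat}.
Implicit Types (f g xi : 'rV[R]_n) (c : R).

(* The matrix [Id + h h^T / (h . g)] with [h = f - g]: it maps [g] to [f]. *)
Definition rank_one_mx f g : 'M[R]_n :=
  1%:M + (dotrv (f - g) g)^-1 *: ((f - g)^T *m (f - g)).

Lemma rank_one_mx_sym f g : (rank_one_mx f g)^T = rank_one_mx f g.
Proof. by rewrite /rank_one_mx linearD/= linearZ/= trmx_mul trmxK trmx1. Qed.

Lemma mulmrv_rank_one f g xi : mulmrv (rank_one_mx f g) xi =
  xi + ((dotrv (f - g) g)^-1 * dotrv xi (f - g)) *: (f - g).
Proof.
rewrite /mulmrv rank_one_mx_sym /rank_one_mx mulmxDr mulmx1; congr (_ + _).
rewrite -scalemxAr mulmxA (mx11_scalar (xi *m (f - g)^T)) mul_scalar_mx.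
by rewrite scalerA -dotrvE.
Qed.

Variables (f g : 'rV[R]_n) (c : R).
Hypotheses (gf : 2 * dotrv g g <= dotrv f g) (fc : dotrv f f <= c * dotrv f g).

Let hg : dotrv (f - g) g = dotrv f g - dotrv g g.
Proof. by rewrite dotrvC dotrvBr dotrvC. Qed.

Let hh : dotrv (f - g) (f - g) <= c * dotrv f g.
Proof.
rewrite dotrvBr dotrvC dotrvBr (dotrvC (f - g) g) dotrvBr (dotrvC g f).
have := dotrv_ge0 g; move: gf fc; lra.
Qed.

Let fg0 : 0 <= dotrv f g. Proof. by apply: le_trans gf; rewrite mulr_ge0// dotrv_ge0. Qed.

Let hg_ge : dotrv f g / 2 <= dotrv (f - g) g. Proof. by rewrite hg; move: gf; lra. Qed.

Let hg0 : 0 <= dotrv (f - g) g.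
Proof. by apply: le_trans hg_ge; rewrite divr_ge0. Qed.

(** If [h . g = 0], the hypotheses force [f . g = 0], then [h = 0] and [f = g]; since the inverse of
    0 is 0, the matrix is the identity in that case. *)
Lemma mulmrv_rank_one_grad : mulmrv (rank_one_mx f g) g = f.
Proof.
rewrite mulmrv_rank_one (dotrvC g).
have [h0|h0] := eqVneq (dotrv (f - g) g) 0; last by rewrite mulVf// scale1r addrC subrK.
have fgE : dotrv f g = 0.
  by apply: le_anti; rewrite fg0 andbT; move: hg_ge; rewrite h0; lra.
have : f - g = 0.
  apply: dotrv_eq0; apply: le_anti; rewrite dotrv_ge0 andbT.
  by apply: le_trans hh _; rewrite fgE mulr0.
by move/eqP; rewrite subr_eq0 => /eqP ->; rewrite subrr scaler0 addr0.
Qed.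

(** By Cauchy-Schwarz the rank-one term is at most [(h . h) / (h . g)] times [|xi|^2]; the [2 c]
    arises from [h . h <= c (f . g)] and [f . g <= 2 (h . g)]. *)
Lemma rank_one_elliptic xi : 0 <= c ->
  dotrv xi xi <= dotrv (mulmrv (rank_one_mx f g) xi) xi <= (1 + 2 * c) * dotrv xi xi.
Proof.
move=> c0; rewrite mulmrv_rank_one dotrvDl dotrvZl (dotrvC _ xi) -mulrA -expr2.
have h0 : 0 <= (dotrv (f - g) g)^-1 * dotrv xi (f - g) ^+ 2.
  by rewrite mulr_ge0 ?invr_ge0// sqr_ge0.
rewrite lerDl h0/= mulrDl mul1r lerD2l.
have [h1|h1] := eqVneq (dotrv (f - g) g) 0.
  by rewrite h1 invr0 mul0r !mulr_ge0// dotrv_ge0.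
have hgp : 0 < dotrv (f - g) g by rewrite lt_def h1 hg0.
rewrite ler_pdivrMl//; apply: le_trans (dotrv_cauchy _ _) _.
have h2 : dotrv (f - g) (f - g) <= 2 * c * dotrv (f - g) g.
  apply: le_trans hh _; have := ler_wpM2l c0 hg_ge; lra.
have := ler_wpM2l (dotrv_ge0 xi) h2; lra.
Qed.

End rank_one_matrix.

Section construction.
Context {R : realType} {n : nat}.
Variables (K : R) (i0 : 'I_n).
Hypotheses (n3 : (3 <= n)%N) (Ke : expR 1 <= K) (Kn : 32 * (n%:R + 1) <= K).
Implicit Types (x : 'rV[R]_n) (e : R) (i j : 'I_n).
Local Notation B := (@unit_ball R n).
Local Notation leb := (@lebesgue_rV R n).
Local Notation "''e_' i" := (delta_mx ord0 i : 'rV[R]_n) (at level 8, i at level 2).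
Local Notation nr := (n%:R : R).

Let K1 : 1 <= K. Proof. by apply: le_trans Ke; rewrite -expR0 ler_expR. Qed.

Let mu : R := nr - 1.
Let n3r : 3 <= nr. Proof. by rewrite ler_nat. Qed.
Let mu2 : 2 <= mu. Proof. by rewrite /mu; move: n3r; lra. Qed.
Let Kmu : 32 * (mu + 2) <= K. Proof. by apply: le_trans Kn; rewrite /mu; lra. Qed.

Local Notation a_ e x := (sqnorm e x).
Local Notation z_ x := (x ord0 i0).

Lemma sqnorm0 x : sqnorm 0 x = dotrv x x. Proof. exact: addr0. Qed.

Lemma sqnorm_ge0 e x : 0 <= e -> 0 <= a_ e x.
Proof. by move=> e0; rewrite addr_ge0// dotrv_ge0. Qed.

Lemma sqr_coord_le_sqnorm e x i : 0 <= e -> x ord0 i ^+ 2 <= a_ e x.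
Proof. by move=> e0; apply: le_trans (sqr_coord_le x i) _; rewrite lerDl. Qed.

Lemma sqnorm0_gt0 x : x <> 0 -> 0 < sqnorm 0 x.
Proof.
move=> x0; rewrite lt_def sqnorm_ge0// andbT sqnorm0.
by apply/eqP => /dotrv_eq0.
Qed.

Lemma sqnorm0_le1 x : B x -> sqnorm 0 x <= 1.
Proof.
move=> Bx; rewrite sqnorm0 -sqr_enorm expr_le1// ?enorm_ge0//; exact: ltW.
Qed.

Lemma sqnorm0_0 : sqnorm (0 : R) (0 : 'rV[R]_n) = 0.
Proof. by rewrite sqnorm0 dotrvE mul0mx mxE. Qed.

Lemma rsqrt0 : rsqrt (0 : R) = 0.
Proof. by rewrite /rsqrt sqrtr0 invr0. Qed.

Definition sol_grad e x : 'rV[R]_n := \row_i grad_u K i0 e x i.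
Definition sol_flux e x : 'rV[R]_n := \row_i flux K i0 e x i.

(** For [a = |x|^2]: [1 / |x|] times the vector with radial component [be] whose tangential part is
    [al] times that of the basis vector. Gradient and flux both have this form, so all inner
    products follow from [dotrv_frame]. *)
Let frame (al be : R) (a : R) x : 'rV[R]_n :=
  (al * rsqrt a) *: 'e_i0 + ((be - cosr a (z_ x) * al) * rsqrt a ^+ 2) *: x.

Let dotrv_e0 x : dotrv 'e_i0 x = z_ x.
Proof.
rewrite /dotrv (bigD1 i0)//= mxE !eqxx mul1r big1 ?addr0// => i ii.
by rewrite mxE (negbTE ii) andbF mul0r.
Qed.

Let dotrv_frame al be al' be' x : x <> 0 ->
  dotrv (frame al be (a_ 0 x) x) (frame al' be' (a_ 0 x) x) =
  rsqrt (a_ 0 x) ^+ 2 * (be * be' + (1 - cosr (a_ 0 x) (z_ x) ^+ 2) * (al * al')).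
Proof.
move=> x0; have a0 := sqnorm0_gt0 x0.
rewrite /frame !(dotrvDl, dotrvDr, dotrvZl, dotrvZr) (dotrvC x) !dotrv_e0 mxE !eqxx/=.
have -> : dotrv x x = a_ 0 x by rewrite sqnorm0.
rewrite /cosr; set r := rsqrt _; have r2 : a_ 0 x = (r ^+ 2)^-1.
  by rewrite /r sqr_rsqrt// invrK.
have r0 : r != 0 by rewrite invr_eq0 gt_eqF// sqrtr_gt0.
by rewrite r2; field.
Qed.

Let sol_grad_frame x : sol_grad 0 x = frame (profile_c K (a_ 0 x) (z_ x)) (profile_r K (a_ 0 x)
  (z_ x)) (a_ 0 x) x.
Proof. by apply/rowP => i; rewrite !mxE /grad_u/= eq_sym addrC. Qed.

Let sol_flux_frame x : x <> 0 ->
  sol_flux 0 x = frame (flux_c K mu (a_ 0 x) (z_ x)) (flux_r K mu (a_ 0 x) (z_ x)) (a_ 0 x) x.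
Proof.
move=> x0; have a0 := sqnorm0_gt0 x0; apply/rowP => i; rewrite !mxE /flux/=.
have -> : \sum_j x ord0 j * grad_m K i0 0 x j =
    stream_x K (a_ 0 x) (z_ x) * rsqrt (a_ 0 x) ^+ 3 * a_ 0 x +
    stream_c K (a_ 0 x) (z_ x) * rsqrt (a_ 0 x) ^+ 2 * z_ x.
  under eq_bigr do rewrite /grad_m mulrDr.
  rewrite big_split/=; congr (_ + _).
    rewrite [X in _ = _ * X]sqnorm0 /dotrv mulr_sumr; apply: eq_bigr => j _; ring.
  rewrite (bigD1 i0)//= eqxx mulr1 big1 ?addr0 ?(mulrC (z_ x))// => j /negbTE ->.
  by rewrite mulr0 mulr0.
rewrite /grad_m eqxx /pot /potential /flux_c /flux_r /stream_x /stream_c /cosr /mu.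
set r := rsqrt _; have r2 : a_ 0 x = (r ^+ 2)^-1.
  by rewrite /r sqr_rsqrt// invrK.
have r0 : r != 0 by rewrite invr_eq0 gt_eqF// sqrtr_gt0.
have -> : forall t : R, t * r ^+ 3 * a_ 0 x = t * r by move=> t; rewrite r2; field.
rewrite (_ : true%:R = 1 :> R)// -[x 0 i]/(x ord0 i); ring.
Qed.

(** A consequence of [rsqrt 0 = 0]. The flux vanishes at the origin as well, so the coefficient
    matrix is the identity there and the pointwise bounds hold on the whole ball. *)
Lemma sol_grad0 : sol_grad 0 0 = 0.
Proof.
by apply/rowP => i; rewrite !mxE /grad_u sqnorm0_0 rsqrt0 expr0n/= !mulr0 !mul0r addr0.
Qed.

Lemma sol_flux0 : sol_flux 0 0 = 0.
Proof.
apply/rowP => i; rewrite !mxE /flux !mxE mulr0 subr0 /pot /potential sqnorm0_0 rsqrt0 mulr0 mulr0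
  add0r.
by rewrite big1 ?mul0r// => j _; rewrite mxE mul0r.
Qed.

Definition flux_const : R := 5120 * (mu + 2) ^+ 2.

Lemma flux_const_ge0 : 0 <= flux_const.
Proof. by apply: mulr_ge0; [exact: ler0n|exact: sqr_ge0]. Qed.

(** Off the origin every inner product carries the same factor [|x|^-2], which cancels and leaves
    the scalar inequalities of [profile_flux_bounds]. *)
Lemma sol_flux_bounds x : B x ->
  2 * dotrv (sol_grad 0 x) (sol_grad 0 x) <= dotrv (sol_flux 0 x) (sol_grad 0 x) /\
  dotrv (sol_flux 0 x) (sol_flux 0 x) <= flux_const * loglogr K (a_ 0 x) ^+ 2 * dotrv (sol_flux 0
    x) (sol_grad 0 x).
Proof.
move=> Bx; have [->|/eqP x0] := eqVneq x 0.
  by rewrite sol_grad0 sol_flux0 !dotrvE mul0mx mxE !mulr0.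
have a0 := sqnorm_ge0 x (lexx 0).
have [b1 b2] := profile_flux_bounds Ke mu2 Kmu a0 (sqnorm0_le1 Bx) (sqr_coord_le_sqnorm x i0 (lexx
  0)).
rewrite sol_grad_frame sol_flux_frame// !dotrv_frame//.
have r0 : 0 <= rsqrt (a_ 0 x) ^+ 2 by rewrite sqr_ge0.
split.
  by rewrite [leLHS]mulrCA; apply: ler_wpM2l => //; move: b1; rewrite /flux_energy -!expr2 !mulrA.
rewrite [leRHS]mulrCA; apply: ler_wpM2l => //; rewrite /flux_const.
by move: b2; rewrite /flux_energy -!expr2 !mulrA.
Qed.

Section pointwise_bounds.
Variables (e : R) (x : 'rV[R]_n).
Hypothesis e0 : 0 <= e.
Let a := a_ e x.
Let a0 : 0 <= a. Proof. exact: sqnorm_ge0. Qed.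
Let za : z_ x ^+ 2 <= a. Proof. exact: sqr_coord_le_sqnorm. Qed.
Let L := loglogr K a.
Let r := rsqrt a.
Let L2 : 2 <= L. Proof. exact: loglogr_ge2. Qed.
Let r0 : 0 <= r. Proof. exact: rsqrt_ge0. Qed.
Let LL : L <= L ^+ 2.
Proof. by rewrite expr2 ler_peMr//; [apply: le_trans L2|apply: le_trans L2; rewrite ler1n]. Qed.
Let xr j : `|x ord0 j| * r <= 1.
Proof. exact: normr_mul_rsqrt_le1 (sqr_coord_le_sqnorm x j e0). Qed.
Let dle1 i : `|(i == i0)%:R : R| <= 1.
Proof. by case: (i == i0); rewrite ?normr1 ?normr0. Qed.

Lemma normr_sol_le2 : `|sol K i0 e x| <= 2.
Proof. exact: (profile_le2 Ke _ a0). Qed.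

Lemma normr_grad_u_le i : `|grad_u K i0 e x i| <= 9 * L * r.
Proof.
rewrite /grad_u -/a -/r.
have p5 := profile_r_le5 Ke a0 za; have q2 := profile_c_le Ke (z_ x) a0.
have c1 := normr_cosr_le1 za.
set p := profile_r K a _ in p5 *; set q := profile_c K a _ in q2 *; set c := cosr a _ in c1 *;
  clearbody p q c.
have h1 : `|p - c * q| <= 7 * L.
  apply: le_trans (ler_normB _ _) _; rewrite (normrM c q).
  have : `|c| * `|q| <= 1 * (2 * L) by apply: ler_pM.
  by move: L2 p5; lra.
have h2 : `|(p - c * q) * r ^+ 2 * x ord0 i| <= 7 * L * r.
  rewrite expr2 mulrA -mulrA normrM (normrM (p - c * q)) (ger0_norm r0) normrM (ger0_norm r0)
    (mulrC r).
  apply: le_trans (ler_pM _ _ (ler_wpM2r r0 h1) (xr i)) _; rewrite ?mulr_ge0//.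
  by rewrite mulr1.
have h3 : `|q * r * (i == i0)%:R| <= 2 * L * r.
  rewrite normrM normrM (ger0_norm r0) -[leRHS]mulr1; apply: ler_pM => //.
    by rewrite mulr_ge0.
  by rewrite ler_wpM2r.
by apply: le_trans (ler_normD _ _) _; lra.
Qed.

Let grad_m_le j : `|grad_m K i0 e x j| <= 896 * L ^+ 2 * r ^+ 2.
Proof.
rewrite /grad_m -/a -/r.
have s1 := stream_x_le Ke a0 za; have s2 := stream_c_le Ke (z_ x) a0.
set s := stream_x K a _ in s1 *; set c := stream_c K a _ in s2 *; clearbody s c.
have r20 : 0 <= r ^+ 2 by rewrite sqr_ge0.
have h2 : `|s * r ^+ 3 * x ord0 j| <= 768 * L ^+ 2 * r ^+ 2.
  rewrite exprSr mulrA -mulrA normrM (normrM s) (ger0_norm r20) normrM (ger0_norm r0) (mulrC r).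
  apply: le_trans (ler_pM _ _ (ler_wpM2r r20 s1) (xr j)) _; rewrite ?mulr_ge0//.
  by rewrite mulr1.
have h3 : `|c * r ^+ 2 * (j == i0)%:R| <= 128 * L ^+ 2 * r ^+ 2.
  rewrite normrM normrM (ger0_norm r20) -[leRHS]mulr1; apply: ler_pM => //.
    by rewrite mulr_ge0.
  by rewrite ler_wpM2r.
by apply: le_trans (ler_normD _ _) _; lra.
Qed.

Let x_grad_m_le i j : `|x ord0 i| * `|grad_m K i0 e x j| <= 896 * L ^+ 2 * r.
Proof.
have h : `|x ord0 i| * `|grad_m K i0 e x j| <= `|x ord0 i| * (896 * L ^+ 2 * r ^+ 2).
  by rewrite ler_wpM2l.
apply: le_trans h _.
have -> : `|x ord0 i| * (896 * L ^+ 2 * r ^+ 2) = (896 * L ^+ 2 * r) * (`|x ord0 i| * r) by ring.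
apply: ler_piMr (xr i); apply: mulr_ge0 r0.
by apply: mulr_ge0; [exact: ler0n|exact: sqr_ge0].
Qed.

Lemma normr_flux_le i : `|flux K i0 e x i| <= 2000 * nr * L ^+ 2 * r.
Proof.
rewrite /flux /pot /potential -/a -/r.
have s1 := stream_le Ke (z_ x) a0; set m := stream K a _ in s1 *.
have L20 : 0 <= L ^+ 2 by rewrite sqr_ge0.
have h1 : `|(nr - 1) * (m * r)| <= nr * (128 * L ^+ 2 * r).
  rewrite normrM; apply: ler_pM => //.
    by rewrite ger0_norm; [lra|move: n3r; lra].
  rewrite normrM (ger0_norm r0) ler_wpM2r//; apply: le_trans s1 _.
  by rewrite -/L; move: LL; lra.
have h2 : `|\sum_j x ord0 j * grad_m K i0 e x j| <= nr * (896 * L ^+ 2 * r).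
  apply: le_trans (ler_norm_sum _ _ _) _.
  rewrite mulr_natl -[n in X in _ <= X]card_ord -sumr_const.
  by apply: ler_sum => j _; rewrite normrM.
have h3 : `|grad_m K i0 e x i0 * x ord0 i| <= 896 * L ^+ 2 * r.
  by rewrite normrM mulrC.
set A := _ * (m * r) in h1 *; set S := \sum_j _ in h2 *; set H := grad_m _ _ _ _ _ * _ in h3 *.
have h4 : `|(A + S) * (i == i0)%:R| <= `|A| + `|S|.
  by rewrite normrM; apply: le_trans (ler_normD _ _); rewrite ler_piMr.
have h5 := ler_normB ((A + S) * (i == i0)%:R) H.
have X0 : 0 <= L ^+ 2 * r by rewrite mulr_ge0.
have X3 : 3 * (L ^+ 2 * r) <= nr * (L ^+ 2 * r) by rewrite ler_wpM2r.
by lra.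
Qed.

End pointwise_bounds.

(** Source of the uniformity in [e]: [loglogr] and [rsqrt] decrease, so their values at [|x|^2 + e]
    are at most those at [|x|^2]. *)
Let a_mono e x : x <> 0 -> 0 <= e -> 0 < a_ 0 x /\ a_ 0 x <= a_ e x.
Proof. by move=> x0 e0; split; [exact: sqnorm0_gt0|rewrite lerD2l]. Qed.

(* Dominates, up to a constant and uniformly in [e], the energy density and the fluxes. *)
Definition majorant x : R := loglogr K (a_ 0 x) ^+ 4 * rsqrt (a_ 0 x) ^+ 2.

Lemma majorant_ge0 x : 0 <= majorant x.
Proof. by rewrite mulr_ge0 ?sqr_ge0// exprn_even_ge0. Qed.

Lemma loglogr_sqnorm_ge0 x : 0 <= loglogr K (a_ 0 x).
Proof. by apply: le_trans (loglogr_ge2 Ke (sqnorm_ge0 x (lexx 0))). Qed.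

Lemma sqr_grad_u_le e x i : x <> 0 -> 0 <= e ->
  loglogr K (a_ 0 x) ^+ 2 * grad_u K i0 e x i ^+ 2 <= 81 * majorant x.
Proof.
move=> x0 e0; have [b0 b1] := a_mono x0 e0.
have h := normr_grad_u_le x e0 i.
have hL := loglogr_le Ke b0 b1; have hr := rsqrt_le b0 b1.
have L0 := loglogr_sqnorm_ge0 x.
have Le0 : 0 <= loglogr K (a_ e x).
  by apply: le_trans (loglogr_ge2 Ke (sqnorm_ge0 x e0)).
set L := loglogr K (a_ 0 x) in hL L0 *; set r := rsqrt (a_ 0 x) in hr.
have h2 : `|grad_u K i0 e x i| <= 9 * (L * r).
  apply: le_trans h _; rewrite -mulrA ler_pM2l//.
  by apply: ler_pM => //; exact: rsqrt_ge0.
have r0 : 0 <= r by exact: rsqrt_ge0.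
have h3 : grad_u K i0 e x i ^+ 2 <= (9 * (L * r)) ^+ 2.
  rewrite -[leLHS]real_normK ?num_real//; apply: lerXn2r h2; rewrite nnegrE//.
  by apply: mulr_ge0 => //; exact: mulr_ge0.
apply: le_trans (ler_wpM2l (sqr_ge0 L) h3) _.
rewrite /majorant -/L -/r le_eqVlt; apply/orP; left; apply/eqP; ring.
Qed.

Lemma flux_le_majorant e x i : x <> 0 -> 0 <= e ->
  `|flux K i0 e x i| <= 2000 * nr * (1 + majorant x).
Proof.
move=> x0 e0; have [b0 b1] := a_mono x0 e0.
have h := normr_flux_le x e0 i.
have hL := loglogr_le Ke b0 b1; have hr := rsqrt_le b0 b1.
have L0 := loglogr_sqnorm_ge0 x.
have Le0 : 0 <= loglogr K (a_ e x).
  by apply: le_trans (loglogr_ge2 Ke (sqnorm_ge0 x e0)).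
set L := loglogr K (a_ 0 x) in hL L0 *; set r := rsqrt (a_ 0 x) in hr.
have r0 : 0 <= r by exact: rsqrt_ge0.
have h2 : loglogr K (a_ e x) ^+ 2 * rsqrt (a_ e x) <= L ^+ 2 * r.
  apply: ler_pM => //; [exact: sqr_ge0|exact: rsqrt_ge0|].
  by rewrite ler_sqr ?nnegrE.
(* [majorant x] is the square of [t = L^2 r], and [t <= 1 + t^2]. *)
have h3 : L ^+ 2 * r <= 1 + majorant x.
  rewrite /majorant -/L -/r; set t := L ^+ 2 * r.
  have -> : L ^+ 4 * r ^+ 2 = t ^+ 2 by rewrite /t; ring.
  have := sqr_ge0 (t - 1); have := sqr_ge0 t; rewrite sqrrB expr1n mulr1; lra.
apply: le_trans h _; rewrite -[leLHS]mulrA; apply: ler_wpM2l (le_trans h2 h3).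
by apply: mulr_ge0; exact: ler0n.
Qed.

(** With [f i x = x_i m], the integrand is the sum over [i] of
    [D_i (f i) D_i0 phi - D_i0 (f i) D_i phi]; each summand integrates to zero by
    [integral_pd_swap], without second derivatives of [m]. *)
Lemma divergence_free e phi : 0 < e -> C1 phi -> vanishes_off 1 phi ->
  (\int[leb]_x (\sum_i flux K i0 e x i * 'D_('e_i) phi x)%:E = 0)%E.
Proof.
move=> e0 C1phi phi1.
have C1m := C1_pot i0 K1 e0.
have C1x i : C1 (fun x : 'rV[R]_n => x ord0 i).
  apply: (@C1_of_has_grad _ _ _ (fun x j => (j == i)%:R) _ _).1 => [x|j].
    exact: has_grad_coord.
  exact: cst_continuous.
pose f i x := x ord0 i * pot K i0 e x.
have C1f i : C1 (f i) by exact: C1M.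
pose w i x := 'D_('e_i) (f i) x * 'D_('e_i0) phi x - 'D_('e_i0) (f i) x * 'D_('e_i) phi x.
have pdx i j x : 'D_('e_j) (fun y : 'rV[R]_n => y ord0 i) x = (j == i)%:R.
  by have [_ ->] := has_grad_coord i x.
have pdf j l x : 'D_('e_j) (f l) x = x ord0 l * grad_m K i0 e x j + pot K i0 e x * (j == l)%:R.
  by rewrite -(pd_pot i0 K1 e0) -(pdx l j x); exact: (pdM _ _ (C1x l) C1m).
have iprod i j l : leb.-integrable setT (EFin \o (fun x => 'D_('e_i) (f j) x * 'D_('e_l) phi x)).
  apply: (@continuous_integrable _ _ _ 1).
    by apply: continuousMR; [have [_ _ c] := C1f j; exact: c|have [_ _ c] := C1phi; exact: c].
  by apply: vanishes_offM; exact: vanishes_off_pd.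
have iw i : leb.-integrable setT (EFin \o w i) by exact: integrableBR.
(* Each of the [n] derivatives [D_i (x_i m)] contributes one [m], and the subtracted terms remove
   one: this is the factor [n - 1] of [flux]. *)
have E x : \sum_i flux K i0 e x i * 'D_('e_i) phi x = \sum_i w i x.
  have wE i : w i x = pot K i0 e x * 'D_('e_i0) phi x
      + x ord0 i * grad_m K i0 e x i * 'D_('e_i0) phi x
      - (pot K i0 e x * (i == i0)%:R * 'D_('e_i) phi x
      + grad_m K i0 e x i0 * x ord0 i * 'D_('e_i) phi x).
    by rewrite /w !pdf eqxx (eq_sym i0 i) mulr1; ring.
  under [RHS]eq_bigr do rewrite wE.
  rewrite sumrB !big_split/= sumr_const card_ord.
  have -> : \sum_i pot K i0 e x * (i == i0)%:R * 'D_('e_i) phi x = pot K i0 e x * 'D_('e_i0) phi x.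
    rewrite (bigD1 i0)//= eqxx mulr1 big1 ?addr0// => i /negbTE ->.
    by rewrite mulr0 mul0r.
  under eq_bigr do rewrite /flux mulrBl.
  rewrite sumrB.
  have -> : \sum_i ((nr - 1) * pot K i0 e x + \sum_j x ord0 j * grad_m K i0 e x j) *
      (i == i0)%:R * 'D_('e_i) phi x =
      ((nr - 1) * pot K i0 e x + \sum_j x ord0 j * grad_m K i0 e x j) * 'D_('e_i0) phi x.
    set c := (_ + _); rewrite (bigD1 i0)//= eqxx mulr1 [X in _ + X]big1 ?addr0// => i /negbTE ->.
    by rewrite mulr0 mul0r.
  rewrite mulrDl mulr_suml -mulr_natl; set s1 := \sum_i _; set s2 := \sum_i _.
  by ring.
under eq_integral do rewrite E.
have iW : leb.-integrable setT (EFin \o (fun x => \sum_i w i x)) by exact: integrable_sumR.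
rewrite -(fineK (integrable_fin_num measurableT iW)); congr (_%:E).
rewrite -[LHS]/(\int[leb]_x (\sum_i w i x))%R Rintegral_sum//.
rewrite big1// => i _; rewrite RintegralB//.
by rewrite (integral_pd_swap i i0 ler01 (C1f i) C1phi phi1) subrr.
Qed.

End construction.

(** * Comparison of logarithms and integrability of the majorant *)

Section logarithms.
Context {R : realType} {n : nat}.
Variable K : R.
Hypotheses (n3 : (3 <= n)%N) (Ke : expR 1 <= K).
Implicit Types (x : 'rV[R]_n) (k : nat).
Local Notation B := (@unit_ball R n).
Local Notation leb := (@lebesgue_rV R n).

Let K1 : 1 <= K. Proof. by apply: le_trans Ke; rewrite -expR0 ler_expR. Qed.

Let e1 : 1 <= expR 1 :> R. Proof. by rewrite -expR0 ler_expR. Qed.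

Lemma ln_invr_enorm_ge0 x : B x -> 0 <= ln (enorm x)^-1.
Proof.
move=> Bx; have [r0|r0] := eqVneq (enorm x) 0; first by rewrite r0 invr0 ln0.
have r1 : 0 < enorm x by rewrite lt_def r0 enorm_ge0.
by rewrite lnV ?posrE// oppr_ge0 ln_le0// ltW.
Qed.

(** For [0 < r <= 1], [ln (1 + r^-2)] lies between [2 ln (1/r)] and [2 ln (1/r) + ln 2]. At the
    origin both logarithms are 0, by [0^-1 = 0] and [ln 0 = 0]. *)
Lemma logr_bounds x : B x ->
  K + ln (enorm x)^-1 <= logr K (sqnorm 0 x) <= K + 1 + ln (enorm x)^-1.
Proof.
move=> Bx; rewrite sqnorm0 -sqr_enorm /logr.
have [->|r0] := eqVneq (enorm x) 0.
  by rewrite expr0n/= !invr0 ln0// !addr0 ln1 mul0r addr0 lexx lerDl ler01.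
have r1 : 0 < enorm x by rewrite lt_def r0 enorm_ge0.
set r := enorm x in r0 r1 *; have r2 : 0 < r^-1 by rewrite invr_gt0.
have r3 : 1 <= r ^- 2 by rewrite invf_ge1 ?exprn_gt0// expr_le1 ?ltW.
have E : ln (r ^- 2) = 2 * ln r^-1 by rewrite -exprVn lnXn// mulr_natl.
have h1 : ln (r ^- 2) <= ln (1 + r ^- 2) by rewrite ler_ln ?posrE; lra.
have h2 : ln (1 + r ^- 2) <= ln (2 * r ^- 2) by rewrite ler_ln ?posrE; lra.
have h3 : ln (2 * r ^- 2) = ln 2 + ln (r ^- 2) by rewrite lnM ?posrE; lra.
have h4 := @ln_sublinear R 2 ltac:(lra).
rewrite -addrA !lerD2l; apply/andP; split; lra.
Qed.

Lemma loglog_le x : B x -> 1 <= ln (expR 1 + ln (enorm x)^-1) <= ln (logr K (sqnorm 0 x)).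
Proof.
move=> Bx; have t0 := ln_invr_enorm_ge0 Bx; have /andP[h1 _] := logr_bounds Bx.
have p : 0 < expR 1 + ln (enorm x)^-1 by rewrite ltr_wpDr// expR_gt0.
apply/andP; split.
  by rewrite -[leLHS](expRK (1 : R)) ler_ln ?posrE ?expR_gt0// lerDl.
have q : expR 1 + ln (enorm x)^-1 <= logr K (sqnorm 0 x) by move: Ke; lra.
by rewrite ler_ln ?posrE// (lt_le_trans p).
Qed.

(** Uses [ln (a b) <= (ln a + 1) ln b], valid once [ln a >= 0] and [ln b >= 1]. Together with
    [loglog_le], [loglogr] is thus comparable to the iterated logarithm of the theorem. *)
Lemma ln_logr_le x : B x ->
  ln (logr K (sqnorm 0 x)) <= (ln (K + 1) + 1) * ln (expR 1 + ln (enorm x)^-1).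
Proof.
move=> Bx; have t0 := ln_invr_enorm_ge0 Bx; have /andP[h1 h2] := logr_bounds Bx.
have /andP[l1 _] := loglog_le Bx.
have p : 0 < expR 1 + ln (enorm x)^-1 by rewrite ltr_wpDr// expR_gt0.
have k1 : 0 < K + 1 by move: K1; lra.
have k0 : 0 <= ln (K + 1) by apply: ln_ge0; move: K1; lra.
have T0 : 0 < logr K (sqnorm 0 x) by apply: logr_gt0 => //; exact: sqnorm_ge0.
have q : logr K (sqnorm 0 x) <= (K + 1) * (expR 1 + ln (enorm x)^-1).
  apply: le_trans h2 _; rewrite mulrDr lerD//.
    by rewrite ler_peMr// ltW.
  by rewrite ler_peMl//; move: K1; lra.
apply: (@le_trans _ _ (ln (K + 1) + ln (expR 1 + ln (enorm x)^-1))).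
  by rewrite -lnM ?posrE// ler_ln ?posrE ?mulr_gt0.
by rewrite mulrDl mul1r lerD2r ler_peMr.
Qed.

(* [(L / 8)^4 <= e^(L / 2)]. *)
Let loglogr_pow4_le a : 0 <= a -> loglogr K a ^+ 4 <= 8 ^+ 4 * logr K a.
Proof.
move=> a0; have T0 := logr_gt0 K1 a0.
have L0 : 0 <= loglogr K a by apply: le_trans (loglogr_ge2 Ke a0).
have h : loglogr K a / 8 <= expR (loglogr K a / 8).
  by apply: le_trans (expR_ge1Dx _); rewrite lerDr.
have -> : logr K a = expR (loglogr K a / 8) ^+ 4.
  rewrite -expRM_natl -[LHS]lnK ?posrE//; congr expR.
  by rewrite /loglogr; field.
rewrite -exprMn; apply: lerXn2r; rewrite ?nnegrE//.
by rewrite mulrC -ler_pdivrMr.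
Qed.

(** [|x|^-2] accounts for [16^k]. The fourth power of [loglogr] is at most a multiple of [logr],
    which grows linearly in [k] on the shells and is therefore covered by [2^k]. *)
Lemma majorant_shell_le x k : B x -> shell_radius k.+1 <= enorm x ->
  majorant K x <= (8 ^+ 4 * (K + 7) * 16) * 32 ^+ k.
Proof.
move=> Bx xk; have r1 : 0 < enorm x := lt_le_trans (shell_radius_gt0 k.+1) xk.
have a0 : 0 < sqnorm 0 x by rewrite sqnorm0 -sqr_enorm exprn_gt0.
have rV : (enorm x)^-1 <= 4 ^+ k.+1.
  by rewrite -[leRHS]invrK lef_pV2 ?posrE// invr_gt0 exprn_gt0.
have h1 : rsqrt (sqnorm 0 x) ^+ 2 <= 16 * 16 ^+ k.
  rewrite sqr_rsqrt// sqnorm0 -sqr_enorm -exprVn -exprS.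
  have -> : 16 ^+ k.+1 = (4 ^+ k.+1) ^+ 2 :> R.
    by rewrite exprAC; congr (_ ^+ _); ring.
  by apply: lerXn2r; rewrite ?nnegrE// ?invr_ge0 ?exprn_ge0// ltW.
have k2 : k.+1%:R <= 2 ^+ k :> R by rewrite -natrX ler_nat ltn_expl.
have l4 : ln 4 <= 3 :> R.
  have -> : (4 : R) = 1 + 3 by ring.
  by apply: le_ln1Dx; lra.
have h2 : logr K (sqnorm 0 x) <= (K + 7) * 2 ^+ k.
  have /andP[_ h] := logr_bounds Bx; apply: le_trans h _.
  have t3 : ln (enorm x)^-1 <= 3 * k.+1%:R.
    apply: (@le_trans _ _ (ln (4 ^+ k.+1))).
      by rewrite ler_ln ?posrE ?invr_gt0 ?exprn_gt0.
    by rewrite lnXn// -[ln 4 *+ _]mulr_natr; apply: ler_wpM2r l4.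
  have k3 : 1 <= 2 ^+ k :> R by apply: exprn_ege1; lra.
  have k4 : K <= K * 2 ^+ k by apply: ler_peMr => //; move: K1; lra.
  lra.
have h3 := loglogr_pow4_le (ltW a0).
have h4 : loglogr K (sqnorm 0 x) ^+ 4 <= 8 ^+ 4 * ((K + 7) * 2 ^+ k).
  by apply: le_trans h3 _; apply: ler_wpM2l h2; rewrite exprn_ge0.
have -> : 32 = 2 * 16 :> R by ring.
have -> : 8 ^+ 4 * (K + 7) * 16 * (2 * 16) ^+ k =
    (8 ^+ 4 * ((K + 7) * 2 ^+ k)) * (16 * 16 ^+ k) :> R by rewrite exprMn; ring.
apply: ler_pM h4 h1; last exact: sqr_ge0.
by rewrite exprn_even_ge0.
Qed.

Lemma measurable_sqnorm e : measurable_fun setT (fun x => sqnorm e x).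
Proof. by apply: continuous_measurable_setT; exact: continuous_sqnorm. Qed.

Lemma majorant0 : majorant K (0 : 'rV[R]_n) = 0.
Proof. by rewrite /majorant sqnorm0_0 rsqrt0 expr0n/= mulr0. Qed.

Lemma integrable_majorant : leb.-integrable B (EFin \o majorant K).
Proof.
apply: (@integrable_of_shells _ _ _ (8 ^+ 4 * (K + 7) * 16)) => //.
- apply: measurable_funTS; apply: measurable_funM.
    by apply: measurable_funX; apply: measurable_loglogr; exact: measurable_sqnorm.
  by apply: measurable_funX; apply: measurable_rsqrt; exact: measurable_sqnorm.
- apply: mulr_ge0; last exact: ler0n.
  by apply: mulr_ge0; [rewrite exprn_ge0|move: K1; lra].
- exact: majorant0.
- by move=> x k Bx xk; rewrite ger0_norm ?majorant_ge0//; exact: majorant_shell_le.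
Qed.

Lemma integrable_cst_ball (c : R) : leb.-integrable B (EFin \o cst c).
Proof.
apply/integrableP; split; first by apply/measurable_EFinP; exact: measurable_cst.
rewrite -[X in (integral _ _ X)]/(cst `|c|%:E) integral_cst; last exact: measurable_unit_ball.
apply: lte_mul_pinfty => //.
apply: le_lt_trans (lebesgue_cube_lty ler01).
apply: le_measure; rewrite ?inE; [exact: measurable_unit_ball|exact: measurable_cube|].
by move=> x Bx; apply/cubeP => i; apply: le_trans (normr_coord_le x i) _; exact: ltW.
Qed.

End logarithms.

(** * Discontinuity at the origin *)

Section discontinuity.
Context {R : realType} {n : nat}.
Local Notation leb := (@lebesgue_rV R n).
Local Notation B := (@unit_ball R n).
Implicit Types x y : 'rV[R]_n.

Lemma lebesgue_ball_rV_gt0 x (e : R) : 0 < e -> (0 < leb (ball x e))%E.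
Proof.
move=> e0; have -> : ball x e = [set y | forall i, ball (x ord0 i) e (y ord0 i)].
  by apply/seteqP; split => y; rewrite ball_rVP.
have E : leb [set y | forall i, ball (x ord0 i) e (y ord0 i)] = ((e *+ 2) ^+ n)%:E.
  apply: eq_trans (lebesgue_rV_box (fun i => measurable_ball (x ord0 i) e)) _.
  rewrite (eq_bigr (fun=> (e *+ 2)%:E)) => [|i _]; last exact: lebesgue_measure_ball (ltW e0).
  by rewrite prodEFin prodr_const card_ord.
by rewrite [X in (_ < X)%E]E lte_fin exprn_gt0// mulrn_wgt0.
Qed.

Lemma ae_ball_rV (P : set 'rV[R]_n) x (e : R) : 0 < e ->
  {ae leb, forall y, P y} -> exists2 y, ball x e y & P y.
Proof.
move=> e0 [N [mN N0 PN]]; apply: contrapT => nP.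
have sN : ball x e `<=` N by move=> y xy; apply: PN => Py; apply: nP; exists y.
have := lebesgue_ball_rV_gt0 x e0; rewrite ltNge => /negP; apply.
by rewrite -N0; apply: le_measure => //; rewrite inE//; apply: open_measurable_rV; exact: ball_open.
Qed.

Variables (K : R) (i0 : 'I_n).
Hypothesis Ke : expR 1 <= K.

Let cone x := 0 < x ord0 i0 /\ dotrv x x <= 2 * x ord0 i0 ^+ 2.

(** On this cone the cosine is at least 1/2; as [loglogr] is at least 2, the argument of the
    hyperbolic tangent is at least 1. *)
Let profile_ge12 a (z : R) : 0 < z -> 0 < a -> a <= 2 * z ^+ 2 -> 1/2 <= profile K a z.
Proof.
move=> z0 a0 az; have v0 := vlog_gt0 Ke (ltW a0); have L2 := loglogr_ge2 Ke (ltW a0).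
have c12 : 1/2 <= cosr a z.
  rewrite /cosr ler_pdivlMr ?sqrtr_gt0//.
  rewrite -(@ler_sqr _ _ z) ?nnegrE ?mulr_ge0 ?sqrtr_ge0 ?(ltW z0)//.
  rewrite exprMn sqr_sqrtr ?(ltW a0)//; have := sqr_ge0 z; lra.
have Lc : 1 <= loglogr K a * cosr a z.
  have : 2 * (1/2) <= loglogr K a * cosr a z by apply: ler_pM.
  lra.
have t12 := tanhR_ge12 Lc; rewrite /profile /taur.
have : 0 <= vlog K a * tanhR (loglogr K a * cosr a z).
  by apply: mulr_ge0; [exact: ltW|move: t12; lra].
by rewrite mulrDl mul1r; move: t12; lra.
Qed.

(** A whole ball is needed, because a representative is known only almost everywhere. The sign [s]
    selects one of two opposite cones, exchanged by the oddness of the profile. *)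
Let cone_point (t s : R) : 0 < t -> t <= 1/4 -> s ^+ 2 = 1 -> exists2 e : R, 0 < e &
  forall y, ball ((s * t) *: delta_mx ord0 i0) e y ->
    [/\ B y, ball 0 (2 * t) y & 1/2 <= s * sol K i0 0 y].
Proof.
move=> t0 t4 s2; have n1 : 1 <= n%:R :> R by rewrite ler1n (leq_ltn_trans _ (ltn_ord i0)).
have n0 : 0 < n%:R :> R by exact: lt_le_trans n1.
(* With this radius the squares of the transverse coordinates sum to at most
   [n e^2 <= t^2 / 4 <= z^2], so the ball stays in the cone. *)
pose e := t / (2 * n%:R); have e0 : 0 < e by rewrite divr_gt0// mulr_gt0.
have ne : n%:R * e = t / 2 by rewrite /e; field; rewrite gt_eqF.
have et : e <= t / 2 by rewrite -ne ler_peMl// ltW.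
exists e => // y; rewrite ball_rVP// => py; set z := y ord0 i0.
have zt : `|s * t - z| < e by have := py i0; rewrite !mxE !eqxx mulr1.
have sE : s = 1 \/ s = -1.
  by move/eqP : s2; rewrite sqrf_eq1 => /orP[/eqP ->|/eqP ->]; [left|right].
have sz : t / 2 <= s * z /\ s * z <= 3 / 2 * t.
  by move: zt; rewrite ltr_norml; case: sE => ->; rewrite ?mul1r ?mulN1r => /andP[]; split; lra.
have z2 : z ^+ 2 = (s * z) ^+ 2 by rewrite exprMn s2 mul1r.
have z2_ge : t ^+ 2 / 4 <= z ^+ 2.
  have -> : t ^+ 2 / 4 = (t / 2) ^+ 2 by field.
  by rewrite z2; apply: lerXn2r sz.1; rewrite nnegrE; lra.
have z2_le : z ^+ 2 <= 9 / 4 * t ^+ 2.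
  have -> : 9 / 4 * t ^+ 2 = (3 / 2 * t) ^+ 2 by field.
  by rewrite z2; apply: lerXn2r sz.2; rewrite nnegrE; lra.
have yz : dotrv y y <= 2 * z ^+ 2.
  have h : dotrv y y <= \sum_(i < n) ((i == i0)%:R * z ^+ 2 + e ^+ 2).
    apply: ler_sum => i _; rewrite -expr2; have [->|ii] := eqVneq i i0.
      by rewrite mul1r lerDl sqr_ge0.
    rewrite mul0r add0r -real_normK ?num_real//.
    apply: lerXn2r; rewrite ?nnegrE ?(ltW e0)// ltW//.
    by have := py i; rewrite !mxE (negbTE ii) andbF mulr0 sub0r normrN.
  apply: le_trans h _; rewrite big_split/= sumr_const card_ord.
  rewrite (bigD1 i0)//= eqxx mul1r big1 ?addr0 => [|i /negbTE ->]; last by rewrite mul0r.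
  have : e ^+ 2 *+ n <= t ^+ 2 / 4; last by move: z2_ge; lra.
  rewrite -mulr_natl expr2 mulrA ne.
  have -> : t ^+ 2 / 4 = (t / 2) * (t / 2) by field.
  by apply: ler_wpM2l et; lra.
have tt : t ^+ 2 <= 1 / 16.
  have -> : 1 / 16 = (1 / 4) ^+ 2 :> R by field.
  by apply: lerXn2r t4; rewrite nnegrE; lra.
split.
- rewrite /unit_ball/= -(@expr_lt1 _ 2)// ?enorm_ge0// sqr_enorm.
  by move: yz z2_le tt; lra.
- rewrite ball_rVP ?mulr_gt0// => i; rewrite mxE sub0r normrN.
  have [->|ii] := eqVneq i i0.
    rewrite -/z ltr_norml; case: sE sz => ->; rewrite ?mul1r ?mulN1r => -[h1 h2];
      by apply/andP; split; lra.
  have := py i; rewrite !mxE (negbTE ii) andbF mulr0 sub0r normrN; move: et; lra.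
- have z1 : 0 < s * z by move: sz.1; lra.
  have a0 : 0 < sqnorm 0 y.
    rewrite sqnorm0 -sqnorm0; apply: lt_le_trans (sqr_coord_le_sqnorm y i0 (lexx 0)).
    by rewrite -/z z2 exprn_gt0.
  have h : 1/2 <= profile K (sqnorm 0 y) (s * z).
    by apply: profile_ge12 => //; rewrite sqnorm0 -z2.
  apply: le_trans h _; rewrite /sol -/z.
  by case: sE => ->; rewrite ?mul1r// !mulN1r /profile taurN mulrN.
Qed.

(** Arbitrarily close to 0 a representative takes values at least 1/2 and values at most -1/2.
    Continuity at 0 with tolerance 1/4 would give both [w 0 >= 1/4] and [w 0 <= -1/4]. *)
Lemma sol_no_continuous_representative : ~ continuous_representative_at0 (sol K i0 0).
Proof.
move=> [w [wu /cvgrPdist_lt cw]].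
have /nbhs_ballP[d /= d0 dw] := cw (1/4) ltac:(lra).
have [t [t0 t4 td]] : exists t : R, [/\ 0 < t, t <= 1/4 & 2 * t <= d].
  exists (Num.min d 1 / 4); have : 0 < Num.min d 1 by rewrite lt_min d0/=.
  have : Num.min d 1 <= 1 by rewrite ge_min lexx orbT.
  have : Num.min d 1 <= d by rewrite ge_min lexx.
  by set m := Num.min d 1; clearbody m => h1 h2 h3; split; lra.
have near_w (s : R) : s ^+ 2 = 1 -> 1/4 <= s * w 0.
  move=> s2; have [e e0 he] := cone_point t0 t4 s2.
  have [y /he[By ty uy] wy] := ae_ball_rV ((s * t) *: delta_mx ord0 i0) e0 wu.
  have : `|w 0 - w y| < 1/4.
    by apply: dw; exact: le_ball ty.
  rewrite wy//; move/eqP : s2 uy; rewrite sqrf_eq1 => /orP[/eqP ->|/eqP ->];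
    rewrite ?mul1r ?mulN1r ltr_norml => uy /andP[]; lra.
have := near_w 1 (expr1n _ _); have := near_w (-1) ltac:(by rewrite sqrrN expr1n).
by rewrite mul1r mulN1r; lra.
Qed.

End discontinuity.

(** * The coefficients, their ellipticity and the weak equation *)

Section assembly.
Context {R : realType} {n : nat}.
Variables (K : R) (i0 : 'I_n).
Hypotheses (n3 : (3 <= n)%N) (Ke : expR 1 <= K) (Kn : 32 * (n%:R + 1) <= K).
Implicit Types (x xi : 'rV[R]_n) (e : R) (i j : 'I_n) (k : nat).
Local Notation B := (@unit_ball R n).
Local Notation leb := (@lebesgue_rV R n).
Local Notation "''e_' i" := (delta_mx ord0 i : 'rV[R]_n) (at level 8, i at level 2).
Local Notation nr := (n%:R : R).

Let K1 : 1 <= K. Proof. by apply: le_trans Ke; rewrite -expR0 ler_expR. Qed.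

Local Notation fc := (@flux_const R n).
Local Notation c3 := (ln (K + 1) + 1).
(** The rank-one matrix is bounded by [1 + 2 fc L^2]. Here [L^2 = 4 T^2] for
    [T = ln (logr K |x|^2)], and [c3] bounds [T] by the iterated logarithm of the theorem. *)
Definition ellipticity_const : R := 4 * (1 + 2 * fc) * c3 ^+ 2.
Local Notation C := ellipticity_const.
Local Notation Lam := (@loglog_sq R n C).
Local Notation L x := (loglogr K (sqnorm 0 x)).

Let fc0 : 0 <= fc. Proof. exact: flux_const_ge0. Qed.
Let c31 : 1 <= c3.
Proof. by rewrite lerDr ln_ge0//; move: K1; lra. Qed.

Lemma ellipticity_const_ge4 : 4 <= C.
Proof.
rewrite /C -mulrA ler_peMr// mulr_ege1//; first by rewrite lerDl mulr_ge0.
by rewrite exprn_ege1.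
Qed.

Let C0 : 0 <= C. Proof. by apply: le_trans ellipticity_const_ge4. Qed.

(** The second inequality serves ellipticity; the third, in the opposite direction, lets [majorant]
    dominate [Lam] and the weighted gradients. *)
Let Lam_bounds x : B x ->
  [/\ 1 <= Lam x, 1 + 2 * (fc * L x ^+ 2) <= Lam x & 4 * Lam x <= C * L x ^+ 2].
Proof.
move=> Bx; have /andP[l1 l2] := loglog_le Ke Bx; have l3 := ln_logr_le Ke Bx.
have L2 : 2 <= L x by apply: loglogr_ge2 => //; exact: sqnorm_ge0.
have C4 := ellipticity_const_ge4.
have LE : L x = 2 * ln (logr K (sqnorm 0 x)) by [].
rewrite /loglog_sq; set l := ln (expR 1 + _) in l1 l2 l3 *.
set T := ln (logr K _) in LE l2 l3; have l0 : 0 <= l by apply: le_trans l1.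
have T1 : 1 <= T by apply: le_trans l2.
have ll : 1 <= l ^+ 2 by exact: exprn_ege1.
have TT : T ^+ 2 <= c3 ^+ 2 * l ^+ 2.
  by rewrite -exprMn; apply: lerXn2r l3; rewrite nnegrE ?mulr_ge0//;
    [apply: le_trans T1|apply: le_trans c31].
have lT : l ^+ 2 <= T ^+ 2.
  by apply: lerXn2r l2; rewrite nnegrE//; apply: le_trans T1.
have TT1 : 1 <= T ^+ 2 by exact: exprn_ege1.
have L4 : L x ^+ 2 = 4 * T ^+ 2 by rewrite LE exprMn; congr (_ * _); ring.
split.
- by apply: le_trans (ler_wpM2l C0 ll); rewrite mulr1; move: C4; lra.
- apply: (@le_trans _ _ (4 * (1 + 2 * fc) * T ^+ 2)).
    rewrite L4 mulrDr mulr1 mulrDl; apply: lerD; first by move: TT1; lra.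
    by rewrite le_eqVlt; apply/orP; left; apply/eqP; ring.
  rewrite /C -[leRHS]mulrA; apply: ler_wpM2l TT.
  by apply: mulr_ge0 => //; apply: addr_ge0 => //; exact: mulr_ge0.
- by rewrite L4 mulrCA; apply: (ler_wpM2l C0); rewrite ler_pM2l.
Qed.

Definition coefficients x : 'M[R]_n := rank_one_mx (sol_flux K i0 0 x) (sol_grad K i0 0 x).
Local Notation A := coefficients.

Let G2F x : B x -> 2 * dotrv (sol_grad K i0 0 x) (sol_grad K i0 0 x) <= dotrv (sol_flux K i0 0 x)
  (sol_grad K i0 0 x).
Proof. by move=> Bx; have [] := sol_flux_bounds i0 n3 Ke Kn Bx. Qed.

Let FF x : B x -> dotrv (sol_flux K i0 0 x) (sol_flux K i0 0 x) <=
  fc * L x ^+ 2 * dotrv (sol_flux K i0 0 x) (sol_grad K i0 0 x).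
Proof. by move=> Bx; have [] := sol_flux_bounds i0 n3 Ke Kn Bx. Qed.

Lemma coefficients_elliptic x xi : B x ->
  dotrv xi xi <= dotrv (mulmrv (A x) xi) xi <= Lam x * dotrv xi xi.
Proof.
move=> Bx; have cL : 0 <= fc * L x ^+ 2 by apply: mulr_ge0 => //; exact: sqr_ge0.
have /andP[h1 h2] := rank_one_elliptic (G2F Bx) (FF Bx) xi cL.
apply/andP; split => //; apply: le_trans h2 _; apply: ler_wpM2r; first exact: dotrv_ge0.
by have [_ h _] := Lam_bounds Bx.
Qed.

Let mz : measurable_fun setT (fun x => x ord0 i0). Proof. exact: measurable_coord. Qed.

Let mc (c : R) : measurable_fun setT (fun _ : 'rV[R]_n => c). Proof. exact: measurable_cst. Qed.

Lemma measurable_sol e : measurable_fun setT (sol K i0 e).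
Proof. exact: measurable_profile (measurable_sqnorm e) mz. Qed.

Lemma measurable_grad_u e i : measurable_fun setT (fun x => grad_u K i0 e x i).
Proof.
have ms := @measurable_sqnorm R n e.
exact: (measurable_funD
 (measurable_funM (measurable_funM (measurable_funB (measurable_profile_r K ms mz)
   (measurable_funM (measurable_cosr ms mz) (measurable_profile_c K ms mz)))
   (measurable_funX 2 (measurable_rsqrt ms))) (measurable_coord i))
 (measurable_funM (measurable_funM (measurable_profile_c K ms mz) (measurable_rsqrt ms)) (mc _))).
Qed.

Let measurable_grad_m e i : measurable_fun setT (fun x => grad_m K i0 e x i).
Proof.
have ms := @measurable_sqnorm R n e.
exact: (measurable_funD
 (measurable_funM (measurable_funM (measurable_stream_x K ms mz)
   (measurable_funX 3 (measurable_rsqrt ms))) (measurable_coord i))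
 (measurable_funM (measurable_funM (measurable_stream_c K ms mz)
   (measurable_funX 2 (measurable_rsqrt ms))) (mc _))).
Qed.

Lemma measurable_flux e i : measurable_fun setT (fun x => flux K i0 e x i).
Proof.
have ms := @measurable_sqnorm R n e.
have h : measurable_fun setT (fun x => \sum_j x ord0 j * grad_m K i0 e x j).
  apply: measurable_sum => j.
  exact: (measurable_funM (measurable_coord j) (measurable_grad_m e j)).
exact: (measurable_funB (measurable_funM (measurable_funD (measurable_funM (mc _)
  (measurable_funM (measurable_stream K ms mz) (measurable_rsqrt ms))) h) (mc _))
  (measurable_funM (measurable_grad_m e i0) (measurable_coord i))).
Qed.

Let msol_grad e i : measurable_fun setT (fun x => sol_grad K i0 e x ord0 i).
Proof.
rewrite (_ : (fun x => _) = (fun x => grad_u K i0 e x i)); first exact: measurable_grad_u.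
by apply/funext => x; rewrite mxE.
Qed.

Let msol_flux e i : measurable_fun setT (fun x => sol_flux K i0 e x ord0 i).
Proof.
rewrite (_ : (fun x => _) = (fun x => flux K i0 e x i)); first exact: measurable_flux.
by apply/funext => x; rewrite mxE.
Qed.

Lemma measurable_coefficients i j : measurable_fun setT (fun x => A x i j).
Proof.
pose h l x : R := sol_flux K i0 0 x ord0 l - sol_grad K i0 0 x ord0 l.
have mh l : measurable_fun setT (h l) by exact: (measurable_funB (msol_flux 0 l) (msol_grad 0 l)).
rewrite (_ : (fun x => _) = (fun x => (i == j)%:R +
    (\sum_l h l x * sol_grad K i0 0 x ord0 l)^-1 * (h i x * h j x))).
  apply: (measurable_funD (mc _)).
  apply: measurable_funM (measurable_funM (mh i) (mh j)).
  apply: measurable_funV; apply: measurable_sum => l.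
  exact: (measurable_funM (mh l) (msol_grad 0 l)).
apply/funext => x; rewrite /coefficients /rank_one_mx !mxE; congr (_ + _ * _).
  by congr (_^-1); apply: eq_bigr => l _; rewrite /h !mxE.
by rewrite big_ord1 /h !mxE.
Qed.

Lemma measurable_loglog_sq (c : R) : measurable_fun setT (@loglog_sq R n c).
Proof.
apply: (measurable_funM (mc _)); apply: measurable_funX.
apply: (measurableT_comp (@measurable_ln R)); apply: (measurable_funD (mc _)).
apply: (measurableT_comp (@measurable_ln R)); apply: measurable_funV.
by apply: continuous_measurable_setT; exact: continuous_enorm.
Qed.

(** 81 comes from the gradient bound [sqr_grad_u_le], [2000 n] from [flux_le_majorant]. The summand
    1 in [D] covers the origin, where [majorant] is 0 but [Lam] equals [C]. *)
Let cD : R := 81 * C + 2000 * nr.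
Let D x : R := cD * (1 + majorant K x).

Let cD_C : 81 * C <= cD.
Proof. by rewrite /cD lerDl; apply: mulr_ge0; exact: ler0n. Qed.

Let cD_n : 2000 * nr <= cD.
Proof. by rewrite /cD lerDr; apply: mulr_ge0 => //; exact: ler0n. Qed.

Let CD x : 81 * C * (1 + majorant K x) <= D x.
Proof. by apply: ler_wpM2r cD_C; have := majorant_ge0 K x; lra. Qed.

Let sqr_L_le x : B x -> x <> 0 -> L x ^+ 2 <= majorant K x.
Proof.
move=> Bx x0; have a0 := sqnorm0_gt0 x0.
have L2 : 2 <= L x by apply: loglogr_ge2 => //; exact: ltW.
have L1 : 1 <= L x ^+ 2 by apply: exprn_ege1; move: L2; lra.
have -> : majorant K x = L x ^+ 2 * (L x ^+ 2 * rsqrt (sqnorm 0 x) ^+ 2).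
  by rewrite /majorant; ring.
rewrite ler_peMr ?sqr_ge0// mulr_ege1// sqr_rsqrt// invf_ge1//; exact: sqnorm0_le1.
Qed.

Let LamD x : B x -> Lam x <= D x.
Proof.
move=> Bx; apply: le_trans (CD x); have m0 := majorant_ge0 K x.
have [->|/eqP x0] := eqVneq x 0.
  rewrite majorant0 /loglog_sq /enorm dotrvE mul0mx mxE sqrtr0 invr0 [ln 0]ln0// !addr0 expRK
    expr1n.
  by move: C0; lra.
have [_ _ h] := Lam_bounds Bx; have := ler_wpM2l C0 (sqr_L_le Bx x0).
have : 0 <= C * majorant K x by exact: mulr_ge0.
by move: C0; lra.
Qed.

Let Lam_grad_le e x i : 0 <= e -> B x -> x <> 0 -> Lam x * grad_u K i0 e x i ^+ 2 <= D x.
Proof.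
move=> e0 Bx x0; apply: le_trans (CD x).
have [_ _ h] := Lam_bounds Bx; have g := @sqr_grad_u_le _ _ K i0 Ke e x i x0 e0.
have h1 := ler_wpM2r (sqr_ge0 (grad_u K i0 e x i)) h.
have h2 := ler_wpM2l C0 g.
have l0 : 0 <= Lam x by have [l1 _ _] := Lam_bounds Bx; apply: le_trans l1.
have l1 : 0 <= Lam x * grad_u K i0 e x i ^+ 2 by apply: mulr_ge0 => //; exact: sqr_ge0.
by move: C0; lra.
Qed.

Let cvg_eps : (k.+1%:R^-1 : R) @[k --> \oo] --> (0 : R).
Proof. by have [] := @harmonic_steps R. Qed.

Let eps0 k : 0 < k.+1%:R^-1 :> R. Proof. by rewrite invr_gt0. Qed.

Let cvg_sqnorm x : sqnorm k.+1%:R^-1 x @[k --> \oo] --> sqnorm 0 x.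
Proof. exact: (cvgD (cvg_cst _) cvg_eps). Qed.

Lemma weak_solution_sol : weak_solution A Lam (sol K i0 0).
Proof.
apply: (@weak_solution_of_limit R n A Lam D (sol K i0 0) (sol_grad K i0 0) (sol_flux K i0 0)
  (fun k => sol K i0 k.+1%:R^-1) (fun k => sol_flux K i0 k.+1%:R^-1)).
- exact: leq_trans n3.
- by move=> i j; apply: measurable_funTS; exact: measurable_coefficients.
- by move=> x _; exact: rank_one_mx_sym.
- by move=> x Bx xi; exact: coefficients_elliptic.
- by move=> x Bx; exact: mulmrv_rank_one_grad (G2F Bx) (FF Bx).
- by apply: measurable_funTS; exact: measurable_loglog_sq.
- by move=> x Bx; have [] := Lam_bounds Bx.
- by apply: measurable_funTS; exact: measurable_sol.
- by move=> i; apply: measurable_funTS; exact: msol_grad.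
- by move=> i; apply: measurable_funTS; exact: msol_flux.
- have iM := integrableDR measurable_unit_ball (integrable_cst_ball 1) (integrable_majorant n3 Ke).
  exact: (integrableZR measurable_unit_ball cD iM).
- exact: LamD.
- by move=> x _; exact: normr_sol_le2.
- move=> x i Bx; have [->|/eqP x0] := eqVneq x 0; last by rewrite mxE; exact: Lam_grad_le.
  rewrite sol_grad0 mxE expr0n/= mulr0; apply: le_trans (CD 0).
  by rewrite majorant0 addr0 mulr1; apply: mulr_ge0.
- by move=> k; exact: (C1_sol i0 K1 (eps0 k)).2.
- by move=> k; exact: (C1_sol i0 K1 (eps0 k)).1.
- by move=> k x _; apply: normr_sol_le2 => //; exact: ltW.
- by move=> k x i Bx x0; rewrite pd_sol//; apply: Lam_grad_le => //; exact: ltW.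
- move=> x Bx x0; apply: (@cvg_sol _ _ _ _ K1 _ _ _ _ _ (fun=> x)) => //.
  + by move=> i; exact: cvg_cst.
  + exact: sqnorm0_gt0.
- move=> x i Bx x0; rewrite mxE; under eq_fun do rewrite pd_sol//.
  apply: (@cvg_grad_u _ _ _ _ K1 _ _ _ _ _ (fun=> x)) => //.
  + by move=> j; exact: cvg_cst.
  + exact: sqnorm0_gt0.
- by move=> k i; apply: measurable_funTS; exact: msol_flux.
- move=> k x i Bx x0; rewrite mxE.
  apply: le_trans (flux_le_majorant i0 n3 Ke i x0 (ltW (eps0 k))) _.
  by apply: ler_wpM2r cD_n; have := majorant_ge0 K x; lra.
- move=> x i Bx x0; rewrite mxE; under eq_fun do rewrite mxE.
  apply: (@cvg_flux _ _ _ _ K1 _ _ _ _ _ (fun=> x)) => //.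
  + by move=> j; exact: cvg_cst.
  + exact: sqnorm0_gt0.
- move=> k phi C1phi phi1; under eq_integral do under eq_bigr do rewrite mxE.
  exact: divergence_free.
Qed.

End assembly.

Theorem theorem1p2 (R : realType) (n : nat) (hn : (3 <= n)%N) :
  exists C : R, 0 < C /\
  exists (A : 'rV[R]_n -> 'M[R]_n) (u : 'rV[R]_n -> R),
    [/\ measurable_symmetric A,
        elliptic A (loglog_sq C),
        weak_solution A (loglog_sq C) u &
        ~ continuous_representative_at0 u].
Proof.
have n0 : (0 < n)%N by exact: leq_trans hn.
(* The two summands meet the two lower bounds required of [K]: [e] gives [loglogr >= 2], and
   [32 (n + 1)] gives [32 v (mu + 2) <= 1]. As [K] depends on [n] alone, so does the ellipticity
   constant. *)
pose i0 := Ordinal n0; pose K : R := expR 1 + 32 * (n%:R + 1).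
have Ke : expR 1 <= K by rewrite lerDl mulr_ge0// addr_ge0.
have Kn : 32 * (n%:R + 1) <= K by rewrite lerDr expR_ge0.
exists (@ellipticity_const R n K); split.
  exact: lt_le_trans (@ellipticity_const_ge4 R n K Ke).
exists (coefficients K i0), (sol K i0 0); split.
- split; last by move=> x _; exact: rank_one_mx_sym.
  apply: measurable_funTS; apply/measurable_fun_matrixP => i j.
  exact: measurable_coefficients.
- by apply: aeW => x Bx xi; rewrite sqr_enorm; exact: coefficients_elliptic.
- exact: weak_solution_sol.
- exact: sol_no_continuous_representative.
Qed.
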